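(* Let $X$ be a complete geodesic space. Let $1<p<\infty$ and $0<\beta\le 1$. Let $E\subset X$ be a closed set. Then the following conditions are equivalent: (1) $\overline{\mathrm{co\,dim}}_A(E)<\beta p$. (2) $E$ satisfies a Hausdorff content density condition for some $0<q<\beta p$, that is, there are $0<q<\beta p$ and a constant $C>0$ such that $\mathcal{H}^{\mu,q}_r(E\cap\overline{B(x,r)})\ge C r^{-q}\mu(B(x,r))$ for every $x\in E$ and all $0<r<\operatorname{diam}(E)$. (3) $E$ satisfies the $(\beta,p)$-capacity density condition. (4) $E$ satisfies the local $(\beta,p,p)$-boundary Poincar\'e inequality: there is a constant $K$ such that for every $w\in E$ and $0<R<\operatorname{diam}(E)$, with $Q=B(w,R/128)$, $Q^*=4Q$ and $E_Q$ the truncation of $E$ to $Q$, the inequality $$\frac{1}{\mu(B)}\int_B|u(x)|^p\,d\mu(x)\le K\operatorname{diam}(B)^{\beta p}\,\frac1{\mu(B)}\int_B g(x)^p\,d\mu(x)$$ holds for every ball $B\subset Q^*$ with center $x_B\in E_Q$, every $\beta$-H\''older function $u$ in $X$ with $u=0$ in $E_Q$, and every $g\in\mathcal{D}_H^\beta(u)$. (5) $E$ satisfies the maximal $(\beta,p,p)$-boundary Poincar\'e inequality: there is a constant $C$ such that for every $w\in E$ and $0<R<\operatorname{diam}(E)$, with $B_0=B(w,R)$, $Q=B(w,R/128)$, $E_Q$ the truncation of $E$ to $Q$, and $\mathcal{B}_0$ the family of all balls contained in $B_0$, the inequality $$\int_{B_0}\big(M^{\sharp,p}_{\beta,\mathcal{B}_0}u+M^{E_Q,p}_{\beta,\mathcal{B}_0}u\big)^p\,d\mu\le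 C\int_{B_0}g^p\,d\mu$$ holds for every $u\in\mathrm{Lip}_\beta(X)$ with $u=0$ in $E_Q$ and every $g\in\mathcal{D}_H^\beta(u)$. (6) $E$ satisfies the local $(\beta,p,p)$-Hardy inequality: there is a constant $C$ such that for every $w\in E$ and $0<R<\operatorname{diam}(E)$, with $Q=B(w,R/128)$ and $E_Q$ the truncation of $E$ to $Q$, the inequality $$\int_{B(w,R)\setminus E_Q}\frac{|u(x)|^p}{d(x,E_Q)^{\beta p}}\,d\mu(x)\le C\int_{B(w,R)}g(x)^p\,d\mu(x)$$ holds for every $u\in\mathrm{Lip}_\beta(X)$ with $u=0$ in $E_Q$ and every $g\in\mathcal{D}_H^\beta(u)$.
   Context: Standing assumptions: $X=(X,d,\mu)$ is a metric measure space with $\#X\ge 2$, equipped with a metric $d$ and a positive complete Borel measure $\mu$ (extended as a Borel regular outer measure) such that $0<\mu(B)<\infty$ for all balls $B$. Balls are open sets $B(x,r)=\{y\in X: d(y,x)<r\}$ with $r>0$ (given with their center and radius), $tB=B(x,tr)$ for $B=B(x,r)$ and $t>0$, and $\overline{A}$ is the closure of $A$. The measure $\mu$ is doubling: there is a constant $c_\mu>1$ with $\mu(2B)\le c_\mu\,\mu(B)$ for all balls $B$. $X$ is a geodesic space if every pair of points can be joined by a (rectifiable, continuous) curve whose length equals the distance between the two points. Write $u_B=\frac1{\mu(B)}\int_B u\,d\mu$; $d(x,A)$ is the distance from $x$ to $A$. $\beta$-H\''older functions: $u:X\to\mathbb{R}$ is $\beta$-H\''older ($0<\beta\le 1$) if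 there is $0\le\kappa<\infty$ with $|u(x)-u(y)|\le\kappa\,d(x,y)^\beta$ for all $x,y\in X$; the set of these is $\mathrm{Lip}_\beta(X)$. Haj{\l}asz gradients: for $u:X\to\mathbb{R}$, $\mathcal{D}_H^\beta(u)$ is the family of all measurable $g:X\to[0,\infty]$ for which there is a set $N$ with $\mu(N)=0$ such that $|u(x)-u(y)|\le d(x,y)^\beta(g(x)+g(y))$ for all $x,y\in X\setminus N$. Capacity: for $\Omega\subset X$ open and $F\subset\Omega$ with $\mathrm{dist}(F,X\setminus\Omega)>0$, $\mathrm{cap}_{\beta,p}(F,\Omega)=\inf_u\inf_g\int_X g^p\,d\mu$, the infimums being over all $\beta$-H\''older functions $u$ in $X$ with $u\ge1$ in $F$ and $u=0$ in $X\setminus\Omega$, and over all $g\in\mathcal{D}_H^\beta(u)$. A closed set $E\subset X$ satisfies the $(\beta,p)$-capacity density condition if there is a constant $c_0>0$ such that $\mathrm{cap}_{\beta,p}(E\cap\overline{B(x,r)},B(x,2r))\ge c_0r^{-\beta p}\mu(B(x,r))$ for all $x\in E$ and all $0<r<(1/8)\operatorname{diam}(E)$. Upper Assouad codimension: for $r>0$ let $E_r=\{x\in X: d(x,E)<r\}$. $\overline{\mathrm{co\,dim}}_A(E)$ is the infimum of all $Q\ge0$ for which there is $c>0$ such that $\frac{\mu(E_r\cap B(x,R))}{\mu(B(x,R))}\ge c\left(\frac rR\right)^Q$ for every $x\in E$ and all $0<r<R<\operatorname{diam}(E)$. If $\operatorname{diam}(E)=0$, the restriction $R<\operatorname{diam}(E)$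 is removed. Hausdorff content of codimension $q\ge0$: $\mathcal{H}^{\mu,q}_\rho(F)=\inf\{\sum_k\mu(B(x_k,r_k))r_k^{-q}: F\subset\bigcup_kB(x_k,r_k),\ 0<r_k\le\rho\}$. Truncation: for $Q=B(w,r_Q)$ with $w\in E$, let $E_Q^0=E\cap\overline{\tfrac12Q}$, $E_Q^j=\bigcup_{x\in E_Q^{j-1}}E\cap\overline{B(x,2^{-j-1}r_Q)}$ for $j=1,2,\dots$, and $E_Q=\overline{\bigcup_{j\ge0}E_Q^j}$. Maximal functions: for a nonempty family $\mathcal{B}$ of balls and $u\in\mathrm{Lip}_\beta(X)$, $$M^{\sharp,p}_{\beta,\mathcal{B}}u(x)=\sup_{x\in B\in\mathcal{B}}\Big(\frac{1}{\operatorname{diam}(B)^{\beta p}}\frac1{\mu(B)}\int_B|u-u_B|^p\,d\mu\Big)^{1/p},$$ and, if $u=0$ in $E_Q$, $$M^{E_Q,p}_{\beta,\mathcal{B}}u(x)=\sup_{x\in B\in\mathcal{B}}\Big(\frac{\mathbf{1}_{E_Q}(x_B)}{\operatorname{diam}(B)^{\beta p}}\frac1{\mu(B)}\int_B|u|^p\,d\mu\Big)^{1/p},$$ where $x_B$ is the center of $B$; the supremums are zero if no ball of $\mathcal{B}$ contains $x$.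
   Formalization: The set E is assumed not to be a single point: for E={x0}, conditions (2)-(6) hold vacuously since diam(E)=0, while (1) can fail (in the plane with β=1, p=3/2, a point has upper codimension 2>βp). *)

(* Defs.v *)
From HB Require Import structures.
From mathcomp Require Import all_boot all_order all_algebra.
From mathcomp Require Import all_classical all_reals all_analysis measurable_realfun.

Set Implicit Arguments.
Unset Strict Implicit.
Unset Printing Implicit Defensive.

Import Order.TTheory GRing.Theory Num.Theory.
Import numFieldNormedType.Exports.

Local Open Scope classical_set_scope.
Local Open Scope ring_scope.
Local Open Scope ereal_scope.

(* The two structures are unrelated here: measurability of the open sets is the
   first clause of [complete_borel_regular]. *)
#[short(type="metricMeasurableType")]
HB.structure Definition MetricMeasurable (R : numDomainType) (d : measure_display) :=
  {T of Metric R T & Measurable d T}.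

#[short(type="completeMetricMeasurableType")]
HB.structure Definition CompleteMetricMeasurable (R : numDomainType)
    (d : measure_display) :=
  {T of Metric R T & Complete T & Measurable d T}.

Section metric.
Context (R : realType) (X : metricType R).
Implicit Types (A : set X) (x y : X) (r : R).

(* [maxe 0] makes the diameter of the empty set 0 instead of -oo. *)
Definition diam A : \bar R :=
  maxe 0 (ereal_sup [set (mdist xy.1 xy.2)%:E | xy in A `*` A]).

(* [s] lists the points of the partition of [a, b] after [a], as in
   [variation], which is restricted to real-valued functions. *)
Definition curve_variation (a b : R) (gamma : R -> X) (s : seq R) : R :=
  let F := gamma \o nth b (a :: s) in
  (\sum_(0 <= n < size s) mdist (F n) (F n.+1))%R.

Definition curve_length (a b : R) (gamma : R -> X) : \bar R :=
  ereal_sup [set (curve_variation a b gamma s)%:E | s in itv_partition a b].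

Definition geodesic_space : Prop :=
  forall x y, exists a b (gamma : R -> X),
    [/\ (a <= b)%R, {within `[a, b], continuous gamma},
        gamma a = x, gamma b = y &
        curve_length a b gamma = (mdist x y)%:E].

Definition holder (beta : R) (u : X -> R) : Prop :=
  exists2 kappa : R, (0 <= kappa)%R &
    forall x y, (`|u x - u y| <= kappa * mdist x y `^ beta)%R.

Definition neighborhood A r : set X := [set x | edist_inf A x < r%:E].

Fixpoint truncation_step (E : set X) (w : X) (rQ : R) (j : nat) : set X :=
  match j with
  | 0%N => E `&` closure (ball w (2^-1 * rQ)%R)
  | i.+1 => \bigcup_(x in truncation_step E w rQ i)
              (E `&` closure (ball x (2 ^- i.+2 * rQ)%R))
  end.

(* E_Q for Q = B(w, rQ) *)
Definition truncation (E : set X) (w : X) (rQ : R) : set X :=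
  closure (\bigcup_j truncation_step E w rQ j).

End metric.

Section metric_measure.
Context (R : realType) (d : measure_display) (X : metricMeasurableType R d).
Variable mu : {measure set X -> \bar R}.
Implicit Types (A B E F : set X) (x w : X) (r : R).

(* [mu_ext mu] is the outer measure that extends [mu] to all subsets. *)
Definition complete_borel_regular : Prop :=
  [/\ forall A, open A -> measurable A,
      measure_is_complete mu &
      forall A, exists B, [/\ <<s open >> B, A `<=` B & mu B = mu_ext mu A]].

Definition balls_pos_finite : Prop :=
  forall x r, (0 < r)%R -> 0 < mu (ball x r) < +oo.

Definition doubling : Prop :=
  exists2 c : R, (1 < c)%R &
    forall x r, (0 < r)%R -> mu (ball x (2 * r)%R) <= c%:E * mu (ball x r).

Definition average B (f : X -> \bar R) : \bar R :=
  (mu B)^-1 * \int[mu]_(x in B) f x.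

Definition hajlasz_gradient (beta : R) (u : X -> R) (g : X -> \bar R) : Prop :=
  [/\ measurable_fun setT g, forall x, 0 <= g x &
      exists2 N, mu.-negligible N &
        forall x y, ~ N x -> ~ N y ->
          `|u x - u y|%:E <= (mdist x y `^ beta)%:E * (g x + g y)].

Definition capacity (beta p : R) F (Omega : set X) : \bar R :=
  ereal_inf [set c | exists u g,
    [/\ holder beta u,
        forall x, F x -> (1 <= u x)%R,
        forall x, ~ Omega x -> u x = 0%R,
        hajlasz_gradient beta u g &
        c = \int[mu]_x (g x `^ p)]].

Definition capacity_density (beta p : R) E : Prop :=
  exists2 c0 : R, (0 < c0)%R &
    forall x r, E x -> (0 < r)%R -> r%:E < (8^-1)%:E * diam E ->
      (c0 * r `^ (- (beta * p)))%:E * mu (ball x r)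
        <= capacity beta p (E `&` closure (ball x r)) (ball x (2 * r)%R).

(* When [diam E = 0] there is no upper bound on the outer radius. Hence for a
   one-point set this notion carries information, whereas the density, Poincare
   and Hardy conditions below, which quantify over radii smaller than (a multiple
   of) [diam E], hold vacuously: in the plane, a point has upper codimension 2. *)
Definition upper_codim E : \bar R :=
  ereal_inf [set Q%:E | Q in [set Q : R | (0 <= Q)%R /\
    exists2 c : R, (0 < c)%R &
      forall x r r', E x -> (0 < r < r')%R -> diam E = 0 \/ r'%:E < diam E ->
        (c * (r / r') `^ Q)%:E
          <= mu (neighborhood E r `&` ball x r') / mu (ball x r')]].

(* The index set [K] ranges over all sets of naturals so that finite covers are
   allowed too. *)
Definition hausdorff_content (q rho : R) F : \bar R :=
  ereal_inf [set s | exists (K : set nat) (x : nat -> X) (r : nat -> R),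
    [/\ forall k, K k -> (0 < r k <= rho)%R,
        F `<=` \bigcup_(k in K) ball (x k) (r k) &
        s = \esum_(k in K) (mu (ball (x k) (r k)) * (r k `^ (- q))%:E)]].

Definition content_density (q : R) E : Prop :=
  exists2 C : R, (0 < C)%R &
    forall x r, E x -> (0 < r)%R -> r%:E < diam E ->
      (C * r `^ (- q))%:E * mu (ball x r)
        <= hausdorff_content q r (E `&` closure (ball x r)).

(* A ball is given by its center and radius, hence families of balls are sets
   of pairs. Inserting 0 makes the supremum over no ball equal to 0 and does not
   affect the other ones. *)
Definition sharp_maximal (beta p : R) (Bs : set (X * R)) (u : X -> R) x
    : \bar R :=
  ereal_sup (0 |` [set
    (let B := ball b.1 b.2 in
     let uB := fine (average B (EFin \o u)) in
     (average B (fun y => (`|u y - uB| `^ p)%:E) / diam B `^ (beta * p)) `^ p^-1)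
    | b in [set b | Bs b /\ ball b.1 b.2 x]]).

Definition boundary_maximal (beta p : R) (Bs : set (X * R)) (EQ : set X)
    (u : X -> R) x : \bar R :=
  ereal_sup (0 |` [set
    (let B := ball b.1 b.2 in
     ((\1_EQ b.1)%:E * average B (fun y => (`|u y| `^ p)%:E)
        / diam B `^ (beta * p)) `^ p^-1)
    | b in [set b | Bs b /\ ball b.1 b.2 x]]).

Definition local_boundary_poincare (beta p : R) E : Prop :=
  exists K : R, forall w r, E w -> (0 < r)%R -> r%:E < diam E ->
    let rQ := (r / 128)%R in
    let EQ := truncation E w rQ in
    forall xB rB, (0 < rB)%R -> EQ xB ->
    let B := ball xB rB in
    B `<=` ball w (4 * rQ)%R ->
    forall u g, holder beta u -> (forall x, EQ x -> u x = 0%R) ->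
      hajlasz_gradient beta u g ->
      average B (fun x => (`|u x| `^ p)%:E)
        <= K%:E * diam B `^ (beta * p) * average B (fun x => g x `^ p).

Definition maximal_boundary_poincare (beta p : R) E : Prop :=
  exists C : R, forall w r, E w -> (0 < r)%R -> r%:E < diam E ->
    let B0 := ball w r in
    let EQ := truncation E w (r / 128)%R in
    let Bs0 := [set b : X * R | (0 < b.2)%R /\ ball b.1 b.2 `<=` B0] in
    forall u g, holder beta u -> (forall x, EQ x -> u x = 0%R) ->
      hajlasz_gradient beta u g ->
      \int[mu]_(x in B0)
          (sharp_maximal beta p Bs0 u x + boundary_maximal beta p Bs0 EQ u x) `^ p
        <= C%:E * \int[mu]_(x in B0) (g x `^ p).

Definition local_hardy (beta p : R) E : Prop :=
  exists C : R, forall w r, E w -> (0 < r)%R -> r%:E < diam E ->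
    let EQ := truncation E w (r / 128)%R in
    forall u g, holder beta u -> (forall x, EQ x -> u x = 0%R) ->
      hajlasz_gradient beta u g ->
      \int[mu]_(x in ball w r `\` EQ)
          ((`|u x| `^ p)%:E / edist_inf EQ x `^ (beta * p))
        <= C%:E * \int[mu]_(x in ball w r) (g x `^ p).

End metric_measure.

(* Main.v *)
(* Condition (1) is compared with a scale condition [thick_scales]: for each A > 0, every
   ball of radius r' centered on E contains a piece F of E whose s-neighborhood, for some
   s = 2^-i r' with i bounded, has measure at least A (s/r')^(beta p) times that of the ball.

   Each of (3)-(6) implies the scale condition. The test function is the average of
   min(1, d(x,F)/s_i) over N consecutive dyadic scales s_i. Its gradient has p-energy about
   N^-p times the sum over i of s_i^(-beta p) mu(F_(s_i)); were all these neighborhoods thin,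
   the energy would be O(N^(1-p)), which contradicts the inequality for N large since p > 1.
   Replacing balls by disjoint balls of a thick scale, repeatedly, turns the scale condition
   into (1). For (1) => (2), a cover of too small content would have a descending sequence of
   balls on which its content stays too small; their centers converge to a point of E which
   the cover misses.

   The content condition (2) holds for some q strictly below beta p. A covering argument
   gives, at each scale, points of E through which u oscillates no more than a maximal
   function of g^p' allows, for any p' < p with q < beta p'; the maximal theorem
   for p/p' > 1 then yields (5) and (6), and the pointwise estimates give (3) and (4). In this
   way the self-improvement of Poincare and Hardy inequalities is not needed. *)
Require Import Defs.
From mathcomp Require Import all_boot all_order all_algebra.
From mathcomp Require Import all_classical all_reals all_analysis measurable_realfun.
From mathcomp Require Import finmap lra ring.

Set Implicit Arguments.
Unset Strict Implicit.
Unset Printing Implicit Defensive.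
Import Order.TTheory GRing.Theory Num.Theory.
Import numFieldNormedType.Exports.
Local Open Scope classical_set_scope.
Local Open Scope ring_scope.

(** * Geodesics and coverings *)

Section metric.
Context (R : realType) (X : metricType R).
Implicit Types (x y z w : X) (r s t : R) (A : set X).

Local Notation dist := (@mdist R X).

Lemma in_ballE x r y : ball x r y = (dist x y < r) :> Prop.
Proof. by rewrite ballEmdist. Qed.

Lemma closure_ball_le x r y : closure (ball x r) y -> dist x y <= r.
Proof.
move=> h; apply/ler_addgt0Pr => e e0.
have [z [xz yz]] := h (ball y e) (nbhsx_ballx _ _ e0).
move: xz yz; rewrite !in_ballE => xz yz.
by rewrite (le_trans (metric_triangle x z y))// lerD// ltW// metric_sym.
Qed.

Lemma ball_openM x r : open (ball x r).
Proof.
rewrite openE => y; rewrite in_ballE => xy; apply/nbhs_ballP.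
exists (r - dist x y); first by rewrite /= subr_gt0.
move=> z; rewrite !in_ballE => yz.
by rewrite (le_lt_trans (metric_triangle x y z))// -ltrBrDl.
Qed.

Hypothesis geo : geodesic_space X.

Lemma geodesic_between x y t : 0 <= t <= dist x y ->
  exists z, dist x z = t /\ dist z y = dist x y - t.
Proof.
move=> /andP[t0 txy]; have [a [b [gam [ab cgam ga gb glen]]]] := geo x y.
pose f s := dist x (gam s).
have fdiff u v : `|f u - f v| <= dist (gam u) (gam v).
  rewrite ler_norml /f; have := metric_triangle x (gam u) (gam v).
  have := metric_triangle x (gam v) (gam u); rewrite (metric_sym (gam v)).
  by move=> h1 h2; apply/andP; split; lra.
have cf : {within `[a, b], continuous f}.
  move=> s; apply/cvgrPdist_lt => e e0.
  have := cgam s (ball (gam s) e) (nbhsx_ballx _ _ e0).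
  rewrite /nbhs/=; apply: filterS => u/=; rewrite in_ballE => h.
  exact: le_lt_trans (fdiff _ _) h.
have [c cab fc] : exists2 c, c \in `[a, b] & f c = t.
  by apply: IVT => //; rewrite /f ga gb mdistxx min_l ?mdist_ge0// max_r ?mdist_ge0// t0.
exists (gam c); split => //.
apply/eqP; rewrite eq_le; apply/andP; split; last first.
  by have := metric_triangle x (gam c) y; rewrite -/(f c) fc => h; lra.
have [ca|ca] := eqVneq c a.
  by move: fc; rewrite /f ca ga mdistxx => <-; rewrite subr0.
have [cb|cb] := eqVneq c b.
  by rewrite cb gb mdistxx; lra.
move: cab; rewrite in_itv/= => /andP[ac cb'].
have : ((curve_variation a b gam [:: c; b])%:E <= curve_length a b gam)%E.
  apply: ereal_sup_ubound => /=; exists [:: c; b] => //.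
  by rewrite /itv_partition/= !lt_neqAle eq_sym ca ac cb cb' eqxx.
rewrite glen lee_fin /curve_variation/= !big_nat_recl// big_geq//= addr0 ga gb.
by rewrite -/(f c) fc => h; lra.
Qed.

End metric.

Section vitali.
Context (R : realType) (d : measure_display) (X : metricMeasurableType R d).
Variable mu : {measure set X -> \bar R}.
Hypothesis mopen : forall A : set X, open A -> measurable A.
Hypothesis mupos : balls_pos_finite mu.

Local Notation bal b := (ball b.1 b.2 : set X).

Lemma measurable_ball (x : X) r : measurable (ball x r).
Proof. by apply: mopen; exact: ball_openM. Qed.

Lemma countable_disjoint_balls (D : set (X * R)) (W : set X) :
  measurable W -> (mu W < +oo)%E ->
  (forall b, D b -> 0 < b.2) -> (forall b, D b -> bal b `<=` W) ->
  trivIset D (fun b => bal b) -> countable D.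
Proof.
move=> mW Wfin Dpos DW tD.
pose Dn n := [set b | D b /\ (n.+1%:R^-1%:E <= mu (bal b))%E].
have DE : D = \bigcup_n Dn n.
  apply/seteqP; split => [b Db|b [n _ []//]].
  have /andP[m0 mf] := mupos b.1 (Dpos b Db).
  have fm : 0 < fine (mu (bal b)) by rewrite fine_gt0// m0 mf.
  exists (Num.truncn (fine (mu (bal b)))^-1) => //; split => //.
  rewrite -[leRHS]fineK ?ge0_fin_numE ?measure_ge0// lee_fin.
  by rewrite invf_ple ?posrE// ltW// truncnS_gt.
rewrite DE; apply: bigcup_countable => // n _; apply: finite_set_countable.
apply: contrapT => infD.
pose m := Num.truncn (fine (mu W) * n.+1%:R).
have [F FD Fm] := infinite_set_fset m.+1 infD.
have FW : (mu (\bigcup_(b in [set` F]) bal b) <= mu W)%E.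
  have mU : measurable (\bigcup_(b in [set` F]) bal b).
    apply: (@fin_bigcup_measurable _ X _ [set` F] (fun b => bal b)) => //.
    by move=> b _; exact: measurable_ball.
  apply: le_measure; [exact: mem_set|exact: mem_set|].
  by apply: bigcup_sub => b /FD [] /DW.
have : ((m.+1%:R * n.+1%:R^-1)%:E <= mu W)%E.
  apply: le_trans FW; rewrite measure_fin_bigcup//; last 2 first.
    by move=> b b' /FD[Db _] /FD[Db' _]; exact: tD.
    by move=> b _; exact: measurable_ball.
  rewrite fsbig_finite//= set_fsetK.
  apply: (@le_trans _ _ (\sum_(i <- F) (n.+1%:R^-1)%:E)%E).
    rewrite sumEFin lee_fin big_const_seq count_predT iter_addr_0.
    by rewrite -[leRHS]mulr_natl ler_wpM2r// ler_nat.
  rewrite big_seq [leRHS]big_seq; apply: lee_sum => b bF.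
  by have [] := FD b bF.
rewrite -(@fineK _ (mu W)) ?ge0_fin_numE ?measure_ge0// lee_fin ler_pdivrMr// leNgt.
by rewrite truncnS_gt.
Qed.

Lemma vitali_cover (x0 : X) (V : set (X * R)) (r0 : R) (W : set X) :
  measurable W -> (mu W < +oo)%E ->
  (forall b, V b -> 0 < b.2 <= r0) -> (forall b, V b -> bal b `<=` W) ->
  exists (K : set nat) (e : nat -> X * R),
    [/\ forall k, K k -> V (e k),
        trivIset K (fun k => bal (e k)) &
        forall b, V b -> exists k, [/\ K k, b.2 <= 2 * (e k).2 &
          mdist b.1 (e k).1 < b.2 + (e k).2]].
Proof.
move=> mW Wfin Vr VW.
pose meet (b c : X * R) := bal b `&` bal c !=set0.
pose P (D : set (X * R)) := [/\ D `<=` V, trivIset D (fun b => bal b) &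
  forall b, V b -> (exists2 c, D c & meet b c) ->
    exists c, [/\ D c, meet b c & b.2 <= 2 * c.2]].
have selfmeet b : V b -> meet b b.
  move=> /Vr/andP[b0 _]; exists b.1.
  by rewrite /setI/= !in_ballE mdistxx.
have [D [[DV tD hD] Dmax]] : exists D, P D /\ forall D', D `<` D' -> ~ P D'.
  apply: Zorn_bigcup => F FP tot; split.
  - by apply: bigcup_sub => E /FP[].
  - move=> i j [x Fx] xi [y Fy] yj ij; have [xy|yx] := tot _ _ Fx Fy.
      by have [_ + _] := FP _ Fy; apply => //; exact: xy.
    by have [_ + _] := FP _ Fx; apply => //; exact: yx.
  - move=> b Vb [c [E FE Ec] bc].
    have [_ _ /(_ b Vb)] := FP _ FE.
    case; first by exists c.
    by move=> c' [Ec' bc' le]; exists c'; split => //; exists E.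
have allmeet b : V b -> exists2 c, D c & meet b c.
  move=> Vb; apply: contrapT => nb.
  pose S := [set c | V c /\ ~ exists2 c', D c' & meet c c'].
  have Sb : S b by [].
  have hsS : has_sup [set c.2 | c in S].
    split; first by exists b.2, b.
    by exists r0 => _ [c [/Vr/andP[_ ?] _] <-].
  pose s := sup [set c.2 | c in S].
  have s0 : 0 < s.
    have /andP[b0 _] := Vr b Vb.
    by apply: (lt_le_trans b0); apply: ub_le_sup; [case: hsS|exists b].
  have [_ [c0 [Vc0 nc0] <-] sc0] := @sup_adherent _ _ (s / 2) (divr_gt0 s0 (ltr0Sn _ 1)) hsS.
  have nDc0 : ~ D c0.
    by move=> Dc0; apply: nc0; exists c0 => //; exact: selfmeet.
  apply: (Dmax (D `|` [set c0])).
    split; first exact: subsetUl.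
    by move=> /(_ c0) h; apply: nDc0; apply: h; right.
  split.
  - by move=> c [/DV//|->].
  - move=> i j [Di|->] [Dj|->] //; first exact: tD.
      move=> ij; exfalso; apply: nc0; exists i => //.
      by rewrite /meet setIC.
    by move=> ij; exfalso; apply: nc0; exists j.
  - move=> c Vc [c' Dc' cc'].
    have [[c2 Dc2 m2]|nc] := pselect (exists2 c', D c' & meet c c').
      have [c3 [? ? ?]] := hD _ Vc (ex_intro2 _ _ _ Dc2 m2).
      by exists c3; split => //; left.
    exists c0; split; first by right.
      case: Dc' => [Dc'|Ec']; last by rewrite -Ec'.
      by exfalso; apply: nc; exists c'.
    have : c.2 <= s by apply: ub_le_sup; [case: hsS|exists c].
    by move: sc0; rewrite -/s; lra.
have cD : countable D.
  apply: (countable_disjoint_balls mW) => // b /DV; last exact: VW.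
  by move=> /Vr/andP[].
have /countable_injP[f finj] := cD.
have [e he] : {e : nat -> X * R & forall k, [set f b | b in D] k -> D (e k) /\ f (e k) = k}.
  apply: (@choice _ _ (fun k b => [set f b | b in D] k -> D b /\ f b = k)) => k.
  have [[b Db <-]|n] := pselect ([set f b | b in D] k); first by exists b.
  by exists (x0, 0).
exists [set f b | b in D], e; split.
- by move=> k /he[/DV].
- move=> i j /he[Di fi] /he[Dj fj] ij.
  by rewrite -fi -fj (tD _ _ Di Dj ij).
- move=> b Vb; have [c [Dc [z [bz cz]] bc]] := hD b Vb (allmeet b Vb).
  have Kf : [set f b | b in D] (f c) by exists c.
  have [De fe] := he _ Kf.
  have ec : e (f c) = c by apply: finj => //; exact: mem_set.
  exists (f c); rewrite ec; split => //.
  move: bz cz; rewrite !in_ballE => bz cz.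
  have := metric_triangle b.1 z c.1; rewrite (metric_sym z).
  by move=> /le_lt_trans; apply; apply: ltrD.
Qed.

End vitali.

(** * Doubling measures *)

Section doubling.
Context (R : realType) (d : measure_display) (X : metricMeasurableType R d).
Variable mu : {measure set X -> \bar R}.
Hypothesis mopen : forall A : set X, open A -> measurable A.
Hypothesis mupos : balls_pos_finite mu.
Implicit Types (x y z : X) (r s t : R).

Local Notation dist := (@mdist R X).

Definition ball_mass x r : R := fine (mu (ball x r)).
Local Notation m := ball_mass.

Lemma ball_massE x r : 0 < r -> mu (ball x r) = (m x r)%:E.
Proof.
move=> r0; have /andP[h1 h2] := mupos x r0.
by rewrite /m fineK// ge0_fin_numE// ltW.
Qed.

Lemma ball_mass_gt0 x r : 0 < r -> 0 < m x r.
Proof. by move=> r0; rewrite -lte_fin -ball_massE//; case/andP: (mupos x r0). Qed.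

Lemma ball_sub x y r s : dist x y + s <= r -> ball y s `<=` ball x r.
Proof.
move=> h z; rewrite !in_ballE => yz; have := metric_triangle x y z; lra.
Qed.

Lemma ball_mass_mono x y r s : 0 < s -> 0 < r -> ball y s `<=` ball x r -> m y s <= m x r.
Proof.
move=> s0 r0 h; rewrite -lee_fin -!ball_massE//.
by apply: le_measure => //; apply: mem_set; exact: (measurable_ball mopen).
Qed.

Hypothesis mudbl : doubling mu.

Lemma ball_mass_expn : exists2 k : nat, (0 < k)%N & forall n x r, 0 < r ->
  m x (2 ^+ n * r) <= (2 ^+ n) ^+ k * m x r.
Proof.
have [c c1 hc] := mudbl.
have [k k0 ck] : exists2 k : nat, (0 < k)%N & c <= 2 ^+ k.
  exists (Num.truncn c).+1 => //.
  by rewrite (le_trans (ltW (truncnS_gt _)))// -natrX ler_nat ltnW// ltn_expl.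
exists k => //; elim=> [|n IH] x r r0; first by rewrite expr1n !mul1r.
have r0' : 0 < 2 ^+ n * r by rewrite mulr_gt0 ?exprn_gt0.
have := hc x _ r0'; rewrite !ball_massE ?mulr_gt0// -EFinM lee_fin [2 * (_ * r)]mulrA -exprS.
move=> /le_trans; apply.
apply: (le_trans (ler_wpM2l _ (IH _ _ r0))); first by lra.
rewrite mulrA ler_wpM2r ?(ltW (ball_mass_gt0 _ _))// [2 ^+ n.+1]exprS exprMn.
by rewrite ler_wpM2r ?exprn_ge0.
Qed.

Lemma expn2_ge (t : R) : exists n, t <= 2 ^+ n.
Proof.
exists (Num.truncn t).+1; rewrite (le_trans (ltW (truncnS_gt _)))// -natrX ler_nat.
by rewrite ltnW// ltn_expl.
Qed.

Lemma ball_mass_compare (L : R) : exists2 C : R, 0 < C & forall x y r s, 0 < r -> 0 < s ->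
  dist x y + r <= L * s -> m x r <= C * m y s.
Proof.
have [k k0 hk] := ball_mass_expn; have [n hn] := expn2_ge L.
exists ((2 ^+ n) ^+ k); first by rewrite !exprn_gt0.
move=> x y r s r0 s0 h; apply: le_trans (hk n _ _ s0).
apply: ball_mass_mono => //; first by rewrite mulr_gt0 ?exprn_gt0.
by apply: ball_sub; rewrite metric_sym (le_trans h)// ler_pM2r.
Qed.

Lemma expn2_between (t : R) : 1 <= t -> exists n, t <= 2 ^+ n /\ 2 ^+ n <= 2 * t.
Proof.
move=> t1; have ex : exists n, t <= 2 ^+ n by exact: expn2_ge.
case: (ex_minnP ex) => -[|n] tn nmin.
  by exists 0%N; split; [exact: tn|rewrite expr0; lra].
exists n.+1; split; first exact: tn.
rewrite exprS ler_pM2l// leNgt; apply/negP => /ltW /nmin.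
by rewrite ltnn.
Qed.

Lemma ball_mass_lower : exists2 s0 : R, 0 < s0 & forall s, s0 <= s ->
  exists2 c : R, 0 < c & forall x y r t, 0 < t <= r -> dist x y <= r ->
    c * (t / r) `^ s * m x r <= m y t.
Proof.
have [k k0 hk] := ball_mass_expn; exists k%:R; first by rewrite ltr0n.
move=> s ks; exists (4 ^- k); first by rewrite invr_gt0 exprn_gt0.
move=> x y r t /andP[t0 tr] xyr.
have r0 : 0 < r by exact: lt_le_trans tr.
have tr1 : 1 <= r / t by rewrite ler_pdivlMr// mul1r.
have [n [n1 n2]] := @expn2_between (2 * (r / t)) ltac:(lra).
have h1 : m x r <= (4 * (r / t)) ^+ k * m y t.
  have h2 : m x r <= m y (2 ^+ n * t).
    apply: ball_mass_mono => //; first by rewrite mulr_gt0// exprn_gt0.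
    have h3 : 2 * r <= 2 ^+ n * t by rewrite -ler_pdivrMr// -mulrA.
    by apply: ball_sub; rewrite metric_sym; lra.
  apply: (le_trans h2); apply: (le_trans (hk n _ _ t0)).
  rewrite ler_wpM2r ?(ltW (ball_mass_gt0 _ _))//.
  by rewrite lerXn2r ?nnegrE ?exprn_ge0//; [apply: mulr_ge0 => //; lra|lra].
apply: (@le_trans _ _ (4 ^- k * (t / r) ^+ k * m x r)).
  rewrite ler_wpM2r ?(ltW (ball_mass_gt0 _ _))// ler_wpM2l ?invr_ge0 ?exprn_ge0//.
  rewrite -powR_mulrn ?divr_ge0 ?(ltW t0) ?(ltW r0)//; apply: ger_powR => //.
  by rewrite divr_gt0//= ler_pdivrMr// mul1r.
apply: (le_trans (ler_wpM2l _ h1)).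
  by rewrite mulr_ge0 ?invr_ge0 ?exprn_ge0// divr_ge0 ?ltW.
rewrite [X in X <= _]mulrA -exprVn -!exprMn [X in X ^+ k](_ : _ = 1) ?expr1n ?mul1r//.
by field; rewrite !gt_eqF.
Qed.

Hypothesis geo : geodesic_space X.

Lemma inner_ball x y r t : 0 < t <= r -> dist x y < r ->
  exists z, [/\ ball z (t / 4) `<=` ball y t, ball z (t / 4) `<=` ball x r & dist x z <= r].
Proof.
move=> /andP[t0 tr] xyr.
pose s := Num.max 0 (dist x y - t / 2).
have sE : 0 <= s <= dist x y.
  by rewrite /s le_max lexx ge_max mdist_ge0/=; lra.
have [z [xz zy]] := geodesic_between geo sE.
have st : dist x y - s <= t / 2.
  have : dist x y - t / 2 <= s by rewrite /s le_max lexx orbT.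
  lra.
have sr : s <= r - t / 2.
  by rewrite /s ge_max; apply/andP; split; lra.
by exists z; split; [apply: ball_sub; rewrite metric_sym|apply: ball_sub|]; lra.
Qed.

Lemma ball_mass_inner : exists2 s0 : R, 0 < s0 & forall s, s0 <= s ->
  exists2 c : R, 0 < c & forall x y r t, 0 < t <= r -> dist x y < r ->
    ((c * (t / r) `^ s * m x r)%:E <= mu (ball y t `&` ball x r))%E.
Proof.
have [s0 s00 h] := ball_mass_lower; exists s0 => // s /h[c c0 hc].
exists (c * (4^-1) `^ s); first by rewrite mulr_gt0// powR_gt0.
move=> x y r t tr xyr; have [z [zy zx xz]] := inner_ball tr xyr.
have /andP[t0 t1] := tr.
have t4 : 0 < t / 4 <= r by apply/andP; split; lra.
have := hc x z r (t / 4) t4 xz.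
rewrite -lee_fin -(ball_massE z); last by lra.
have -> : c * 4^-1 `^ s * (t / r) `^ s = c * (t / 4 / r) `^ s.
  rewrite -mulrA -powRM ?invr_ge0//; last by rewrite divr_ge0//; lra.
  by congr (_ * _ `^ _); ring.
move=> /le_trans; apply; apply: le_measure.
- by apply: mem_set; exact: (measurable_ball mopen).
- by apply: mem_set; apply: measurableI; exact: (measurable_ball mopen).
- by move=> u zu; split; [exact: zy|exact: zx].
Qed.

End doubling.

Section integral.
Local Open Scope ereal_scope.
Context d (T : measurableType d) (R : realType).
Variable mu : {measure set T -> \bar R}.
Implicit Types (D : set T) (f : T -> \bar R) (K : set nat).

Lemma ge0_le_integral_pointwise D f1 f2 : (forall x, D x -> 0 <= f1 x) ->
  (forall x, D x -> f1 x <= f2 x) ->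
  \int[mu]_(x in D) f1 x <= \int[mu]_(x in D) f2 x.
Proof.
move=> f10 f12.
have f20 x : D x -> 0 <= f2 x by move=> Dx; exact: le_trans (f10 _ Dx) (f12 _ Dx).
rewrite !ge0_integralE//; apply: le_ereal_sup => _ [h hf <-]; exists h => // x.
apply: (le_trans (hf x)); rewrite /patch; case: ifPn => // /set_mem; exact: f12.
Qed.

Lemma ge0_le_integral_null D N f1 f2 : measurable D -> mu.-negligible N ->
  measurable_fun D f2 ->
  (forall x, D x -> 0 <= f1 x) -> (forall x, D x -> 0 <= f2 x) ->
  (forall x, D x -> ~ N x -> f1 x <= f2 x) ->
  \int[mu]_(x in D) f1 x <= \int[mu]_(x in D) f2 x.
Proof.
move=> mD [M [mM M0 NM]] mf2 f10 f20 f12.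
pose f3 x := if x \in M then +oo else f2 x.
have f30 x : D x -> 0 <= f3 x by move=> Dx; rewrite /f3; case: ifP => // _; exact: f20.
have mf3 : measurable_fun D f3.
  apply: measurable_fun_if => //.
    by apply: (measurable_fun_bool true) => //=; rewrite preimage_mem_true; exact: measurableI.
  by apply: (measurable_funS mD) => //; exact: subIsetl.
have -> : \int[mu]_(x in D) f2 x = \int[mu]_(x in D) f3 x.
  apply: ge0_ae_eq_integral => //.
  exists M; split => // x /= h; apply: contrapT => nM; apply: h => _.
  by rewrite /f3 memNset.
apply: ge0_le_integral_pointwise => // x Dx; rewrite /f3; case: ifPn => [_|nM].
  exact: leey.
apply: f12 => // Nx; move: nM; rewrite notin_setE; apply; exact: NM.
Qed.

Lemma ge0_subset_integral_pointwise D1 D2 f : D1 `<=` D2 ->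
  (forall x, D2 x -> 0 <= f x) ->
  \int[mu]_(x in D1) f x <= \int[mu]_(x in D2) f x.
Proof.
move=> D12 f0; rewrite (integral_mkcond D1) (integral_mkcond D2).
apply: ge0_le_integral_pointwise => x _.
  by apply: erestrict_ge0 => y /D12; exact: f0.
rewrite /patch; case: ifPn => [/set_mem/D12/mem_set -> //|_].
by case: ifPn => // /set_mem; exact: f0.
Qed.

Lemma esum_nat_patch K (a : nat -> \bar R) : (forall k, K k -> 0 <= a k) ->
  \esum_(k in K) a k = \sum_(k <oo) (if k \in K then a k else 0).
Proof.
move=> a0; rewrite nneseries_esumT; last first.
  by move=> k; case: ifPn => // /set_mem; exact: a0.
by rewrite esum_mkcond.
Qed.

Lemma ge0_esumZl K (a : nat -> \bar R) (c : R) : (forall k, K k -> 0 <= a k) -> (0 <= c)%R ->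
  \esum_(k in K) (c%:E * a k) = c%:E * \esum_(k in K) a k.
Proof.
move=> a0 c0; rewrite !esum_nat_patch//; last first.
  by move=> k Kk; rewrite mule_ge0// ?lee_fin// a0.
rewrite -nneseriesZl; last by move=> k _; case: ifPn => // /set_mem; exact: a0.
by apply: eq_eseriesr => k _; case: ifPn => //; rewrite mule0.
Qed.

Lemma measure_le_esum K (F : nat -> set T) (A : set T) : measurable A ->
  (forall k, K k -> measurable (F k)) -> A `<=` \bigcup_(k in K) F k ->
  mu A <= \esum_(k in K) mu (F k).
Proof.
move=> mA mF AF; rewrite esum_nat_patch//.
pose G k := if k \in K then F k else set0.
have mG k : measurable (G k).
  by rewrite /G; case: ifPn => // /set_mem; exact: mF.
have -> : \sum_(k <oo) (if k \in K then mu (F k) else 0) = \sum_(k <oo) mu (G k).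
  by apply: eq_eseriesr => k _; rewrite /G; case: ifPn.
apply: measure_sigma_subadditive => // x /AF[k Kk Fx].
by exists k => //; rewrite /G mem_set.
Qed.

Lemma esum_integral_le K (F : nat -> set T) (W : set T) f :
  measurable_fun setT f -> (forall x, 0 <= f x) ->
  (forall k, K k -> measurable (F k)) -> trivIset K F ->
  (forall k, K k -> F k `<=` W) ->
  \esum_(k in K) \int[mu]_(x in F k) f x <= \int[mu]_(x in W) f x.
Proof.
move=> mf f0 mF tF FW; rewrite esum_nat_patch//; last first.
  by move=> k _; apply: integral_ge0 => x _; exact: f0.
pose G k := if k \in K then F k else set0.
have mG k : measurable (G k).
  by rewrite /G; case: ifPn => // /set_mem; exact: mF.
have -> : \sum_(k <oo) (if k \in K then \int[mu]_(x in F k) f x else 0) =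
    \sum_(k <oo) \int[mu]_(x in G k) f x.
  by apply: eq_eseriesr => k _; rewrite /G; case: ifPn; rewrite ?integral_set0.
rewrite -ge0_integral_bigcup//.
- apply: ge0_subset_integral_pointwise => // x [k _]; rewrite /G.
  by case: ifPn => // /set_mem Kk; exact: FW.
- exact: measurable_funS mf.
- move=> i j _ _; rewrite /G; case: ifPn => [/set_mem Ki|_]; last by rewrite set0I => -[].
  case: ifPn => [/set_mem Kj|_]; last by rewrite setI0 => -[].
  exact: tF.
Qed.

Lemma esum_measure_le K (F : nat -> set T) (W : set T) : measurable W ->
  (forall k, K k -> measurable (F k)) -> trivIset K F ->
  (forall k, K k -> F k `<=` W) -> \esum_(k in K) mu (F k) <= mu W.
Proof.
move=> mW mF tF FW.
have := @esum_integral_le K F W (cst 1) (measurable_cst _) (fun=> lee01) mF tF FW.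
rewrite integral_cst// mul1e; congr (_ <= _); apply: eq_esum => k Kk.
by rewrite integral_cst ?mul1e//; exact: mF.
Qed.

Lemma exists_le_of_integral_lt A N f (l : R) : measurable A -> mu.-negligible N ->
  measurable_fun setT f -> (forall x, 0 <= f x) -> (0 <= l)%R ->
  \int[mu]_(x in A) f x < l%:E * mu A ->
  exists x, [/\ A x, ~ N x & f x <= l%:E].
Proof.
move=> mA N0 mf f0 l0 h; apply: contrapT => hn.
move: h; rewrite ltNge => /negP; apply.
rewrite -(integral_cst mu mA l%:E).
apply: (ge0_le_integral_null mA N0) => //.
  exact: measurable_funS mf.
move=> x Ax Nx; rewrite leNgt; apply/negP => lx; apply: hn; exists x; split => //.
exact: ltW.
Qed.

End integral.

(** * Hajlasz gradients *)

Section real_powers.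
Context (R : realType).
Implicit Types (x y q : R).

Lemma exprn_powR x n q : 0 <= x -> (x ^+ n) `^ q = (x `^ q) ^+ n.
Proof.
by move=> x0; rewrite -powR_mulrn// -powRrM mulrC powRrM powR_mulrn// powR_ge0.
Qed.

Lemma powR_le_cancel x y q : 0 < q -> 0 <= x -> 0 <= y -> x `^ q <= y `^ q -> x <= y.
Proof.
move=> q0 x0 y0; rewrite !leNgt; apply: contra => yx.
by apply: gt0_ltr_powR; rewrite ?nnegrE.
Qed.

Lemma poweR_le_cancel (x : \bar R) y q : 0 < q -> (0 <= x)%E -> 0 <= y ->
  (x `^ q <= (y `^ q)%:E)%E -> (x <= y%:E)%E.
Proof.
move=> q0; case: x => [x| |]//.
  by rewrite poweR_EFin !lee_fin => x0 y0; exact: powR_le_cancel.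
by rewrite poweRyr ?gt_eqF.
Qed.

Lemma powR_root_cancel x q : 0 <= x -> q != 0 -> (x `^ q^-1) `^ q = x.
Proof. by move=> x0 q0; rewrite -powRrM mulVf// powRr1. Qed.

Lemma exists_powR_root x q : 0 < x -> 0 < q -> exists y : R, 0 < y /\ y `^ q = x.
Proof.
move=> x0 q0; exists (x `^ q^-1).
by rewrite powR_gt0// powR_root_cancel ?gt_eqF// ltW.
Qed.

Lemma powRV x y : 0 <= x -> x^-1 `^ y = (x `^ y)^-1.
Proof. by move=> x0; rewrite -powR_inv1// -powRrM mulN1r powRN. Qed.

Lemma expn2V_powR n q : (2^-1 ^+ n) `^ (- q) = (2 `^ q) ^+ n :> R.
Proof.
rewrite exprn_powR ?invr_ge0//; congr (_ ^+ n).
by rewrite powRN powRV// invrK.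
Qed.

Lemma ltr_powR x y z : 1 < x -> y < z -> x `^ y < x `^ z.
Proof.
move=> x1 yz; have x0 : 0 < x by exact: lt_trans x1.
have -> : x `^ z = x `^ (z - y) * x `^ y.
  by rewrite -powRD ?subrK//; apply/implyP => _; rewrite gt_eqF.
rewrite ltr_pMl ?powR_gt0//.
have <- : 1 `^ (z - y) = 1 :> R by rewrite powR1.
by apply: gt0_ltr_powR; rewrite ?subr_gt0 ?nnegrE// ltW.
Qed.

Lemma le_of_le_geometric (A D K th : R) : 0 <= th < 1 ->
  (forall n, A <= D + K * th ^+ n) -> A <= D.
Proof.
move=> /andP[th0 th1] h.
have cv : (fun n => D + K * th ^+ n) @ \oo --> D + K * 0.
  apply: cvgD; first exact: cvg_cst.
  by apply: cvgMr; apply: cvg_expr; rewrite ger0_norm.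
rewrite -[leRHS]addr0 -[X in _ + X](mulr0 K).
by apply: (cvgr_to_ge cv); exact: nearW.
Qed.

Lemma telescope_geometric (v : nat -> R) (D th : R) : 0 <= th < 1 -> 0 <= D ->
  (forall n, `|v n - v n.+1| <= D * th ^+ n) ->
  forall n, `|v 0%N - v n| <= D / (1 - th).
Proof.
move=> /andP[th0 th1] D0 h n.
suff : `|v 0%N - v n| <= D * (1 - th ^+ n) / (1 - th).
  move=> /le_trans; apply; rewrite ler_pM2r ?invr_gt0 ?subr_gt0//.
  by rewrite ler_piMr// gerBl exprn_ge0.
elim: n => [|n IH]; first by rewrite subrr normr0 expr0 subrr mulr0 mul0r.
rewrite (le_trans (ler_distD (v n) _ _))//; apply: (le_trans (lerD IH (h n))).
rewrite le_eqVlt; apply/orP; left; apply/eqP; rewrite exprS.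
by field; rewrite subr_eq0 gt_eqF.
Qed.

End real_powers.

Section hajlasz.
Context (R : realType) (d : measure_display) (X : metricMeasurableType R d).
Variable mu : {measure set X -> \bar R}.
Local Notation dist := (@mdist R X).

Definition hajlasz_off (beta : R) (u : X -> R) (g : X -> \bar R) (N : set X) : Prop :=
  [/\ measurable_fun setT g, forall x, (0 <= g x)%E, mu.-negligible N &
      forall x y, ~ N x -> ~ N y ->
        (`|u x - u y|%:E <= (dist x y `^ beta)%:E * (g x + g y))%E].

Lemma hajlasz_gradientP beta u g :
  hajlasz_gradient mu beta u g <-> exists N, hajlasz_off beta u g N.
Proof.
split; first by move=> [mg g0 [N N0 h]]; exists N.
by move=> [N [mg g0 N0 h]]; split => //; exists N.
Qed.

Variables (beta : R) (u : X -> R) (g : X -> \bar R) (N : set X).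
Hypothesis H : hajlasz_off beta u g N.

Lemma hajlasz_dist x y r (a b : R) : 0 <= beta -> ~ N x -> ~ N y -> dist x y <= r ->
  (g x <= a%:E)%E -> (g y <= b%:E)%E ->
  `|u x - u y| <= r `^ beta * (a + b).
Proof.
have [mg g0 _ h] := H; move=> b0 Nx Ny xyr ga gb.
have a0 : 0 <= a by rewrite -lee_fin (le_trans (g0 x)).
have bb0 : 0 <= b by rewrite -lee_fin (le_trans (g0 y)).
have r0 : 0 <= r by rewrite (le_trans _ xyr) ?mdist_ge0.
have : (`|u x - u y|%:E <= (dist x y `^ beta)%:E * (a + b)%:E)%E.
  apply: (le_trans (h _ _ Nx Ny)); apply: lee_wpmul2l; first by rewrite lee_fin powR_ge0.
  by rewrite EFinD; apply: leeD.
rewrite -EFinM lee_fin => /le_trans; apply; rewrite ler_wpM2r ?addr_ge0//.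
by apply: ge0_ler_powR; rewrite ?nnegrE ?mdist_ge0.
Qed.

Lemma hajlasz_measurable_pow p : measurable_fun setT (fun x => g x `^ p)%E.
Proof.
have [mg _ _ _] := H.
exact: (measurableT_comp (measurable_poweR p) mg).
Qed.

Lemma hajlasz_good_point (A : set X) (p l : R) : measurable A -> 0 < p -> 0 <= l ->
  (\int[mu]_(x in A) (g x `^ p) < (l `^ p)%:E * mu A)%E ->
  exists x, [/\ A x, ~ N x & (g x <= l%:E)%E].
Proof.
have [mg g0 N0 _] := H; move=> mA p0 l0 h.
have [x [Ax Nx gx]] := exists_le_of_integral_lt mA N0 (hajlasz_measurable_pow p)
  (fun x => poweR_ge0 _ _) (powR_ge0 _ _) h.
by exists x; split => //; exact: poweR_le_cancel gx.
Qed.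

End hajlasz.

(** * Consequences of the content density condition *)

Section content.
Context (R : realType) (d : measure_display) (X : metricMeasurableType R d).
Variable mu : {measure set X -> \bar R}.
Hypothesis mopen : forall A : set X, open A -> measurable A.
Hypothesis mupos : balls_pos_finite mu.
Hypothesis mudbl : doubling mu.
Local Notation dist := (@mdist R X).
Local Notation m := (ball_mass mu).

Lemma hausdorff_content_le_bad (q t : R) (y : X) (A W : set X) (f : X -> \bar R)
    (M : R) (bad : X -> R -> Prop) :
  0 < t -> measurable W -> (mu W < +oo)%E ->
  measurable_fun setT f -> (forall x, (0 <= f x)%E) -> 0 <= M ->
  (forall z r, bad z r -> 0 < r <= t / 5 /\ ball z r `<=` W) ->
  (forall z r, bad z r -> (mu (ball z (5 * r)) * ((5 * r) `^ (- q))%:E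
      <= M%:E * \int[mu]_(x in ball z r) f x)%E) ->
  (forall z, A z -> exists r, bad z r) ->
  (hausdorff_content mu q t A <= M%:E * \int[mu]_(x in W) f x)%E.
Proof.
move=> t0 mW Wfin mf f0 M0 badr badm Abad.
pose V := [set b : X * R | bad b.1 b.2].
have [||K [e [KV tK cov]]] := @vitali_cover R d X mu mopen mupos y V (t / 5) W mW Wfin.
- by move=> b /badr[].
- by move=> b /badr[].
apply: (@le_trans _ _ (\esum_(k in K) (mu (ball (e k).1 (5 * (e k).2)) *
   ((5 * (e k).2) `^ (- q))%:E))%E).
  apply: ereal_inf_lbound; exists K, (fun k => (e k).1), (fun k => 5 * (e k).2); split => //.
    by move=> k /KV/badr[/andP[? ?] _] /=; apply/andP; split; lra.
  move=> z /Abad[r /= bzr]; have [k [Kk h1 h2]] := cov (z, r) bzr.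
  have [/andP[ek0 _] _] := badr _ _ (KV k Kk).
  by exists k => //; rewrite in_ballE metric_sym; move: h1 h2 => /=; lra.
have fge0 k : (0 <= \int[mu]_(x in ball (e k).1 (e k).2) f x)%E by apply: integral_ge0.
apply: (@le_trans _ _ (\esum_(k in K) (M%:E * \int[mu]_(x in ball (e k).1 (e k).2) f x))%E).
  by apply: le_esum => k /KV /badm.
rewrite ge0_esumZl//; apply: lee_wpmul2l; first by rewrite lee_fin.
apply: esum_integral_le => //.
  by move=> k _; exact: (measurable_ball mopen).
by move=> k /KV/badr[].
Qed.

Variables (E : set X) (beta q p : R).
Hypothesis dens : content_density mu q E.
Hypotheses (beta0 : 0 < beta) (q0 : 0 < q) (p0 : 0 < p) (qp : q < beta * p).

(* Otherwise every point of [A] is the center of a ball on which [g ^ p] has a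
   large average at its own scale, and covering [A] by such balls contradicts the
   lower bound of the content. *)
Lemma content_density_good_center : exists2 L : R, 0 < L &
  forall (y : X) (t a : R) (g : X -> \bar R), E y -> 0 < t -> (t%:E < diam E)%E -> 0 < a ->
  measurable_fun setT g -> (forall x, (0 <= g x)%E) ->
  (\int[mu]_(x in ball y (2 * t)) (g x `^ p) <= (a `^ p * m y t)%:E)%E ->
  exists z, [/\ E z, closure (ball y t) z & forall k : nat,
    (\int[mu]_(x in ball z (t * 2^-1 ^+ k / 5)) (g x `^ p) <=
      (L * a `^ p * (2 `^ q) ^+ k * m z (t * 2^-1 ^+ k / 5))%:E)%E].
Proof.
have [c c0 hc] := dens.
have [C C0 hC] := ball_mass_compare mopen mupos mudbl 5.
have [L [L0 LE]] : exists L : R, 0 < L /\ L = 2 * C / c.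
  by exists (2 * C / c); rewrite !mulr_gt0// invr_gt0.
exists L => // y t a g Ey t0 tE a0 mg g0 hg; apply: contrapT => hn.
pose f x := (g x `^ p)%E.
have mf : measurable_fun setT f by exact: (measurableT_comp (measurable_poweR p) mg).
have f0 x : (0 <= f x)%E by exact: poweR_ge0.
pose A := E `&` closure (ball y t).
have ap0 : 0 < a `^ p by exact: powR_gt0.
pose bad z r := exists k : nat, [/\ A z, r = t * 2^-1 ^+ k / 5 &
  ((L * a `^ p * (2 `^ q) ^+ k * m z r)%:E < \int[mu]_(x in ball z r) f x)%E].
have Abad z : A z -> exists r, bad z r.
  move=> Az; apply: contrapT => nb; apply: hn; exists z; case: (Az) => ? ?; split => // k.
  by rewrite leNgt; apply/negP => lt; apply: nb; exists (t * 2^-1 ^+ k / 5), k.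
pose M := C * t `^ (- q) / (L * a `^ p).
have M0 : 0 <= M by rewrite ltW// divr_gt0 ?mulr_gt0 ?powR_gt0//.
have t20 : 0 < 2 * t by lra.
have half k : 0 < (2^-1 : R) ^+ k <= 1.
  by rewrite exprn_gt0//= exprn_ile1//; lra.
have hcont : (hausdorff_content mu q t A <= M%:E * \int[mu]_(x in ball y (2 * t)) f x)%E.
  apply: (@hausdorff_content_le_bad q t y A _ f M bad) => //.
  - exact: (measurable_ball mopen).
  - by case/andP: (mupos y t20).
  - move=> z _ [k [[_ Az] -> _]]; have /andP[h0 h1] := half k.
    have h2 : t * 2^-1 ^+ k <= t by rewrite ler_piMr// ltW.
    have h3 : 0 < t * 2^-1 ^+ k by rewrite mulr_gt0.
    split; first by apply/andP; split; lra.
    by apply: ball_sub; have := closure_ball_le Az; lra.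
  - move=> z r [k [_ rE hr]]; have /andP[h0 h1] := half k.
    have h3 : 0 < t * 2^-1 ^+ k by rewrite mulr_gt0.
    have r0 : 0 < r by rewrite rE; lra.
    rewrite ball_massE//; last by rewrite mulr_gt0.
    rewrite (_ : 5 * r = t * 2^-1 ^+ k) ?powRM ?expn2V_powR ?exprn_ge0 ?(ltW t0)//; last first.
      by rewrite rE; field.
    apply: (@le_trans _ _ (M%:E * (L * a `^ p * (2 `^ q) ^+ k * m z r)%:E)%E); last first.
      by apply: lee_wpmul2l; [rewrite lee_fin|exact: ltW].
    rewrite -!EFinM lee_fin.
    apply: (@le_trans _ _ (C * m z r * (t `^ (- q) * (2 `^ q) ^+ k))).
      rewrite ler_wpM2r ?mulr_ge0 ?powR_ge0 ?exprn_ge0 ?powR_ge0//.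
      by apply: hC => //; rewrite mdistxx add0r rE; lra.
    rewrite le_eqVlt; apply/orP; left; apply/eqP; rewrite /M.
    by field; rewrite !gt_eqF.
have := le_trans (hc y t Ey t0 tE) hcont; apply/negP; rewrite -ltNge.
  have yt0 := ball_mass_gt0 mupos y t0.
  apply: (@le_lt_trans _ _ (M * (a `^ p * m y t))%:E).
    by rewrite (EFinM M); apply: lee_wpmul2l; [rewrite lee_fin|exact: hg].
  rewrite ball_massE// -EFinM lte_fin.
  rewrite (_ : M * _ = 2^-1 * (c * t `^ (- q) * m y t)).
    by rewrite gtr_pMl ?mulr_gt0 ?powR_gt0//; lra.
  by rewrite /M LE; field; rewrite !gt_eqF.
Qed.

Lemma content_density_good_point : exists2 C : R, 0 < C &
  forall (y : X) (t a : R) u g N, E y -> 0 < t -> (t%:E < diam E)%E -> 0 < a ->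
  holder beta u -> hajlasz_off mu beta u g N ->
  (\int[mu]_(x in ball y (2 * t)) (g x `^ p) <= (a `^ p * m y t)%:E)%E ->
  exists z x, [/\ E z, closure (ball y t) z, ball y (2 * t) x &
    [/\ ~ N x, (g x <= (C * a)%:E)%E & `|u x - u z| <= C * t `^ beta * a]].
Proof.
have [L L0 hL] := content_density_good_center.
have [M [M0 Mp]] : exists M : R, 0 < M /\ M `^ p = 2 * L.
  by apply: exists_powR_root; rewrite ?mulr_gt0.
have [b [b0 bp bbeta]] : exists b : R, [/\ 0 < b, b `^ p = 2 `^ q & b < 2 `^ beta].
  exists (2 `^ (q / p)); rewrite powR_gt0// -powRrM divfK ?gt_eqF//; split => //.
  by apply: ltr_powR; rewrite ?ltr1n// ltr_pdivrMr.
have tb0 : 0 < 2 `^ beta :> R by rewrite powR_gt0.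
have [th [th0 th1 thE]] : exists th : R, [/\ 0 <= th, th < 1 & th = b / 2 `^ beta].
  by exists (b / 2 `^ beta); rewrite divr_ge0 ?(ltW b0) ?(ltW tb0)// ltr_pdivrMr// mul1r.
have MC : M <= M * (1 + b) / (1 - th).
  rewrite -mulrA ler_peMr ?(ltW M0)// ler_pdivlMr ?subr_gt0//; lra.
exists (M * (1 + b) / (1 - th)); first exact: lt_le_trans M0 MC.
move=> y t a u g N Ey t0 tE a0 [kap kap0 hkap] H hg.
have [mg g0 N0 _] := H.
have [z [Ez yz hz]] := hL y t a g Ey t0 tE a0 mg g0 hg.
pose rho k : R := t * 2^-1 ^+ k / 5.
have rho0 k : 0 < rho k by rewrite divr_gt0 ?mulr_gt0 ?exprn_gt0 ?invr_gt0.
have rhot k : 2 * rho k <= t * 2^-1 ^+ k.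
  have : 0 < t * 2^-1 ^+ k by rewrite mulr_gt0 ?exprn_gt0 ?invr_gt0.
  by rewrite /rho; lra.
have rhobeta k : (t * 2^-1 ^+ k) `^ beta = t `^ beta * (2 `^ beta)^-1 ^+ k.
  by rewrite powRM ?(ltW t0) ?exprn_ge0 ?invr_ge0// exprn_powR ?invr_ge0// powRV.
have /choice[xs hxs] : forall k, exists x, [/\ ball z (rho k) x, ~ N x & (g x <= (M * a * b ^+ k)%:E)%E].
  move=> k; apply: (hajlasz_good_point H (p := p)) => //.
  - exact: (measurable_ball mopen).
  - by rewrite !mulr_ge0 ?exprn_ge0 ?(ltW M0) ?(ltW a0) ?(ltW b0).
  apply: (le_lt_trans (hz k)); rewrite -/(rho k) ball_massE// -EFinM lte_fin ltr_pM2r ?ball_mass_gt0//.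
  rewrite !powRM ?exprn_ge0 ?mulr_ge0 ?(ltW M0) ?(ltW a0) ?(ltW b0)// exprn_powR ?(ltW b0)// Mp bp.
  have : 0 < L * a `^ p * (2 `^ q) ^+ k by rewrite !mulr_gt0 ?exprn_gt0 ?powR_gt0.
  lra.
have xz k : dist (xs k) z < rho k.
  by rewrite metric_sym -in_ballE; case: (hxs k).
exists z, (xs 0%N); split => //.
- apply: (@ball_sub _ _ _ y z (2 * t) (rho 0%N)); last by case: (hxs 0%N).
  by have := closure_ball_le yz; rewrite /rho expr0; lra.
split.
- by case: (hxs 0%N).
- have [_ _ h0] := hxs 0%N; apply: (le_trans h0); rewrite expr0 mulr1 lee_fin.
  by rewrite ler_wpM2r// ltW.
have step k : `|u (xs k) - u (xs k.+1)| <= t `^ beta * a * M * (1 + b) * th ^+ k.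
  have [_ N1 g1] := hxs k; have [_ N2 g2] := hxs k.+1.
  have dk : dist (xs k) (xs k.+1) <= t * 2^-1 ^+ k.
    have := metric_triangle (xs k) z (xs k.+1); rewrite (metric_sym z).
    have := xz k; have := xz k.+1; have := rhot k.
    have : rho k.+1 <= rho k.
      by rewrite /rho ler_pM2r ?invr_gt0// ler_pM2l// exprS ler_piMl ?exprn_ge0 ?invr_ge0//; lra.
    lra.
  have := hajlasz_dist H (ltW beta0) N1 N2 dk g1 g2.
  rewrite rhobeta => /le_trans; apply; rewrite le_eqVlt; apply/orP; left; apply/eqP.
  by rewrite thE exprMn exprS; ring.
have tel := @telescope_geometric _ (fun k => u (xs k)) _ _ _ _ step.
apply: (@le_of_le_geometric _ _ _ (kap * t `^ beta) ((2 `^ beta)^-1)).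
  rewrite invr_ge0 (ltW tb0)/= invf_lt1//.
  have : 2 `^ 0 < 2 `^ beta :> R by apply: ltr_powR; rewrite ?ltr1n.
  by rewrite powRr0.
move=> n; apply: (le_trans (ler_distD (u (xs n)) _ _)); apply: lerD.
  apply: (le_trans (tel _ _ n)).
  - by rewrite th0.
  - by rewrite !mulr_ge0 ?powR_ge0 ?(ltW a0) ?(ltW M0)// addr_ge0 ?(ltW b0).
  by rewrite le_eqVlt; apply/orP; left; apply/eqP; ring.
apply: (le_trans (hkap _ _)); rewrite -mulrA ler_wpM2l// -rhobeta.
apply: ge0_ler_powR; rewrite ?nnegrE ?mdist_ge0 ?(ltW beta0)//.
  by rewrite mulr_ge0 ?exprn_ge0 ?invr_ge0 ?(ltW t0).
have := xz n; have := rhot n; have := rho0 n; lra.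
Qed.

End content.

Section sobolev_poincare.
Context (R : realType) (d : measure_display) (X : metricMeasurableType R d).
Variable mu : {measure set X -> \bar R}.
Hypothesis mopen : forall A : set X, open A -> measurable A.
Hypothesis mupos : balls_pos_finite mu.
Hypothesis mudbl : doubling mu.
Hypothesis geo : geodesic_space X.
Local Notation dist := (@mdist R X).
Local Notation m := (ball_mass mu).

Variables (p beta : R).
Hypotheses (p0 : 0 < p) (beta0 : 0 < beta).

(* By Chebyshev's inequality a point where [g <= 2 ^ k.+1 * a] is close to one
   where [g <= 2 ^ k * a]; moving down through the levels, the increments of [u]
   form a geometric series. *)
Lemma sobolev_poincare_level : exists2 p1 : R, 0 < p1 < p & forall p', p1 <= p' < p ->
  forall K : R, exists D L : R, [/\ 0 < D, 1 <= L, K <= L &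
  forall (x0 : X) (r a : R) u g N, 0 < r -> 0 < a -> hajlasz_off mu beta u g N ->
  (\int[mu]_(x in ball x0 r) (g x `^ p') <= (a `^ p' * m x0 r)%:E)%E ->
  forall (k : nat) x y, ball x0 r x -> ball x0 r y -> ~ N x -> ~ N y ->
    (g y <= (L * a)%:E)%E -> (g x <= (L * a * 2 ^+ k)%:E)%E ->
    `|u x - u y| <= D * r `^ beta * (L * a) * (2 `^ (p' / p)) ^+ k].
Proof.
have [s0 s00 hs] := ball_mass_inner mopen mupos mudbl geo.
have bp0 : 0 < s0 + beta * p by rewrite addr_gt0// mulr_gt0.
exists (s0 * p / (s0 + beta * p)).
  rewrite divr_gt0 ?mulr_gt0//= ltr_pdivrMr// mulrC ltr_pM2l// ltrDl mulr_gt0//.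
move=> p' /andP[p1p' p'p] K.
have p'0 : 0 < p' by apply: lt_le_trans p1p'; rewrite divr_gt0 ?mulr_gt0.
have pp' : 0 < p - p' by rewrite subr_gt0.
pose s := beta * p * p' / (p - p').
have s_s0 : s0 <= s.
  rewrite ler_pdivlMr//; move: p1p'; rewrite ler_pdivrMr//; lra.
have s0' : 0 < s by exact: lt_le_trans s_s0.
have bs : beta * p' / s = 1 - p' / p.
  by rewrite /s; field; rewrite !gt_eqF.
have [c c0 hc] := hs s s_s0.
have [L [L1 KL Lp]] : exists L : R, [/\ 1 <= L, K <= L & 2 <= L `^ p' * c].
  pose L0 : R := (2 / c) `^ p'^-1.
  exists (Num.max 1 (Num.max K L0)); rewrite !le_max !lexx !orbT; split => //.
  rewrite -ler_pdivrMr//.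
  have <- : L0 `^ p' = 2 / c by rewrite powR_root_cancel ?gt_eqF// divr_ge0// ltW.
  apply: ge0_ler_powR; rewrite ?nnegrE ?(ltW p'0) ?powR_ge0//.
    by rewrite le_max ler01.
  by rewrite !le_max lexx !orbT.
have L0 : 0 < L by exact: lt_le_trans L1.
have [w [w1 wE]] : exists w : R, 1 < w /\ w = 2 `^ (p' / p).
  exists (2 `^ (p' / p)); split => //.
  have : 2 `^ 0 < 2 `^ (p' / p) :> R by apply: ltr_powR; rewrite ?ltr1n ?divr_gt0.
  by rewrite powRr0.
rewrite -wE.
pose v : R := 2 `^ (- (p' / s)).
have v0 : 0 < v by rewrite powR_gt0.
have v1 : v <= 1.
  have : 2 `^ (- (p' / s)) <= 2 `^ 0 :> R.
    by apply: ler_powR; rewrite ?ler1n// oppr_le0 divr_ge0 ?ltW.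
  by rewrite powRr0.
have vs : v `^ s = (2 `^ p')^-1.
  by rewrite /v -powRrM mulNr divfK ?gt_eqF// powRN.
have vb : v `^ beta * 2 = w.
  rewrite wE /v -powRrM -[X in _ * X](powRr1 (ler0n _ 2)) -powRD; last first.
    by apply/implyP => _; rewrite pnatr_eq0.
  congr (_ `^ _); rewrite mulNr mulrAC [p' * beta]mulrC bs; ring.
pose D := 2 * 2 `^ beta + 3 / (w - 1).
have D2 : 2 * 2 `^ beta <= D by rewrite lerDl divr_ge0// subr_ge0 ltW.
have D3 : 3 <= D * (w - 1).
  rewrite -ler_pdivrMr ?subr_gt0// lerDr mulr_ge0 ?powR_ge0//.
have D0 : 0 < D by rewrite (lt_le_trans _ D2)// mulr_gt0 ?powR_gt0.
exists D, L; split => // x0 r a u g N r0 a0 H hg.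
elim=> [|k IH] x y Bx By Nx Ny gy gx.
  rewrite expr0 !mulr1 in gx *.
  have dxy : dist x y <= 2 * r.
    have := metric_triangle x x0 y; rewrite (metric_sym x x0).
    by move: Bx By; rewrite !in_ballE; lra.
  have := hajlasz_dist H (ltW beta0) Nx Ny dxy gx gy.
  move=> /le_trans; apply; rewrite powRM ?(ltW r0)//.
  rewrite (_ : _ * _ = 2 * 2 `^ beta * (r `^ beta * (L * a))); last by ring.
  by rewrite -[leRHS]mulrA ler_wpM2r// !mulr_ge0 ?powR_ge0 ?(ltW L0) ?(ltW a0).
pose rho := r * v ^+ k.
have vk0 : 0 < v ^+ k by rewrite exprn_gt0.
have vk1 : v ^+ k <= 1 by rewrite exprn_ile1// ltW.
have rho0 : 0 < rho <= r by rewrite mulr_gt0//= ger_pMr.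
have dx0 : dist x0 x < r by rewrite -in_ballE.
have := hc x0 x r rho rho0 dx0.
rewrite (_ : rho / r = v ^+ k); last by rewrite /rho; field; rewrite gt_eqF.
rewrite exprn_powR ?(ltW v0)// vs => mA.
have mt0 := ball_mass_gt0 mupos x0 r0.
have [x' [[x'x x'x0] Nx' gx']] : exists x', [/\ (ball x rho `&` ball x0 r) x', ~ N x' &
    (g x' <= (L * a * 2 ^+ k)%:E)%E].
  apply: (hajlasz_good_point H (p := p')) => //.
  - by apply: measurableI; exact: measurable_ball.
  - by rewrite !mulr_ge0 ?exprn_ge0 ?(ltW L0) ?(ltW a0).
  apply: (@le_lt_trans _ _ (a `^ p' * m x0 r)%:E).
    apply: le_trans hg; apply: ge0_subset_integral_pointwise; first exact: subIsetr.
    by move=> z _; exact: poweR_ge0.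
  apply: (@lt_le_trans _ _ (((L * a * 2 ^+ k) `^ p') * (c * (2 `^ p')^-1 ^+ k * m x0 r))%:E).
    rewrite lte_fin !powRM ?exprn_ge0 ?mulr_ge0 ?(ltW L0) ?(ltW a0)// exprn_powR//.
    have t0 : 0 < (2 `^ p') ^+ k :> R by rewrite exprn_gt0 ?powR_gt0.
    rewrite (_ : _ * (c * _ * _) = L `^ p' * c * (a `^ p' * m x0 r)); last first.
      by rewrite exprVn; field; rewrite gt_eqF.
    by rewrite ltr_pMl ?mulr_gt0 ?powR_gt0//; lra.
  by rewrite EFinM; apply: lee_wpmul2l; [rewrite lee_fin powR_ge0|].
have dxx' : dist x x' <= rho by rewrite ltW// -in_ballE.
have h1 := IH x' y x'x0 By Nx' Ny gy gx'.
have h2 := hajlasz_dist H (ltW beta0) Nx Nx' dxx' gx gx'.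
apply: (le_trans (ler_distD (u x') _ _)).
have h3 : `|u x - u x'| <= 3 * (r `^ beta * (L * a)) * w ^+ k.
  apply: (le_trans h2); rewrite powRM ?(ltW r0) ?(ltW vk0)// exprn_powR ?(ltW v0)// -vb exprMn exprS.
  by rewrite le_eqVlt; apply/orP; left; apply/eqP; ring.
apply: (le_trans (lerD h3 h1)).
have wk0 : 0 < w ^+ k by rewrite exprn_gt0// (lt_trans _ w1).
have Q0 : 0 <= r `^ beta * (L * a) * w ^+ k by rewrite !mulr_ge0 ?powR_ge0 ?(ltW L0) ?(ltW a0) ?(ltW wk0).
rewrite exprS.
have : 0 <= (D * (w - 1) - 3) * (r `^ beta * (L * a) * w ^+ k) by rewrite mulr_ge0// subr_ge0.
lra.
Qed.

Lemma sobolev_poincare : exists2 p1 : R, 0 < p1 < p & forall p', p1 <= p' < p ->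
  forall K : R, exists2 C : R, 0 < C &
  forall (x0 : X) (r a : R) u g N, 0 < r -> 0 < a -> hajlasz_off mu beta u g N ->
  (\int[mu]_(x in ball x0 r) (g x `^ p') <= (a `^ p' * m x0 r)%:E)%E ->
  forall x y, ball x0 r x -> ball x0 r y -> ~ N x -> ~ N y ->
    (g y <= (K * a)%:E)%E ->
    ((`|u x - u y| `^ p)%:E <=
      (C * r `^ (beta * p) * a `^ p)%:E * (1 + (a `^ (- p'))%:E * g x `^ p'))%E.
Proof.
have [p1 /andP[p10 p1p] hp1] := sobolev_poincare_level.
exists p1; first by rewrite p10.
move=> p' p'E K; have [D [L [D0 L1 KL h]]] := hp1 p' p'E K.
have p'0 : 0 < p' by case/andP: p'E => /(lt_le_trans p10).
have L0 : 0 < L by exact: lt_le_trans L1.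
exists ((D * L) `^ p * 2 `^ p'); first by rewrite mulr_gt0 ?powR_gt0 ?mulr_gt0.
move=> x0 r a u g N r0 a0 H hg x y Bx By Nx Ny gy.
have [mg g0 N0 _] := H.
have gy' : (g y <= (L * a)%:E)%E by apply: (le_trans gy); rewrite lee_fin ler_pM2r.
have Cpos : 0 < (D * L) `^ p * 2 `^ p' * r `^ (beta * p) * a `^ p.
  by rewrite !mulr_gt0 ?powR_gt0 ?mulr_gt0.
have La0 : 0 < L * a by rewrite mulr_gt0.
have ap0 : 0 < a `^ (- p') by rewrite powR_gt0.
have := g0 x; case E : (g x) => [G| |]// G0; last first.
  by rewrite poweRyr ?gt_eqF// gt0_muley ?lte_fin// addey// gt0_muley ?lte_fin// leey.
rewrite poweR_EFin -(EFinM (a `^ (- p'))) -(EFinD 1) -EFinM lee_fin.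
rewrite lee_fin in G0.
have key (k : nat) : (G <= L * a * 2 ^+ k) -> (2 `^ p') ^+ k <= 2 `^ p' * (1 + a `^ (- p') * G `^ p') ->
    `|u x - u y| `^ p <= (D * L) `^ p * 2 `^ p' * r `^ (beta * p) * a `^ p * (1 + a `^ (- p') * G `^ p').
  move=> gk hk.
  have gxk : (g x <= (L * a * 2 ^+ k)%:E)%E by rewrite E lee_fin.
  have hu := h x0 r a u g N r0 a0 H hg k x y Bx By Nx Ny gy' gxk.
  apply: (@le_trans _ _ ((D * r `^ beta * (L * a) * (2 `^ (p' / p)) ^+ k) `^ p)).
    apply: ge0_ler_powR; rewrite ?nnegrE ?(ltW p0)//.
    by rewrite (le_trans _ hu).
  rewrite !powRM ?exprn_ge0 ?mulr_ge0 ?powR_ge0 ?(ltW D0) ?(ltW L0) ?(ltW a0)//.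
  rewrite exprn_powR ?powR_ge0// -(powRrM 2) divfK ?gt_eqF// -(powRrM r).
  rewrite (_ : _ * (_ * _) * _ = D `^ p * L `^ p * r `^ (beta * p) * a `^ p * (2 `^ p') ^+ k); last by ring.
  rewrite [leRHS](_ : _ = D `^ p * L `^ p * r `^ (beta * p) * a `^ p * (2 `^ p' * (1 + a `^ (- p') * G `^ p'))); last by ring.
  by rewrite ler_wpM2l// !mulr_ge0 ?powR_ge0.
have t1 : 1 <= 2 `^ p' :> R.
  have : 2 `^ 0 <= 2 `^ p' :> R by apply: ler_powR; rewrite ?ler1n ?ltW.
  by rewrite powRr0.
have aG0 : 0 <= a `^ (- p') * G `^ p' by rewrite mulr_ge0 ?powR_ge0.
have [GL|/ltW GL] := leP G (L * a).
  apply: (key 0%N); rewrite expr0 ?mulr1//.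
  by rewrite (le_trans t1)// ler_peMr ?powR_ge0// lerDl.
have G1 : 1 <= G / (L * a) by rewrite ler_pdivlMr// mul1r.
have [n [n1 n2]] := expn2_between G1.
apply: (key n); first by rewrite mulrC -ler_pdivrMr.
rewrite -exprn_powR//.
apply: (@le_trans _ _ ((2 * (G / (L * a))) `^ p')).
  by apply: ge0_ler_powR; rewrite ?nnegrE ?exprn_ge0 ?(ltW p'0)// mulr_ge0 ?divr_ge0 ?(ltW La0).
rewrite powRM ?divr_ge0 ?(ltW La0)//; apply: ler_wpM2l; first exact: powR_ge0.
apply: (@le_trans _ _ (a `^ (- p') * G `^ p')); last by rewrite lerDr.
rewrite powRM ?invr_ge0 ?(ltW La0)// mulrC ler_wpM2r ?powR_ge0// powRN powRV ?(ltW La0)//.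
rewrite lef_pV2 ?posrE ?powR_gt0//; apply: ge0_ler_powR; rewrite ?nnegrE ?(ltW p'0) ?(ltW a0) ?(ltW La0)//.
by rewrite ler_peMl// ltW.
Qed.

End sobolev_poincare.

Section geometric.
Context (R : realType).

Lemma geometric_sum_le (b : nat -> R) (P : nat -> bool) (th M : R) (n : nat) : 1 < th ->
  (forall k, 0 <= b k) -> (forall k, b k.+1 = th * b k) -> 0 <= M ->
  (forall k, (k < n)%N -> P k -> b k <= M) ->
  \sum_(k < n | P k) b k <= th / (th - 1) * M.
Proof.
move=> th1 b0 bS M0; have th0 : 0 < th - 1 by rewrite subr_gt0.
have full k : \sum_(i < k.+1) b i <= th / (th - 1) * b k.
  elim: k => [|k IH].
    rewrite big_ord_recl big_ord0 addr0 ler_peMl// ler_pdivlMr//; lra.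
  rewrite big_ord_recr/= (le_trans (lerD IH (lexx _)))// bS.
  by rewrite le_eqVlt; apply/orP; left; apply/eqP; field; rewrite gt_eqF.
elim: n => [|n IH] h.
  by rewrite big_ord0 mulr_ge0// divr_ge0 ?ltW// (lt_trans _ th1).
have [Pn|Pn] := boolP (P n).
  apply: (@le_trans _ _ (\sum_(k < n.+1) b k)).
    by rewrite [leRHS](bigID (fun k : 'I_n.+1 => P k))/= lerDl sumr_ge0.
  apply: (le_trans (full n)); rewrite ler_pM2l ?divr_gt0 ?(lt_trans _ th1)//.
  exact: h.
rewrite big_mkcond big_ord_recr/= (negbTE Pn) addr0 -big_mkcond/=.
by apply: IH => k kn; apply: h; rewrite ltnS ltnW.
Qed.

End geometric.

Section maximal.
Context (R : realType) (d : measure_display) (X : metricMeasurableType R d).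
Variable mu : {measure set X -> \bar R}.
Hypothesis mopen : forall A : set X, open A -> measurable A.
Hypothesis mupos : balls_pos_finite mu.
Hypothesis mudbl : doubling mu.
Local Notation dist := (@mdist R X).
Local Notation m := (ball_mass mu).

Definition maximal_level (W : set X) (rho : R) (f : X -> \bar R) (l : R) : set X :=
  [set x | exists y r, [/\ 0 < r <= rho, ball y r x &
    ((l * m y r)%:E < \int[mu]_(z in ball y r `&` W) f z)%E]].

Lemma maximal_level_measurable W rho f l : measurable (maximal_level W rho f l).
Proof.
apply: mopen; rewrite openE => x [y [r [rr yrx h]]].
apply: filterS (open_nbhs_nbhs (conj (@ball_openM _ _ y r) yrx)) => z yrz.
by exists y, r.
Qed.

Lemma maximal_weak_type : exists2 C : R, 0 < C &
  forall (w : X) (R0 rho l : R) (f : X -> \bar R), 0 < R0 -> 0 < rho -> 0 < l ->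
  measurable_fun setT f -> (forall x, (0 <= f x)%E) ->
  (mu (maximal_level (ball w R0) rho f l) <=
    (C / l)%:E * \int[mu]_(x in ball w R0) (f \_ [set x | ((l / 2)%:E < f x)%E]) x)%E.
Proof.
have [C C0 hC] := ball_mass_compare mopen mupos mudbl 5.
exists (C * 2); first by rewrite mulr_gt0.
move=> w R0 rho l f R00 rho0 l0 mf f0.
set S := [set x | ((l / 2)%:E < f x)%E]; set fS := f \_ S; set W := ball w R0.
have mS : measurable S.
  by have := emeasurable_fun_o_infty measurableT mf (l / 2)%:E; rewrite setTI.
have mW : measurable W by exact: measurable_ball.
have mfS : measurable_fun setT fS.
  by apply/(measurable_restrict _ mS measurableT); rewrite setTI; exact: measurable_funS mf.
have fS0 x : (0 <= fS x)%E by apply: erestrict_ge0.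
pose V := [set b : X * R | 0 < b.2 <= rho /\
  ((l * m b.1 b.2)%:E < \int[mu]_(z in ball b.1 b.2 `&` W) f z)%E].
have Vm b : V b -> ((m b.1 b.2)%:E <= (2 / l)%:E * \int[mu]_(z in ball b.1 b.2 `&` W) fS z)%E.
  move=> [/andP[b0 _] hb].
  have mb : measurable (ball b.1 b.2 `&` W) by apply: measurableI => //; exact: measurable_ball.
  have : (\int[mu]_(z in ball b.1 b.2 `&` W) f z <=
      (l / 2 * m b.1 b.2)%:E + \int[mu]_(z in ball b.1 b.2 `&` W) fS z)%E.
    apply: (@le_trans _ _ (\int[mu]_(z in ball b.1 b.2 `&` W) ((l / 2)%:E + fS z))%E).
      apply: ge0_le_integral_pointwise => // z _; rewrite /fS /patch.
      case: ifPn => [zS|]; first by rewrite leeDr// lee_fin divr_ge0// ltW.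
      by rewrite notin_setE /S/= => /negP; rewrite -leNgt adde0.
    rewrite ge0_integralD//; last 2 first.
      by move=> z _; rewrite lee_fin divr_ge0// ltW.
      by apply: measurable_funS mfS.
    rewrite integral_cst//; apply: leeD => //.
    rewrite (EFinM (l / 2)) -ball_massE//.
    apply: lee_wpmul2l; first by rewrite lee_fin divr_ge0// ltW.
    apply: le_measure; [exact: mem_set|apply: mem_set; exact: measurable_ball|exact: subIsetl].
  move=> /(lt_le_trans hb).
  have i0 : (0 <= \int[mu]_(z in ball b.1 b.2 `&` W) fS z)%E by apply: integral_ge0.
  case: (\int[mu]_(z in ball b.1 b.2 `&` W) fS z)%E i0 => [I| |]// I0; last first.
    by move=> _; rewrite gt0_muley ?lte_fin ?divr_gt0// leey.
  rewrite -EFinD lte_fin -EFinM lee_fin => h.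
  rewrite mulrAC ler_pdivlMr//; lra.
have W'0 : 0 < R0 + 2 * rho by rewrite addr_gt0// mulr_gt0.
have /andP[_ W'fin] := mupos w W'0.
have [||K [e [KV tK cov]]] := @vitali_cover R d X mu mopen mupos w V rho (ball w (R0 + 2 * rho))
    (measurable_ball mopen _ _) W'fin.
- by move=> b [].
- move=> b [/andP[b0 brho] hb].
  have [z [bz Wz]] : ball b.1 b.2 `&` W !=set0.
    apply/set0P/eqP => e0; move: hb; rewrite e0 integral_set0 lte_fin ltNge mulr_ge0//.
      exact: ltW.
    exact/ltW/ball_mass_gt0.
  apply: ball_sub; move: bz Wz; rewrite /W !in_ballE => bz Wz.
  have := metric_triangle w z b.1; rewrite (metric_sym z); lra.
have cover : maximal_level W rho f l `<=` \bigcup_(k in K) ball (e k).1 (5 * (e k).2).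
  move=> x [y [r [rr yrx hyr]]].
  have [k [Kk h1 h2]] := cov (y, r) (conj rr hyr); exists k => //.
  have [/andP[ek0 _] _] := KV k Kk.
  move: yrx; rewrite !in_ballE => yrx; rewrite /= in h1 h2.
  have := metric_triangle (e k).1 y x; rewrite (metric_sym (e k).1 y); lra.
apply: (le_trans (measure_le_esum mu (maximal_level_measurable _ _ _ _) _ cover)).
  by move=> k _; exact: measurable_ball.
apply: (@le_trans _ _ (\esum_(k in K) ((C * 2 / l)%:E * \int[mu]_(z in ball (e k).1 (e k).2 `&` W) fS z))%E).
  apply: le_esum => k /[dup] Kk /KV /[dup] [[/andP[ek0 _] _]] /Vm hk.
  rewrite ball_massE ?mulr_gt0//.
  apply: (@le_trans _ _ (C * m (e k).1 (e k).2)%:E).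
    rewrite lee_fin; apply: hC => //; first by rewrite mulr_gt0.
    by rewrite mdistxx add0r.
  rewrite -mulrA (EFinM C) (EFinM C (2 / l)) -muleA.
  by apply: lee_wpmul2l => //; rewrite lee_fin ltW.
rewrite ge0_esumZl; last 2 first.
- by move=> k _; apply: integral_ge0.
- by rewrite divr_ge0 ?mulr_ge0// ltW.
apply: lee_wpmul2l; first by rewrite lee_fin divr_ge0 ?mulr_ge0// ltW.
apply: (@esum_integral_le _ _ _ mu K (fun k => ball (e k).1 (e k).2 `&` W)) => //.
- by move=> k _; apply: measurableI => //; exact: measurable_ball.
- move=> i j Ki Kj [z [[iz _] [jz _]]]; apply: tK => //; by exists z.
Qed.

Lemma maximal_levels_sum (eps tau : R) (v : \bar R) : 0 < eps -> 1 < tau -> (0 <= v)%E ->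
  (\sum_(k <oo) ((eps * 2 ^+ k) `^ (tau - 1))%:E *
      (if ((eps * 2 ^+ k / 2)%:E < v) then v else 0) <=
   (2 `^ (tau - 1) / (2 `^ (tau - 1) - 1) * 2 `^ (tau - 1))%:E * v `^ tau)%E.
Proof.
move=> e0 t1 v0.
have [th [th1 thE]] : exists th : R, 1 < th /\ th = 2 `^ (tau - 1).
  exists (2 `^ (tau - 1)); split => //.
  have : 2 `^ 0 < 2 `^ (tau - 1) :> R by apply: ltr_powR; rewrite ?ltr1n// subr_gt0.
  by rewrite powRr0.
rewrite -thE.
have th0 : 0 < th by exact: lt_trans th1.
have c0 : 0 < th / (th - 1) * th by rewrite mulr_gt0 ?divr_gt0// subr_gt0.
have term0 k : (0 <= ((eps * 2 ^+ k) `^ (tau - 1))%:E *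
    (if ((eps * 2 ^+ k / 2)%:E < v) then v else 0))%E.
  by rewrite mule_ge0// ?lee_fin ?powR_ge0//; case: ifP.
case: v v0 term0 => [v| |]// v0 term0; last first.
  by rewrite poweRyr ?gt_eqF ?(lt_trans _ t1)// gt0_muley ?lte_fin// leey.
apply: lime_le; first by apply: is_cvg_nneseries.
apply: nearW => n.
rewrite poweR_EFin -EFinM; rewrite lee_fin in v0.
have -> : (\sum_(0 <= k < n) ((eps * 2 ^+ k) `^ (tau - 1))%:E *
      (if ((eps * 2 ^+ k / 2)%:E < v%:E) then v%:E else 0))%E =
   ((\sum_(k < n | (fun k => eps * 2 ^+ k / 2 < v) k) (eps * 2 ^+ k) `^ (tau - 1)) * v)%:E.
  rewrite mulr_suml -sumEFin big_mkord [RHS]big_mkcond; apply: eq_bigr => k _.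
  by rewrite lte_fin; case: ifP => _; rewrite ?mule0// EFinM.
rewrite lee_fin -(mulr_powRB1 v0 (lt_trans ltr01 t1)) (mulrC v) mulrA ler_wpM2r//.
rewrite -[leRHS]mulrA; apply: (@geometric_sum_le _ (fun k => (eps * 2 ^+ k) `^ (tau - 1))
  (fun k => eps * 2 ^+ k / 2 < v) th _ n) => //.
- by move=> k; exact: powR_ge0.
- move=> k; rewrite thE -powRM ?mulr_ge0 ?exprn_ge0 ?(ltW e0)//; congr (_ `^ _).
  by rewrite exprS; ring.
- by rewrite mulr_ge0 ?powR_ge0 ?(ltW th0).
- move=> k _ /ltW kv; rewrite thE -powRM//; apply: ge0_ler_powR.
  + by rewrite subr_ge0 ltW.
  + by rewrite nnegrE mulr_ge0 ?exprn_ge0 ?(ltW e0).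
  + by rewrite nnegrE mulr_ge0//.
  + by rewrite [leRHS]mulrC -ler_pdivrMr//.
Qed.

(* A function controlled by the maximal function of [f] at every level is
   integrated against the layers [eps * 2 ^ k]; the part below [eps] is negligible
   because the ball has finite measure. *)
Lemma maximal_strong_type (tau : R) : 1 < tau -> exists2 C : R, 0 < C &
  forall (w : X) (R0 rho A : R) (f Phi h : X -> \bar R) (N : set X),
  0 < R0 -> 0 < rho -> 0 < A -> mu.-negligible N ->
  measurable_fun setT f -> (forall x, (0 <= f x)%E) -> (forall x, (0 <= Phi x)%E) ->
  measurable_fun setT h -> (forall x, (0 <= h x)%E) ->
  (forall (l : R) x, 0 < l -> ball w R0 x -> ~ N x ->
    ~ maximal_level (ball w R0) rho f l x -> (Phi x <= (A * l `^ tau)%:E + h x)%E) ->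
  (\int[mu]_(x in ball w R0) Phi x <=
    (C * A)%:E * \int[mu]_(x in ball w R0) (f x `^ tau) +
    \int[mu]_(x in ball w R0) h x)%E.
Proof.
move=> t1; have [C C0 weak] := maximal_weak_type.
have tau0 : 0 < tau by exact: lt_trans t1.
have th1 : 1 < 2 `^ (tau - 1) :> R.
  have : 2 `^ 0 < 2 `^ (tau - 1) :> R by apply: ltr_powR; rewrite ?ltr1n// subr_gt0.
  by rewrite powRr0.
have [T [T0 TE]] : exists T : R, 0 < T /\
    T = 2 `^ (tau - 1) / (2 `^ (tau - 1) - 1) * 2 `^ (tau - 1).
  by eexists; split; last reflexivity; rewrite mulr_gt0 ?divr_gt0 ?powR_gt0// subr_gt0.
exists (2 `^ tau * C * T); first by rewrite !mulr_gt0 ?powR_gt0//.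
move=> w R0 rho A f Phi h N R00 rho0 A0 N0 mf f0 Phi0 mh h0 hPhi.
set W := ball w R0; pose U l := maximal_level W rho f l.
have mW : measurable W by exact: measurable_ball.
have [mW0 mWoo] : (0 < mu W)%E /\ (mu W < +oo)%E by apply/andP; exact: (mupos w R00).
pose l_ eps k : R := eps * 2 ^+ k.
pose fS l := f \_ [set x | ((l / 2)%:E < f x)%E].
have mfS l : measurable_fun setT (fS l).
  have mS : measurable [set x | ((l / 2)%:E < f x)%E].
    by have := emeasurable_fun_o_infty measurableT mf (l / 2)%:E; rewrite setTI.
  by apply/(measurable_restrict _ mS measurableT); rewrite setTI; exact: measurable_funS mf.
have fS0 l x : (0 <= fS l x)%E by apply: erestrict_ge0.
have key eps : 0 < eps -> (\int[mu]_(x in W) Phi x <= (A * eps `^ tau)%:E * mu W +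
    (2 `^ tau * C * T * A)%:E * \int[mu]_(x in W) (f x `^ tau) + \int[mu]_(x in W) h x)%E.
  move=> e0; have l0 k : 0 < l_ eps k by rewrite mulr_gt0// exprn_gt0.
  pose term k x := ((A * (2 * l_ eps k) `^ tau)%:E * (\1_(U (l_ eps k)) x)%:E)%E.
  have term0 k x : (0 <= term k x)%E.
    by rewrite mule_ge0// lee_fin// mulr_ge0 ?powR_ge0// ltW.
  have mterm k : measurable_fun W (term k).
    apply: measurable_funeM; apply/measurable_EFinP; apply: measurable_indic.
    exact: maximal_level_measurable.
  pose S x := (\sum_(k <oo) term k x)%E.
  have S0 x : (0 <= S x)%E by apply: nneseries_ge0.
  have termS k x : (term k x <= S x)%E.
    apply: (@le_trans _ _ (\sum_(0 <= i < k.+1) term i x)%E).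
      by rewrite big_nat_recr//= leeDr// sume_ge0.
    exact: nneseries_lim_ge.
  have pt x : W x -> ~ N x -> (Phi x <= (A * eps `^ tau)%:E + S x + h x)%E.
    move=> Wx Nx; have [allU|] := pselect (forall k, U (l_ eps k) x).
      suff -> : S x = +oo%E by rewrite addey// addye ?leey// gt_eqF// (lt_le_trans _ (h0 x)).
      apply/eqyP => M M0.
      have Ae0 : 0 < A * eps `^ tau by rewrite mulr_gt0 ?powR_gt0.
      have [k hk] := expn2_ge (M / (A * eps `^ tau)).
      apply: le_trans (termS k x); rewrite /term indicE mem_set// mule1 lee_fin.
      rewrite /l_ mulrCA powRM ?mulr_ge0 ?exprn_ge0 ?(ltW e0)// mulrA mulrC -ler_pdivrMr//.
      apply: (le_trans hk); rewrite -exprS.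
      apply: (@le_trans _ _ (2 ^+ k.+1)); first by rewrite ler_eXn2l// ltr1n.
      by apply: le1r_powR; rewrite ?(ltW t1)// -natrX ler1n expn_gt0.
    move/existsNP => ex; have exn : exists k, `[< ~ U (l_ eps k) x >].
      by case: ex => k hk; exists k; apply/asboolP.
    case: (ex_minnP exn) => -[|k] /asboolP nU kmin.
      have := hPhi _ _ (l0 0%N) Wx Nx nU; rewrite {1}/l_ expr0 mulr1 => /le_trans; apply.
      by rewrite leeD2r// leeDl.
    have Uk : U (l_ eps k) x.
      by apply: contrapT => /asboolP /kmin; rewrite ltnn.
    apply: (le_trans (hPhi _ _ (l0 k.+1) Wx Nx nU)); apply: leeD => //.
    apply: (@le_trans _ _ (term k x)).
      by rewrite /term indicE mem_set// mule1 /l_ exprS mulrCA.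
    apply: (le_trans (termS k x)).
    by rewrite leeDr// lee_fin mulr_ge0 ?powR_ge0// ltW.
  have mS : measurable_fun W S by apply: ge0_emeasurable_sum => // k x _ _; exact: term0.
  have AS0 x : (0 <= (A * eps `^ tau)%:E + S x)%E.
    by rewrite adde_ge0// lee_fin mulr_ge0 ?powR_ge0// ltW.
  have mhW : measurable_fun W h by exact: measurable_funS mh.
  have mAS : measurable_fun W (fun x => (A * eps `^ tau)%:E + S x)%E by exact: emeasurable_funD.
  apply: (@le_trans _ _ (\int[mu]_(x in W) ((A * eps `^ tau)%:E + S x + h x))%E).
    apply: (ge0_le_integral_null mW N0) => //; first exact: emeasurable_funD.
    by move=> x _; rewrite adde_ge0.
  rewrite ge0_integralD//; apply: leeD => //.
  rewrite ge0_integralD//; last by move=> x _; rewrite lee_fin mulr_ge0 ?powR_ge0// ltW.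
  rewrite integral_cst//; apply: leeD => //.
  rewrite integral_nneseries//.
  apply: (@le_trans _ _ (\sum_(k <oo) \int[mu]_(x in W)
     ((2 `^ tau * C * A)%:E * ((l_ eps k `^ (tau - 1))%:E * fS (l_ eps k) x)))%E).
    apply: lee_nneseries; first by move=> *; apply: integral_ge0.
    move=> k _; rewrite ge0_integralZl//; last 2 first.
      by apply/measurable_EFinP; apply: measurable_indic; exact: maximal_level_measurable.
      by rewrite lee_fin mulr_ge0 ?powR_ge0// ltW.
    rewrite integral_indic//; last exact: maximal_level_measurable.
    rewrite ge0_integralZl//; last 3 first.
      by apply: measurable_funeM; exact: measurable_funS (mfS _).
      by move=> x _; rewrite mule_ge0// lee_fin powR_ge0.
      by rewrite lee_fin !mulr_ge0 ?powR_ge0// ltW.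
    rewrite ge0_integralZl//; last 2 first.
      exact: measurable_funS (mfS _).
      by rewrite lee_fin powR_ge0.
    have hw := weak w R0 rho (l_ eps k) f R00 rho0 (l0 k) mf f0.
    apply: (@le_trans _ _ ((A * (2 * l_ eps k) `^ tau)%:E *
      ((C / l_ eps k)%:E * \int[mu]_(x in W) fS (l_ eps k) x))%E).
      apply: lee_wpmul2l; first by rewrite lee_fin mulr_ge0 ?powR_ge0// ltW.
      apply: le_trans hw; apply: le_measure; last exact: subIsetl.
      - by apply: mem_set; apply: measurableI => //; exact: maximal_level_measurable.
      - by apply: mem_set; exact: maximal_level_measurable.
    rewrite !muleA -!EFinM le_eqVlt; apply/orP; left; apply/eqP; congr (_%:E * _)%E.
    rewrite powRM ?(ltW (l0 _))// -(mulr_powRB1 (ltW (l0 k)) tau0).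
    by field; rewrite gt_eqF.
  rewrite -integral_nneseries//; last 2 first.
  - by move=> k; do 2 apply: measurable_funeM; exact: measurable_funS (mfS _).
  - by move=> k x _; rewrite !mule_ge0// lee_fin ?mulr_ge0 ?powR_ge0// ltW.
  have mfW : measurable_fun W (fun x => (f x `^ tau)%E).
    by apply: (measurable_funS measurableT) => //; exact: (measurableT_comp (measurable_poweR tau) mf).
  rewrite -ge0_integralZl//; last 2 first.
  - by move=> x _; exact: poweR_ge0.
  - by rewrite lee_fin !mulr_ge0 ?powR_ge0// ltW.
  apply: ge0_le_integral_pointwise => x Wx.
    by apply: nneseries_ge0 => k _ _; rewrite !mule_ge0// lee_fin ?mulr_ge0 ?powR_ge0// ltW.
  rewrite nneseriesZl; last by move=> k _; rewrite mule_ge0// lee_fin powR_ge0.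
  rewrite [(_ * T * A)%R]mulrAC (EFinM _ T) -muleA.
  apply: lee_wpmul2l; first by rewrite lee_fin !mulr_ge0 ?powR_ge0// ltW.
  rewrite TE; apply: le_trans (maximal_levels_sum e0 t1 (f0 x)).
  rewrite le_eqVlt; apply/orP; left; apply/eqP; apply: eq_eseriesr => k _.
  congr (_ * _)%E; rewrite /fS /patch.
  case: ifPn => [/set_mem/= ->//|]; rewrite notin_setE/= => /negP/negbTE.
  by rewrite /l_ => ->.
rewrite -/(W) in key *.
have [wE|] := eqVneq (\int[mu]_(x in W) (f x `^ tau))%E +oo%E.
  rewrite wE gt0_muley ?lte_fin ?mulr_gt0 ?powR_gt0//.
  by rewrite addye ?leey// gt_eqF// (lt_le_trans ltNy0)// integral_ge0.
move=> wfin; apply/lee_addgt0Pr => e e0.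
have muWE : mu W = (m w R0)%:E by rewrite ball_massE.
have mw0 := ball_mass_gt0 mupos w R00.
pose eps : R := (e / (A * m w R0)) `^ tau^-1.
have eps0 : 0 < eps by rewrite powR_gt0 ?divr_gt0 ?mulr_gt0.
apply: (le_trans (key _ eps0)); rewrite -[leLHS]addeA [leRHS]addeC; apply: leeD => //.
rewrite muWE -EFinM lee_fin /eps powR_root_cancel ?gt_eqF//; last first.
  by rewrite divr_ge0 ?mulr_ge0 ?(ltW A0) ?(ltW mw0) ?(ltW e0).
by rewrite le_eqVlt; apply/orP; left; apply/eqP; field; rewrite !gt_eqF.
Qed.

End maximal.

Section scale.
Context (R : realType).
Implicit Types (r t : R).

Lemma exists_scale rho r : 0 < rho -> rho <= 4 * r -> exists t : R,
  [/\ 0 < t <= r / 128, 0 < 2 * t <= rho, t <= rho & rho <= 256 * (2 * t)].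
Proof.
by move=> rho0 rr; exists (rho / 512); split; try (apply/andP; split); lra.
Qed.

Lemma mul4E r : 4 * r = 2 * (2 * r).
Proof. by ring. Qed.

Lemma le_mul4 rho r : 0 < r -> rho <= 4 * (4 * (r / 128)) -> rho <= 4 * r.
Proof. lra. Qed.

Lemma hardy_scale (a rho r t : R) : 0 < rho -> 0 < r -> 0 < t <= r / 128 -> 2 * t <= rho ->
  rho <= 256 * (2 * t) -> a < 2 * rho ->
  [/\ a + 2 * t <= 4 * rho, r / 128 + 2 * t <= r & a + 4 * rho <= 2048 * (2 * t)].
Proof. by move=> rho0 r0 /andP[t0 tr] tr' rt ar; split; lra. Qed.

End scale.

Section distance_to_set.
Context (R : realType) (X : metricType R).
Local Notation dist := (@mdist R X).
Implicit Types (x y : X) (r : R) (A : set X).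

Lemma diam_ge A x y : A x -> A y -> ((dist x y)%:E <= diam A)%E.
Proof.
move=> Ax Ay; rewrite /diam le_max; apply/orP; right.
by apply: ereal_sup_ubound; exists (x, y).
Qed.

Lemma diam_le A (D : R) : 0 <= D -> (forall x y, A x -> A y -> dist x y <= D) ->
  (diam A <= D%:E)%E.
Proof.
move=> D0 h; rewrite /diam ge_max lee_fin D0/=.
by apply: ge_ereal_sup => _ [[x y] [/= Ax Ay] <-]; rewrite lee_fin; exact: h.
Qed.

Lemma exists_far_point A x (t : R) : 0 <= t -> (t%:E < diam A)%E -> A x ->
  exists2 y, A y & t / 2 < dist x y.
Proof.
move=> t0 tA Ax; apply: contrapT => h; move: tA; rewrite ltNge => /negP; apply.
have far y : A y -> dist x y <= t / 2.
  by move=> Ay; rewrite leNgt; apply/negP => ?; apply: h; exists y.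
apply: diam_le => // y z Ay Az; have := metric_triangle y x z.
by rewrite (metric_sym y x); have := far _ Ay; have := far _ Az; lra.
Qed.

Lemma edistE x y : edist (x, y) = (dist x y)%:E.
Proof.
apply/eqP; rewrite eq_le; apply/andP; split.
  apply/lee_addgt0Pr => e e0; rewrite -EFinD; apply: edist_fin; last first.
    by rewrite /= in_ballE ltrDl.
  by rewrite ltr_wpDl// mdist_ge0.
apply: le_ereal_inf_tmp => _ [r [r0 +] <-]; rewrite /= in_ballE lee_fin; exact: ltW.
Qed.

Definition dist_set A x : R := fine (edist_inf A x).

Lemma edist_infE A x : A !=set0 -> edist_inf A x = (dist_set A x)%:E.
Proof.
move=> [a Aa]; rewrite /dist_set fineK// ge0_fin_numE ?edist_inf_ge0//.
apply: (@le_lt_trans _ _ (dist x a)%:E); last exact: ltry.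
by apply: ereal_inf_lbound; exists a => //; rewrite edistE.
Qed.

Lemma dist_set_ge0 A x : 0 <= dist_set A x.
Proof. by rewrite fine_ge0// edist_inf_ge0. Qed.

Lemma dist_set_le A x a : A a -> dist_set A x <= dist x a.
Proof.
move=> Aa; rewrite -lee_fin -edist_infE; last by exists a.
by apply: ereal_inf_lbound; exists a => //; rewrite edistE.
Qed.

Lemma dist_set0 A a : A a -> dist_set A a = 0.
Proof. by move=> Aa; rewrite /dist_set edist_inf0. Qed.

Lemma neighborhoodP A r x : neighborhood A r x <-> exists2 a, A a & dist x a < r.
Proof.
split; rewrite /neighborhood/=.
  by move=> /ereal_inf_lt[_ [a Aa <-]]; rewrite edistE lte_fin; exists a.
move=> [a Aa xa]; apply: le_lt_trans (_ : ((dist x a)%:E < _)%E); last by rewrite lte_fin.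
by apply: ereal_inf_lbound; exists a => //; rewrite edistE.
Qed.

Lemma dist_set_lt A x r : A !=set0 -> dist_set A x < r -> exists2 a, A a & dist x a < r.
Proof. by move=> A0 h; apply/neighborhoodP; rewrite /neighborhood/= edist_infE// lte_fin. Qed.

Lemma neighborhoodE A x r : A !=set0 -> neighborhood A r x <-> dist_set A x < r.
Proof. by move=> A0; rewrite /neighborhood/= edist_infE// lte_fin. Qed.

Lemma dist_set_lipschitz A x y : A !=set0 -> `|dist_set A x - dist_set A y| <= dist x y.
Proof.
move=> A0; have h z t : dist_set A z <= dist z t + dist_set A t.
  apply/ler_addgt0Pr => e e0.
  have [a Aa ta] := @dist_set_lt A t (dist_set A t + e) A0 ltac:(lra).
  by have := dist_set_le z Aa; have := metric_triangle z t a; lra.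
rewrite ler_norml; have := h x y; have := h y x; rewrite (metric_sym y x).
by move=> *; apply/andP; split; lra.
Qed.

Lemma dist_set_gt0 A x : A !=set0 -> closed A -> ~ A x -> 0 < dist_set A x.
Proof.
move=> A0 cA nAx; rewrite lt_neqAle dist_set_ge0 andbT; apply/negP => /eqP e0; apply: nAx.
apply: cA => B /nbhs_ballP[e /= epos eB].
have [a Aa xa] := @dist_set_lt A x e A0 ltac:(by rewrite -e0).
by exists a; split => //; apply: eB; rewrite in_ballE.
Qed.

Lemma neighborhood_open A r : open (neighborhood A r).
Proof.
rewrite (_ : neighborhood A r = \bigcup_(a in A) ball a r); last first.
  apply/seteqP; split => [x /neighborhoodP[a Aa xa]|x [a Aa]]; last first.
    by rewrite in_ballE metric_sym => ax; apply/neighborhoodP; exists a.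
  by exists a => //; rewrite in_ballE metric_sym.
by apply: bigcup_open => a _; exact: ball_openM.
Qed.

Lemma ball_dist_le x y z r : ball x r y -> ball x r z -> dist y z <= 2 * r.
Proof.
by rewrite !in_ballE => xy xz; have := metric_triangle y x z; rewrite (metric_sym y x); lra.
Qed.

Lemma diam_ball_le x r : 0 < r -> (diam (ball x r) <= (2 * r)%:E)%E.
Proof.
move=> r0; apply: diam_le; first by rewrite mulr_ge0// ltW.
by move=> y z; exact: ball_dist_le.
Qed.

Hypothesis hX : exists x y : X, x <> y.
Hypothesis geo : geodesic_space X.

(* The radius of a ball containing the whole space can be arbitrarily large; a ball
   is also the ball of radius at most twice its diameter. *)
Lemma ball_diam x r : 0 < r -> exists D r' : R, [/\ diam (ball x r) = D%:E, 0 < D,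
  0 < r' <= 2 * D, D <= 2 * r' & ball x r = ball x r'].
Proof.
move=> r0.
have dfin : diam (ball x r) \is a fin_num.
  rewrite ge0_fin_numE; last by rewrite /diam le_max lexx.
  exact: le_lt_trans (diam_ball_le x r0) (ltry _).
have [y xy] : exists y, x <> y.
  have [a [b ab]] := hX; have [xa|] := pselect (x = a); last by exists a.
  by exists b; rewrite xa.
have xy0 : 0 < dist x y by rewrite mdist_gt0; apply/eqP.
pose t := Num.min (dist x y) (r / 2).
have t0 : 0 < t by rewrite lt_min xy0 divr_gt0.
have [z [xz _]] : exists z, dist x z = t /\ dist z y = dist x y - t.
  by apply: geodesic_between => //; rewrite ltW//= ge_min lexx.
have tr : t <= r / 2 by rewrite /t ge_min lexx orbT.
pose D := fine (diam (ball x r)).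
have DE : diam (ball x r) = D%:E by rewrite fineK.
have Bx : ball x r x by exact: ballxx.
have D0 : 0 < D.
  rewrite (lt_le_trans t0)// -lee_fin -DE -xz; apply: diam_ge => //.
  by rewrite in_ballE xz; lra.
have BE : ball x r = ball x (Num.min r (2 * D)).
  apply/seteqP; split => u; rewrite !in_ballE; last by rewrite lt_min => /andP[].
  move=> ur; rewrite lt_min ur/=.
  have : dist x u <= D by rewrite -lee_fin -DE; apply: diam_ge => //; rewrite in_ballE.
  lra.
have r'0 : 0 < Num.min r (2 * D) by rewrite lt_min r0 mulr_gt0.
exists D, (Num.min r (2 * D)); split => //.
- by rewrite r'0 ge_min lexx orbT.
- by rewrite -lee_fin -DE BE; exact: diam_ball_le.
Qed.

End distance_to_set.

Section truncation.
Context (R : realType) (X : metricType R).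
Local Notation dist := (@mdist R X).
Variables (E : set X) (w : X) (rQ : R).
Hypotheses (cE : closed E) (Ew : E w) (rQ0 : 0 < rQ).
Local Notation step := (truncation_step E w rQ).
Local Notation EQ := (truncation E w rQ).

Lemma truncation_step_sub j : step j `<=` E.
Proof. by case: j => [|j] x /=; [case|case=> y _ []]. Qed.

Lemma truncation_sub : EQ `<=` E.
Proof.
rewrite /truncation => x xE; apply: cE; move: x xE.
by apply: closure_subset; apply: bigcup_sub => j _; exact: truncation_step_sub.
Qed.

Lemma truncation_closed : closed EQ.
Proof. exact: closed_closure. Qed.

Lemma truncation_center : EQ w.
Proof.
apply: subset_closure; exists 0%N => //; split => //.
by apply: subset_closure; apply: ballxx; rewrite mulr_gt0// invr_gt0.
Qed.

Lemma closure_ball_sub (x : X) (r s : R) : r <= s -> closure (ball x r) `<=` closure (ball x s).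
Proof. by move=> rs; apply: closure_subset; exact: le_ball. Qed.

Lemma half_expn_gt0 n : 0 < (2 : R) ^- n.
Proof. by rewrite invr_gt0 exprn_gt0. Qed.

Lemma half_expnS n : 2 * (2 : R) ^- n.+1 = 2 ^- n.
Proof. by rewrite exprS invfM mulrA divff// mul1r. Qed.

Lemma truncation_step_near j x i : step j x -> (i <= j)%N ->
  exists2 y, step i y & dist x y <= (2 ^- i.+1 - 2 ^- j.+1) * rQ.
Proof.
elim: j x => [|j IH] x sx; first by rewrite leqn0 => /eqP ->; exists x => //; rewrite mdistxx subrr mul0r.
rewrite leq_eqVlt => /predU1P[->|]; first by exists x => //; rewrite mdistxx subrr mul0r.
rewrite ltnS => ij; case: sx => z sz [Ex /closure_ball_le zx].
have [y sy zy] := IH z sz ij; exists y => //.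
apply: (le_trans (metric_triangle x z y)); rewrite (metric_sym x).
apply: (le_trans (lerD zx zy)); have := half_expnS j.+1; set a := 2 ^- j.+1; set b := 2 ^- j.+2.
move=> <-; rewrite -mulrDl; apply: ler_wpM2r; [exact: ltW|lra].
Qed.

Lemma truncation_dist x : EQ x -> dist w x <= rQ.
Proof.
move=> hx; apply/ler_addgt0Pr => e e0.
have [y [[j _ sy] xy]] := hx (ball x e) (nbhsx_ballx _ _ e0).
have [z [_ /closure_ball_le wz] yz] := truncation_step_near sy (leq0n j).
rewrite in_ballE in xy.
have h1 : (2 ^- 1 - 2 ^- j.+1) * rQ <= 2^-1 * rQ.
  by rewrite ler_wpM2r ?(ltW rQ0)// expr1 gerBl ltW ?half_expn_gt0.
have := metric_triangle w z x; have := metric_triangle z y x.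
rewrite (metric_sym z y) (metric_sym y x); lra.
Qed.

Lemma truncation_inner x t : EQ x -> 0 < t <= rQ ->
  exists y, [/\ E y, dist x y <= t & E `&` closure (ball y (t / 8)) `<=` EQ].
Proof.
move=> hx /andP[t0 tr].
have rt1 : 1 <= rQ / t by rewrite ler_pdivlMr// mul1r.
have [i [i1 i2]] := expn2_between rt1.
have p2 : 0 < (2 : R) ^+ i by rewrite exprn_gt0.
have i1' : 2 ^- i * rQ <= t by rewrite mulrC ler_pdivrMr// -ler_pdivrMl// mulrC.
have i2' : t / 8 <= 2 ^- i.+2 * rQ.
  have : t <= 2 * (2 ^- i * rQ).
    rewrite (_ : 2 * (2 ^- i * rQ) = 2 * rQ / 2 ^+ i); last by ring.
    by rewrite ler_pdivlMr// [t * _]mulrC -ler_pdivlMr// -mulrA.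
  rewrite -(half_expnS i) -(half_expnS i.+1); lra.
have h0 : 0 < 2 ^- i.+1 * rQ by rewrite mulr_gt0 ?half_expn_gt0.
have [x' [[j _ sx] xx']] := hx _ (nbhsx_ballx x _ h0).
rewrite in_ballE in xx'.
have [y [l sy [xy li]]] : exists y, exists2 l, step l y & dist x' y <= 2 ^- i.+1 * rQ /\ 2 ^- i.+2 <= (2 : R) ^- l.+2.
  have [ij|/ltnW ji] := leqP i j.
    have [y sy xy] := truncation_step_near sx ij; exists y, i => //; split => //.
    by apply: (le_trans xy); rewrite ler_wpM2r ?(ltW rQ0)// gerBl ltW ?half_expn_gt0.
  exists x', j => //; rewrite mdistxx ltW//; split => //.
  by rewrite lef_pV2 ?posrE ?exprn_gt0// ler_eXn2l// ltr1n.
exists y; split; first exact: truncation_step_sub sy.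
  have := metric_triangle x x' y; rewrite -(half_expnS i) in i1'; lra.
move=> z [Ez yz]; apply: subset_closure; exists l.+1 => //; exists y => //; split => //.
apply: closure_ball_sub yz; apply: (le_trans i2').
by rewrite ler_wpM2r// ltW.
Qed.

End truncation.

Section averages.
Context (R : realType) (d : measure_display) (X : metricMeasurableType R d).
Variable mu : {measure set X -> \bar R}.
Hypothesis mopen : forall A : set X, open A -> measurable A.
Hypothesis mupos : balls_pos_finite mu.
Local Notation dist := (@mdist R X).
Local Notation m := (ball_mass mu).

Lemma powR_add_le (x y p : R) : 0 <= x -> 0 <= y -> 0 <= p ->
  (x + y) `^ p <= 2 `^ p * (x `^ p + y `^ p).
Proof.
move=> x0 y0 p0; have h z t : 0 <= z -> z <= t -> (z + t) `^ p <= 2 `^ p * (z `^ p + t `^ p).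
  move=> z0 zt; have t0 : 0 <= t by exact: le_trans zt.
  apply: (@le_trans _ _ ((2 * t) `^ p)).
    by apply: ge0_ler_powR; rewrite ?nnegrE ?addr_ge0 ?mulr_ge0//; lra.
  by rewrite powRM// ler_wpM2l ?powR_ge0// lerDr powR_ge0.
have [xy|/ltW yx] := leP x y; first exact: h.
by rewrite addrC [X in _ * X]addrC; exact: h.
Qed.

Lemma averageE x r f : 0 < r ->
  average mu (ball x r) f = (((m x r)^-1)%:E * \int[mu]_(z in ball x r) f z)%E.
Proof.
by move=> r0; rewrite /average ball_massE// inver gt_eqF// ball_mass_gt0.
Qed.

Lemma average_le x r f c : 0 < r -> (\int[mu]_(z in ball x r) f z <= (c * m x r)%:E)%E ->
  (average mu (ball x r) f <= c%:E)%E.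
Proof.
move=> r0 h; have m0 := ball_mass_gt0 mupos x r0; rewrite averageE//.
apply: (@le_trans _ _ (((m x r)^-1)%:E * (c * m x r)%:E)%E).
  by apply: lee_wpmul2l => //; rewrite lee_fin invr_ge0 ltW.
by rewrite -EFinM lee_fin mulrCA mulVf ?gt_eqF// mulr1.
Qed.

Lemma holder_continuous (beta : R) (u : X -> R) : 0 < beta -> holder beta u -> continuous u.
Proof.
move=> b0 [k k0 hk] x; apply/cvgrPdist_le => e e0.
pose r := (e / (k + 1)) `^ beta^-1.
have k1 : 0 < k + 1 by lra.
have r0 : 0 < r by apply: powR_gt0; rewrite divr_gt0.
have := nbhsx_ballx x r r0; apply: filterS => y; rewrite in_ballE => xy.
apply: (le_trans (hk x y)); apply: (@le_trans _ _ (k * r `^ beta)).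
  by rewrite ler_wpM2l//; apply: ge0_ler_powR; rewrite ?nnegrE ?mdist_ge0 ?(ltW b0) ?(ltW r0)// ltW.
rewrite /r powR_root_cancel ?gt_eqF//; last by rewrite divr_ge0 ?(ltW e0) ?(ltW k1).
by rewrite mulrCA ler_piMr ?(ltW e0)// ler_pdivrMr// mul1r lerDl.
Qed.

Lemma continuous_measurable (u : X -> R) : continuous u -> measurable_fun setT u.
Proof.
move=> /continuousP cu; apply: (measurability _ (RGenOpens.measurableE R)).
by move=> _ [_ [a [b ->]] <-]; rewrite setTI; apply: mopen; apply: cu; exact: interval_open.
Qed.

Lemma holder_integrable (beta : R) (u : X -> R) x r : 0 < beta -> 0 < r -> holder beta u ->
  mu.-integrable (ball x r) (EFin \o u).
Proof.
move=> b0 r0 hu; apply: measurable_bounded_integrable.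
- exact: measurable_ball.
- by case/andP: (mupos x r0).
- apply: measurable_funS (measurableT) _ _ => //.
  exact: continuous_measurable (holder_continuous b0 hu).
have [k k0 hk] := hu.
exists (`|u x| + k * r `^ beta); split; first exact: num_real.
move=> M hM y; rewrite /= in_ballE => xy; apply/ltW/(le_lt_trans _ hM).
rewrite -[u y](subrK (u x)) addrC (le_trans (ler_normD _ _))// lerD2l distrC.
apply: (le_trans (hk _ _)); rewrite ler_wpM2l//.
by apply: ge0_ler_powR; rewrite ?nnegrE ?mdist_ge0 ?(ltW b0) ?(ltW r0)// ltW.
Qed.

Lemma mean_deviation_le (beta p c M : R) (u : X -> R) x r : 0 < beta -> 0 < r ->
  1 <= p -> 0 < M -> holder beta u ->
  (\int[mu]_(z in ball x r) (`|u z - c| `^ p)%:E <= (M * m x r)%:E)%E ->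
  `|fine (average mu (ball x r) (EFin \o u)) - c| `^ p <= 2 `^ p * M.
Proof.
move=> b0 r0 p1 M0 hu hM; set B := ball x r.
have p0 : 0 < p by lra.
have m0 := ball_mass_gt0 mupos x r0.
have mB : measurable B by exact: measurable_ball.
have muB : mu B = (m x r)%:E by rewrite ball_massE.
have iu := holder_integrable x b0 r0 hu.
have Ifin : (\int[mu]_(z in B) (u z)%:E)%E \is a fin_num by exact: integrable_fin_num iu.
pose I := fine (\int[mu]_(z in B) (u z)%:E)%E.
have -> : average mu B (EFin \o u) = ((m x r)^-1 * I)%:E.
  by rewrite averageE//= EFinM /I fineK.
have ic : mu.-integrable B (EFin \o (fun=> c)).
  apply: measurable_bounded_integrable => //; first by rewrite muB ltry.
  by exists `|c|; split; [exact: num_real|move=> M' hM' y _; exact: ltW].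
have IE : ((I - c * m x r)%:E = \int[mu]_(z in B) ((u z)%:E - c%:E))%E.
  by rewrite (integralB mB iu ic) /= integral_cst// muB -EFinM EFinB /I fineK.
pose l := M `^ p^-1.
have l0 : 0 < l by rewrite powR_gt0.
have lp : l `^ p = M by rewrite powR_root_cancel ?gt_eqF// ltW.
have young t : 0 <= t -> t <= l + l `^ (1 - p) * t `^ p.
  move=> t0; have [tl|lt] := leP t l; first by rewrite (le_trans tl)// lerDl mulr_ge0 ?powR_ge0.
  have t0' : 0 < t by exact: lt_trans lt.
  apply: (@le_trans _ _ (l `^ (1 - p) * t `^ p)); last by rewrite lerDr ltW.
  rewrite -(mulr_powRB1 t0 p0) mulrCA ler_peMr// -[1 - p]opprB powRN.
  rewrite mulrC ler_pdivlMr ?powR_gt0// mul1r.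
  by apply: ge0_ler_powR; rewrite ?nnegrE ?subr_ge0// ltW.
have mu0 : measurable_fun setT u := continuous_measurable (holder_continuous b0 hu).
have key : `|I - c * m x r| <= 2 * l * m x r.
  have mu1 : measurable_fun B (fun z => (u z)%:E - c%:E)%E.
    apply: emeasurable_funB => //; apply/measurable_EFinP; exact: measurable_funS mu0.
  have mu2 : measurable_fun B (fun z => (`|u z - c| `^ p)%:E).
    apply/measurable_EFinP; apply: (measurable_funS measurableT) => //.
    apply: (measurableT_comp (measurable_powR p)); apply: measurableT_comp => //.
    exact: measurable_funB.
  have : (`|(I - c * m x r)%:E| <= (l * m x r)%:E + (l `^ (1 - p))%:E * (M * m x r)%:E)%E.
    rewrite IE; apply: (le_trans (le_abse_integral mu mB mu1)).
    apply: (@le_trans _ _ (\int[mu]_(z in B) (l%:E + (l `^ (1 - p))%:E * (`|u z - c| `^ p)%:E))%E).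
      apply: ge0_le_integral_pointwise => // z _; rewrite -EFinB -EFinM -EFinD lee_fin.
      exact: young.
    rewrite ge0_integralD//; last 3 first.
    - by move=> z _; rewrite lee_fin ltW.
    - by move=> z _; rewrite mule_ge0// lee_fin powR_ge0.
    - exact: measurable_funeM.
    rewrite integral_cst// muB -EFinM leeD2l// ge0_integralZl//.
    - by apply: lee_wpmul2l => //; rewrite lee_fin powR_ge0.
    - by rewrite lee_fin powR_ge0.
  rewrite -EFinM -EFinD lee_fin => /le_trans; apply.
  have -> : M = l `^ (p - 1) * l by rewrite mulrC mulr_powRB1// ltW.
  rewrite -[1 - p]opprB powRN le_eqVlt; apply/orP; left; apply/eqP.
  by field; rewrite gt_eqF// powR_gt0.
rewrite /=.
have -> : (m x r)^-1 * I - c = (I - c * m x r) / m x r by field; rewrite gt_eqF.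
rewrite normrM normfV (gtr0_norm m0).
apply: (@le_trans _ _ ((2 * l) `^ p)); last by rewrite powRM ?(ltW l0)// lp.
apply: ge0_ler_powR; rewrite ?nnegrE ?(ltW p0)//.
- by rewrite divr_ge0// ltW.
- by rewrite mulr_ge0// ltW.
- by rewrite ler_pdivrMr.
Qed.

End averages.

Section content_consequences.
Context (R : realType) (d : measure_display) (X : metricMeasurableType R d).
Variable mu : {measure set X -> \bar R}.
Hypothesis mopen : forall A : set X, open A -> measurable A.
Hypothesis mupos : balls_pos_finite mu.
Hypothesis mudbl : doubling mu.
Hypothesis hX : exists x y : X, x <> y.
Hypothesis geo : geodesic_space X.
Local Notation dist := (@mdist R X).
Local Notation m := (ball_mass mu).

Variables (beta q : R) (E : set X).
Hypotheses (beta0 : 0 < beta) (q0 : 0 < q) (cE : closed E).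
Hypothesis dens : content_density mu q E.

Lemma lt_mule_inv (r k : R) (D : \bar R) : 0 < k -> (r%:E < (k^-1)%:E * D)%E -> ((k * r)%:E < D)%E.
Proof.
move=> k0; case: D => [D| |].
- by rewrite -EFinM !lte_fin mulrC ltr_pdivlMr// mulrC.
- by move=> _; exact: ltry.
- by rewrite gt0_muleNy ?lte_fin ?invr_gt0// ltNge leNye.
Qed.

Lemma content_capacity_density (p : R) : 0 < p -> q < beta * p -> capacity_density mu beta p E.
Proof.
move=> p0 qp; have [C C0 hC] := content_density_good_point mopen mupos mudbl dens beta0 p0 qp.
have [C1 C10 hC1] := ball_mass_compare mopen mupos mudbl 10.
have [C2 [C20 C2p]] : exists C2 : R, 0 < C2 /\ C2 `^ p = C1.
  exact: exists_powR_root.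
pose T := C + 6 `^ beta * (C + C2).
have T0 : 0 < T by rewrite addr_gt0// mulr_gt0 ?powR_gt0// addr_gt0.
have [k [k0 kT]] : exists k : R, 0 < k /\ k * T = 2^-1.
  by exists (2^-1 / T); rewrite divr_gt0// divfK// gt_eqF.
exists (k `^ p); first by rewrite powR_gt0.
move=> x r Ex r0 rE; apply: le_ereal_inf_tmp => _ [u [g [hu u1 u0 hg ->]]].
have rE8 := lt_mule_inv (ltr0n _ 8) rE.
have rdE : (r%:E < diam E)%E.
  by apply: le_lt_trans rE8; rewrite lee_fin ler_peMl ?(ltW r0)//; lra.
have /hajlasz_gradientP[N H] := hg.
rewrite leNgt; apply/negP => hlt.
pose a := k * r `^ (- beta).
have a0 : 0 < a by rewrite mulr_gt0 ?powR_gt0.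
have ra : r `^ beta * a = k by rewrite /a powRN mulrCA divff ?mulr1// gt_eqF ?powR_gt0.
have rb0 : 0 < r `^ beta by rewrite powR_gt0.
have ap : k `^ p * r `^ (- (beta * p)) = a `^ p.
  by rewrite /a powRM ?powR_ge0 ?(ltW k0)// -powRrM mulNr.
rewrite ap ball_massE// -EFinM in hlt.
have sub A : (\int[mu]_(z in A) (g z `^ p) <= \int[mu]_z (g z `^ p))%E.
  by apply: ge0_subset_integral_pointwise => // z _; exact: poweR_ge0.
have [z [x1 [Ez xz xx1 [Nx1 gx1 ux1]]]] :=
  hC x r a u g N Ex r0 rdE a0 hu H (le_trans (sub _) (ltW hlt)).
have [e Ee xe] : exists2 e, E e & 8 * r / 2 < dist x e.
  by apply: exists_far_point => //; rewrite mulr_ge0// ltW.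
have [y0 [xy0 _]] : exists y0, dist x y0 = 3 * r /\ dist y0 e = dist x e - 3 * r.
  by apply: geodesic_between => //; apply/andP; split; lra.
have [y [By Ny gy]] : exists y, [/\ ball y0 r y, ~ N y & (g y <= (C2 * a)%:E)%E].
  apply: (hajlasz_good_point H (p := p)) => //.
  - exact: measurable_ball.
  - by rewrite mulr_ge0// ltW.
  apply: (le_lt_trans (sub _)); apply: (lt_le_trans hlt).
  rewrite ball_massE// -EFinM lee_fin powRM ?(ltW C20) ?(ltW a0)// C2p mulrAC [leRHS]mulrC.
  by rewrite ler_wpM2l ?powR_ge0// hC1//; lra.
have uy : u y = 0.
  apply: u0; move: By; rewrite !in_ballE => y0y xy.
  by have := metric_triangle x y y0; rewrite (metric_sym y); lra.
have d1 : dist x1 y <= 6 * r.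
  move: By xx1; rewrite !in_ballE => y0y xx1.
  have := metric_triangle x1 x y; have := metric_triangle x y0 y.
  by rewrite (metric_sym x1 x); lra.
have h1 := hajlasz_dist H (ltW beta0) Nx1 Ny d1 gx1 gy.
have uz : 1 <= u z by apply: u1.
have : 1 <= `|u z - u y| by rewrite uy subr0 ler_normr uz.
move=> /le_trans /(_ (ler_distD (u x1) _ _)); rewrite distrC.
move=> /le_trans /(_ (lerD ux1 h1)); rewrite powRM ?(ltW r0)//.
rewrite (_ : _ + _ = r `^ beta * a * T); last by rewrite /T; ring.
by rewrite ra kT; lra.
Qed.

Lemma truncation_good_point (p : R) : 0 < p -> q < beta * p -> exists2 C : R, 0 < C &
  forall (w x : X) (r t a : R) u g N, E w -> 0 < r -> (r%:E < diam E)%E ->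
  truncation E w (r / 128) x -> 0 < t <= r / 128 -> 0 < a ->
  holder beta u -> (forall z, truncation E w (r / 128) z -> u z = 0) ->
  hajlasz_off mu beta u g N ->
  (\int[mu]_(z in ball x (2 * t)) (g z `^ p) <= (a `^ p * m x (2 * t))%:E)%E ->
  exists x1, [/\ ball x (2 * t) x1, ~ N x1, (g x1 <= (C * a)%:E)%E & `|u x1| <= C * t `^ beta * a].
Proof.
move=> p0 qp; have [C C0 hC] := content_density_good_point mopen mupos mudbl dens beta0 p0 qp.
have [C1 C10 hC1] := ball_mass_compare mopen mupos mudbl 24.
have [C2 [C20 C2p]] : exists C2 : R, 0 < C2 /\ C2 `^ p = C1.
  exact: exists_powR_root.
exists (C * C2); first by rewrite mulr_gt0.
move=> w x r t a u g N Ew r0 rE xEQ /andP[t0 tr] a0 hu u0 H hg.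
have r1280 : 0 < r / 128 by rewrite divr_gt0.
have [y [Ey xy yEQ]] := @truncation_inner _ _ E w (r / 128) r1280 x t xEQ ltac:(by rewrite t0).
have t80 : 0 < t / 8 by rewrite divr_gt0.
have t8E : ((t / 8)%:E < diam E)%E by apply: lt_trans rE; rewrite lte_fin; lra.
have sub : ball y (2 * (t / 8)) `<=` ball x (2 * t) by apply: ball_sub; lra.
have h : (\int[mu]_(z in ball y (2 * (t / 8))) (g z `^ p) <= ((C2 * a) `^ p * m y (t / 8))%:E)%E.
  apply: (@le_trans _ _ (\int[mu]_(z in ball x (2 * t)) (g z `^ p))%E).
    by apply: ge0_subset_integral_pointwise => // z _; exact: poweR_ge0.
  apply: (le_trans hg); rewrite lee_fin powRM ?(ltW C20) ?(ltW a0)// C2p mulrAC [leRHS]mulrC.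
  by rewrite ler_wpM2l ?powR_ge0// hC1//; lra.
have [z [x1 [Ez yz yx1 [Nx1 gx1 ux1]]]] :=
  hC y (t / 8) (C2 * a) u g N Ey t80 t8E (mulr_gt0 C20 a0) hu H h.
exists x1; split => //; first exact: sub.
  by rewrite -mulrA.
have : `|u x1| = `|u x1 - u z| by rewrite (u0 z) ?subr0//; apply: yEQ.
move=> ->; apply: (le_trans ux1).
rewrite (_ : C * C2 * _ * a = C * t `^ beta * (C2 * a)); last by ring.
rewrite ler_wpM2r ?mulr_ge0 ?(ltW C20) ?(ltW a0)// ler_wpM2l ?(ltW C0)//.
by apply: ge0_ler_powR; rewrite ?nnegrE ?(ltW beta0) ?(ltW t0) ?(ltW t80)//; lra.
Qed.

Lemma hajlasz_pow_le (p M : R) : 0 < p -> 0 < M -> exists2 C : R, 0 < C &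
  forall u g N (x x1 : X) (rho a : R), hajlasz_off mu beta u g N -> 0 < rho -> 0 < a ->
  ~ N x -> ~ N x1 -> dist x x1 <= rho -> (g x1 <= (M * a)%:E)%E ->
  `|u x1| <= M * rho `^ beta * a ->
  ((`|u x| `^ p)%:E <= (C * rho `^ (beta * p))%:E * ((a `^ p)%:E + g x `^ p))%E.
Proof.
move=> p0 M0; exists ((2 * M + 1) `^ p * 2 `^ p).
  by rewrite mulr_gt0 ?powR_gt0// addr_gt0// mulr_gt0.
move=> u g N x x1 rho a H rho0 a0 Nx Nx1 xx1 gx1 ux1.
have [_ g0 _ _] := H; have M1 : 0 < 2 * M + 1 by lra.
have K0 : 0 < (2 * M + 1) `^ p * 2 `^ p * rho `^ (beta * p) by rewrite !mulr_gt0 ?powR_gt0.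
have := g0 x; case G_ : (g x) => [G| |]// G0; last first.
  by rewrite poweRyr ?gt_eqF// addey// gt0_muley ?lte_fin// leey.
rewrite lee_fin in G0; rewrite poweR_EFin -EFinD -EFinM lee_fin.
have h := hajlasz_dist H (ltW beta0) Nx Nx1 xx1 (_ : (g x <= G%:E)%E) gx1.
have {}h := h ltac:(by rewrite G_).
have rb0 : 0 < rho `^ beta by rewrite powR_gt0.
have ux : `|u x| <= rho `^ beta * (2 * M + 1) * (a + G).
  rewrite -[u x](subrK (u x1)) (le_trans (ler_normD _ _))// (le_trans (lerD h ux1))//.
  rewrite -subr_ge0 (_ : _ - _ = rho `^ beta * (a + 2 * M * G)); last by ring.
  by rewrite mulr_ge0 ?(ltW rb0)// addr_ge0 ?(ltW a0)// !mulr_ge0 ?(ltW M0).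
apply: (@le_trans _ _ ((rho `^ beta * (2 * M + 1) * (a + G)) `^ p)).
  by apply: ge0_ler_powR; rewrite ?nnegrE ?(ltW p0)// (le_trans _ ux).
have aG0 : 0 <= a + G by rewrite addr_ge0// ltW.
rewrite !powRM ?mulr_ge0 ?(ltW rb0) ?(ltW M1)// -powRrM.
rewrite [leRHS](_ : _ = rho `^ (beta * p) * (2 * M + 1) `^ p * (2 `^ p * (a `^ p + G `^ p))); last by ring.
by rewrite ler_wpM2l ?mulr_ge0 ?powR_ge0// powR_add_le// ltW.
Qed.

Lemma content_local_boundary_poincare (p : R) : 0 < p -> q < beta * p ->
  local_boundary_poincare mu beta p E.
Proof.
move=> p0 qp; have [C C0 hC] := truncation_good_point p0 qp.
have [C1 C10 hC1] := ball_mass_compare mopen mupos mudbl 256.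
have [C2 [C20 C2p]] : exists C2 : R, 0 < C2 /\ C2 `^ p = C1.
  exact: exists_powR_root.
have [C3 C30 hC3] := hajlasz_pow_le p0 (mulr_gt0 C0 C20).
exists (2 * (C3 * 4 `^ (beta * p))); move=> w r Ew r0 rE /= xB rB rB0 EQx Bsub u g hu u0 hg.
have /hajlasz_gradientP[N H] := hg; have [mg g0 N0 _] := H.
have [D [r' [DE D0 /andP[r'0 r'D] Dr' BE]]] := ball_diam hX geo xB rB0.
have r1280 : 0 <= 2 * (4 * (r / 128)) by rewrite !mulr_ge0 ?invr_ge0// ltW.
have D8 : D <= 2 * (4 * (r / 128)).
  rewrite -lee_fin -DE; apply: diam_le => // y z /Bsub + /Bsub; exact: ball_dist_le.
have r'r : r' <= 4 * r.
  apply: le_mul4 => //; apply: (le_trans r'D).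
  by rewrite mul4E ler_pM2l.
have [t [tr /andP[t20 t2r] tr' rt]] := exists_scale r'0 r'r.
rewrite DE BE poweR_EFin !averageE//; set B := ball xB r'.
have mB : measurable B by exact: measurable_ball.
have m0 := ball_mass_gt0 mupos xB r'0.
have muB : mu B = (m xB r')%:E by rewrite ball_massE.
have gp0 z : (0 <= g z `^ p)%E by exact: poweR_ge0.
have mgp : measurable_fun B (fun z => g z `^ p)%E.
  by apply: measurable_funS (measurableT) _ (hajlasz_measurable_pow H p).
set I := (\int[mu]_(x in B) (g x `^ p))%E.
have I0 : (0 <= I)%E by apply: integral_ge0.
have [c [c0 c_def]] : exists c : R, 0 < c /\ c = C3 * (2 * r') `^ (beta * p).
  by exists (C3 * (2 * r') `^ (beta * p)); rewrite mulr_gt0 ?powR_gt0 ?mulr_gt0.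
have key : (\int[mu]_(z in B) (`|u z| `^ p)%:E <= (2 * c)%:E * I)%E.
  case E_ : I I0 => [I'| |]// I0; last by rewrite gt0_muley ?lte_fin ?mulr_gt0// leey.
  rewrite lee_fin in I0; rewrite -EFinM; apply/lee_addgt0Pr => e e0; rewrite -EFinD.
  have [eps [eps0 epsE]] : exists eps : R, 0 < eps /\ c * (eps * m xB r') = e.
    exists (e / (c * m xB r')); rewrite divr_gt0 ?mulr_gt0//; split => //.
    by field; rewrite !gt_eqF.
  have Im0 : 0 < I' / m xB r' + eps by rewrite ltr_wpDl// divr_ge0// ltW.
  have [a [a0 ap]] : exists a : R, 0 < a /\ a `^ p = I' / m xB r' + eps.
    exact: exists_powR_root.
  have hI : (\int[mu]_(z in ball xB (2 * t)) (g z `^ p) <= ((C2 * a) `^ p * m xB (2 * t))%:E)%E.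
    apply: (@le_trans _ _ I).
      by apply: ge0_subset_integral_pointwise => //; apply: ball_sub; rewrite mdistxx add0r.
    rewrite E_ lee_fin powRM ?(ltW C20) ?(ltW a0)// C2p ap.
    apply: (@le_trans _ _ ((I' / m xB r' + eps) * m xB r')).
      by rewrite mulrDl divfK ?gt_eqF// lerDl mulr_ge0// ltW.
    by rewrite mulrAC [leRHS]mulrC ler_wpM2l ?(ltW Im0)//; apply: hC1 => //; rewrite mdistxx add0r.
  have [x1 [Bx1 Nx1 gx1 ux1]] := hC w xB r t (C2 * a) u g N Ew r0 rE EQx tr (mulr_gt0 C20 a0) hu u0 H hI.
  have pt z : B z -> ~ N z -> ((`|u z| `^ p)%:E <= c%:E * ((a `^ p)%:E + g z `^ p))%E.
    move=> Bz Nz; rewrite c_def; apply: (hC3 u g N z x1 (2 * r') a) => //.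
    - by rewrite mulr_gt0.
    - apply: (ball_dist_le Bz); move: Bx1; apply: ball_sub.
      by rewrite mdistxx add0r.
    - by rewrite -mulrA.
    - apply: (le_trans ux1); rewrite (_ : C * _ * _ = C * C2 * t `^ beta * a); last by ring.
      rewrite ler_wpM2r ?(ltW a0)// ler_wpM2l ?mulr_ge0 ?(ltW C0) ?(ltW C20)//.
      have t0 : 0 < t by case/andP: tr.
      apply: ge0_ler_powR; rewrite ?nnegrE ?mulr_ge0 ?(ltW beta0) ?(ltW t0) ?(ltW r'0)//.
      by rewrite (le_trans tr')// ler_peMl ?ler1n// ltW.
  apply: (@le_trans _ _ (\int[mu]_(z in B) (c%:E * ((a `^ p)%:E + g z `^ p)))%E).
    apply: (ge0_le_integral_null mB N0) => //.
      by apply: measurable_funeM; apply: emeasurable_funD.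
    by move=> z _; rewrite mule_ge0// ?adde_ge0// lee_fin ?powR_ge0// ltW.
  rewrite ge0_integralZl//; last 3 first.
  - exact: emeasurable_funD.
  - by move=> z _; rewrite adde_ge0// lee_fin powR_ge0.
  - by rewrite lee_fin ltW.
  rewrite ge0_integralD//; last by move=> z _; rewrite lee_fin powR_ge0.
  rewrite integral_cst// muB -/I E_ -(EFinM (a `^ p)) -(EFinD _ I') -EFinM lee_fin ap -epsE.
  by rewrite le_eqVlt; apply/orP; left; apply/eqP; field; rewrite gt_eqF.
rewrite -(EFinM (2 * (C3 * 4 `^ (beta * p)))) [leRHS]muleCA.
apply: lee_wpmul2l; first by rewrite lee_fin invr_ge0 ltW.
apply: (le_trans key); apply: lee_wpmul2r => //.
rewrite lee_fin c_def -!mulrA ler_pM2l// ler_pM2l// -powRM ?(ltW D0)//.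
apply: ge0_ler_powR; rewrite ?nnegrE ?mulr_ge0 ?(ltW beta0) ?(ltW p0) ?(ltW r'0) ?(ltW D0)//.
by rewrite mul4E ler_pM2l.
Qed.

Lemma content_local_hardy (p p' : R) : 0 < p' < p -> q < beta * p' ->
  local_hardy mu beta p E.
Proof.
move=> /andP[p'0 p'p] qp; have p0 : 0 < p by exact: lt_trans p'p.
have [C C0 hC] := truncation_good_point p'0 qp.
have [C1 C10 hC1] := ball_mass_compare mopen mupos mudbl 2048.
have [C2 [C20 C2p]] : exists C2 : R, 0 < C2 /\ C2 `^ p' = C1.
  exact: exists_powR_root.
have [C3 C30 hC3] := hajlasz_pow_le p0 (mulr_gt0 C0 C20).
have tau1 : 1 < p / p' by rewrite ltr_pdivlMr// mul1r.
have [C4 C40 hC4] := maximal_strong_type mopen mupos mudbl tau1.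
have [c [c0 c_def]] : exists c : R, 0 < c /\ c = C3 * 4 `^ (beta * p).
  by exists (C3 * 4 `^ (beta * p)); rewrite mulr_gt0 ?powR_gt0.
exists (C4 * c + c); move=> w r Ew r0 rE EQ u g hu u0 hg.
have /hajlasz_gradientP[N H] := hg; have [mg g0 N0 _] := H.
pose W := ball w r.
have mW : measurable W by exact: measurable_ball.
have EQ0 : EQ !=set0 by exists w; apply: truncation_center => //; rewrite divr_gt0.
have EQcl : closed EQ by exact: truncation_closed.
pose V x := ((`|u x| `^ p)%:E / edist_inf EQ x `^ (beta * p))%E.
have V0 x : (0 <= V x)%E.
  by rewrite mule_ge0// ?lee_fin ?powR_ge0// inve_ge0 poweR_ge0.
pose Phi := V \_ (~` EQ).
have mgp s : measurable_fun setT (fun z => g z `^ s)%E := hajlasz_measurable_pow H s.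
have gpp x : ((g x `^ p') `^ (p / p') = g x `^ p)%E.
  by rewrite -poweRrM mulrCA divff ?mulr1// gt_eqF.
have := @hC4 w r (4 * r) c (fun x => g x `^ p')%E Phi (fun x => c%:E * g x `^ p)%E N.
under [X in (_ <= (C4 * c)%:E * X + _)%E]eq_integral do rewrite gpp.
rewrite setDE integral_mkcondr -/V -/Phi => h.
have {}h : (\int[mu]_(x in W) Phi x <= (C4 * c)%:E * \int[mu]_(x in W) (g x `^ p) +
    \int[mu]_(x in W) (c%:E * g x `^ p))%E.
  apply: h => //; first by rewrite mulr_gt0.
  - by move=> x; exact: poweR_ge0.
  - by move=> x; apply: erestrict_ge0.
  - exact: measurable_funeM.
  - by move=> x; rewrite mule_ge0 ?lee_fin ?(ltW c0)// poweR_ge0.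
  move=> l x l0 Wx Nx nlev; rewrite /Phi /patch.
  case: ifPn => [/set_mem/= nEQ|_]; last first.
    by rewrite adde_ge0// ?mule_ge0 ?lee_fin ?poweR_ge0// ?mulr_ge0 ?powR_ge0// ltW.
  rewrite /V edist_infE// poweR_EFin; set de := dist_set EQ x.
  have de0 : 0 < de by exact: dist_set_gt0.
  have EQw : EQ w by apply: truncation_center => //; rewrite divr_gt0.
  have der : de < r.
    by apply: le_lt_trans (dist_set_le x EQw) _; rewrite metric_sym -in_ballE.
  have [x' EQx' xx'] : exists2 x', EQ x' & dist x x' < 2 * de.
    by apply: dist_set_lt => //; rewrite -/de ltr_pMl// ltr1n.
  have de4r : de <= 4 * r by rewrite (le_trans (ltW der))// ler_peMl ?ler1n// ltW.
  have [t [tr /andP[t20 t2r] tr' rt]] := exists_scale de0 de4r.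
  have t0 : 0 < t by case/andP: tr.
  have [h1 h2 h3] := hardy_scale de0 r0 tr t2r rt xx'.
  have [a [a0 ap]] : exists a : R, 0 < a /\ a `^ p' = l.
    exact: exists_powR_root.
  have de40 : 0 < 4 * de by rewrite mulr_gt0.
  have hball : (\int[mu]_(z in ball x (4 * de) `&` W) (g z `^ p') <= (l * m x (4 * de))%:E)%E.
    rewrite leNgt; apply/negP => lt; apply: nlev; exists x, (4 * de); split => //.
    - by rewrite de40 ler_pM2l// ltW.
    - by rewrite in_ballE mdistxx.
  have wx' : dist w x' <= r / 128 by apply: (truncation_dist (E := E)) => //; rewrite divr_gt0.
  have hI : (\int[mu]_(z in ball x' (2 * t)) (g z `^ p') <= ((C2 * a) `^ p' * m x' (2 * t))%:E)%E.
    apply: (@le_trans _ _ (\int[mu]_(z in ball x (4 * de) `&` W) (g z `^ p'))%E).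
      apply: ge0_subset_integral_pointwise; last by move=> z _; exact: poweR_ge0.
      rewrite subsetI; split; apply: ball_sub => //.
      by rewrite (le_trans _ h2)// lerD2r.
    apply: (le_trans hball); rewrite lee_fin powRM ?(ltW C20) ?(ltW a0)// C2p ap.
    by rewrite mulrAC [leRHS]mulrC ler_wpM2l ?(ltW l0)//; apply: hC1.
  have [x1 [Bx1 Nx1 gx1 ux1]] := hC w x' r t (C2 * a) u g N Ew r0 rE EQx' tr (mulr_gt0 C20 a0) hu u0 H hI.
  have ux : ((`|u x| `^ p)%:E <= (C3 * (4 * de) `^ (beta * p))%:E * ((a `^ p)%:E + g x `^ p))%E.
    apply: (hC3 u g N x x1 (4 * de) a) => //.
    - move: Bx1; rewrite in_ballE => Bx1; apply: (le_trans (metric_triangle x x' x1)).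
      by rewrite (le_trans _ h1)// lerD2l ltW.
    - by rewrite -mulrA.
    - apply: (le_trans ux1); rewrite (_ : C * _ * _ = C * C2 * t `^ beta * a); last by ring.
      rewrite ler_wpM2r ?(ltW a0)// ler_wpM2l ?mulr_ge0 ?(ltW C0) ?(ltW C20)//.
      apply: ge0_ler_powR; rewrite ?nnegrE ?(ltW beta0) ?(ltW t0) ?(ltW de40)//.
      by rewrite (le_trans tr')// ler_peMl ?ler1n// ltW.
  have deb0 : 0 < de `^ (beta * p) by rewrite powR_gt0.
  rewrite inver gt_eqF//.
  apply: (@le_trans _ _ ((C3 * (4 * de) `^ (beta * p))%:E * ((a `^ p)%:E + g x `^ p) * ((de `^ (beta * p))^-1)%:E)%E).
    by apply: lee_wpmul2r => //; rewrite lee_fin invr_ge0 ltW.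
  rewrite muleAC -EFinM.
  have -> : C3 * (4 * de) `^ (beta * p) / de `^ (beta * p) = c.
    by rewrite powRM ?(ltW de0)// mulrA mulfK ?gt_eqF.
  rewrite ge0_muleDr ?poweR_ge0 ?lee_fin ?powR_ge0// -EFinM.
  by rewrite -ap -powRrM mulrCA divff ?mulr1// gt_eqF.
apply: (le_trans h); rewrite ge0_integralZl//.
- by rewrite EFinD ge0_muleDl ?lee_fin ?mulr_ge0 ?(ltW C40) ?(ltW c0).
- exact: measurable_funS (mgp p).
- by move=> x _; exact: poweR_ge0.
- by rewrite lee_fin ltW.
Qed.

End content_consequences.

Section content_maximal.
Context (R : realType) (d : measure_display) (X : metricMeasurableType R d).
Variable mu : {measure set X -> \bar R}.
Hypothesis mopen : forall A : set X, open A -> measurable A.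
Hypothesis mupos : balls_pos_finite mu.
Hypothesis mudbl : doubling mu.
Hypothesis hX : exists x y : X, x <> y.
Hypothesis geo : geodesic_space X.
Local Notation dist := (@mdist R X).
Local Notation m := (ball_mass mu).

Lemma poweR_root_le (x : \bar R) (y p : R) : 0 < p -> (0 <= x)%E -> 0 <= y ->
  (x <= (y `^ p)%:E)%E -> (x `^ p^-1 <= y%:E)%E.
Proof.
move=> p0 x0 y0 h; apply: (@poweR_le_cancel _ _ _ p) => //; first exact: poweR_ge0.
by rewrite -poweRrM mulVf ?gt_eqF// poweRe1.
Qed.

Lemma affine_add_le (S P Q k c1 c2 : R) (h : \bar R) : 0 < k -> 0 < c1 -> 0 < c2 ->
  (0 <= h)%E -> S <= k * (P + Q) -> (P%:E <= c1%:E * (1 + h))%E -> Q <= c2 ->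
  (S%:E <= (k * (c1 + c2))%:E * (1 + h))%E.
Proof.
move=> k0 c10 c20; case: h => [h| |]//; last first.
  by move=> *; rewrite addey// gt0_muley ?lte_fin ?leey ?mulr_gt0 ?addr_gt0.
rewrite lee_fin -(EFinD 1) -!EFinM !lee_fin => h0 SPQ Ph Qc.
apply: (le_trans SPQ); rewrite -mulrA ler_pM2l// mulrDl lerD// (le_trans Qc)//.
by rewrite ler_peMr ?(ltW c20)// lerDl.
Qed.

Lemma normalized_average_le (beta p T D a : R) (A : \bar R) : 0 < p -> 0 < D -> 0 <= T ->
  0 < a -> (0 <= A)%E -> (A <= (T `^ p * D `^ (beta * p) * a `^ p)%:E)%E ->
  ((A / D%:E `^ (beta * p)) `^ p^-1 <= (T * a)%:E)%E.
Proof.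
move=> p0 D0 T0 a0 A0 h.
have Db0 : 0 < D `^ (beta * p) by rewrite powR_gt0.
apply: poweR_root_le => //.
- by rewrite mule_ge0// inve_ge0 poweR_ge0.
- by rewrite mulr_ge0// ltW.
rewrite poweR_EFin inver gt_eqF//.
apply: (@le_trans _ _ ((T `^ p * D `^ (beta * p) * a `^ p)%:E * ((D `^ (beta * p))^-1)%:E)%E).
  by apply: lee_wpmul2r => //; rewrite lee_fin invr_ge0 ltW.
rewrite -EFinM lee_fin powRM ?(ltW a0)// le_eqVlt; apply/orP; left; apply/eqP.
by field; rewrite gt_eqF.
Qed.

Lemma integral_le_of_affine (beta p c a : R) u g N (y : X) (r : R) (f : X -> \bar R) :
  hajlasz_off mu beta u g N -> 0 < p -> 0 < r -> 0 < a -> 0 <= c ->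
  (\int[mu]_(x in ball y r) (g x `^ p) <= (a `^ p * m y r)%:E)%E ->
  (forall z, (0 <= f z)%E) ->
  (forall z, ball y r z -> ~ N z -> (f z <= c%:E * (1 + (a `^ (- p))%:E * g z `^ p))%E) ->
  (\int[mu]_(x in ball y r) f x <= (2 * c * m y r)%:E)%E.
Proof.
move=> H p0 r0 a0 c0 hg f0 hf; have [mg g0 N0 _] := H.
have mB : measurable (ball y r) by exact: measurable_ball.
have ap0 : 0 < a `^ (- p) by rewrite powR_gt0.
have mgp : measurable_fun (ball y r) (fun z => g z `^ p)%E.
  by apply: measurable_funS (measurableT) _ (hajlasz_measurable_pow H p).
have h0 z : (0 <= (a `^ (- p))%:E * g z `^ p)%E by rewrite mule_ge0 ?lee_fin ?poweR_ge0// ltW.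
have mh : measurable_fun (ball y r) (fun z => (a `^ (- p))%:E * g z `^ p)%E by exact: measurable_funeM.
apply: (@le_trans _ _ (\int[mu]_(z in ball y r) (c%:E * (1 + (a `^ (- p))%:E * g z `^ p)))%E).
  apply: (ge0_le_integral_null mB N0) => //.
    by apply: measurable_funeM; apply: emeasurable_funD.
  by move=> z _; rewrite mule_ge0// adde_ge0.
rewrite ge0_integralZl//; last 2 first.
- exact: emeasurable_funD.
- by move=> z _; rewrite adde_ge0.
rewrite ge0_integralD// integral_cst// mul1e ge0_integralZl//; last 2 first.
- by move=> z _; exact: poweR_ge0.
- by rewrite lee_fin ltW.
apply: (@le_trans _ _ (c%:E * ((m y r)%:E + (a `^ (- p))%:E * (a `^ p * m y r)%:E))%E).
  apply: lee_wpmul2l => //; rewrite ball_massE//; apply: leeD => //.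
  by apply: lee_wpmul2l => //; rewrite lee_fin ltW.
rewrite -(EFinM (a `^ (- p))) -(EFinD (m y r)) -EFinM lee_fin le_eqVlt; apply/orP; left; apply/eqP.
by rewrite powRN; field; rewrite gt_eqF// powR_gt0.
Qed.

Variables (beta q p : R) (E : set X).
Hypotheses (beta0 : 0 < beta) (q0 : 0 < q) (cE : closed E) (p1 : 1 < p) (qp : q < beta * p).
Hypothesis dens : content_density mu q E.

Lemma content_maximal_boundary_poincare : maximal_boundary_poincare mu beta p E.
Proof.
have p0 : 0 < p by exact: lt_trans ltr01 p1.
have [ps /andP[ps0 psp] hps] := sobolev_poincare mopen mupos mudbl geo p0 beta0.
have [q' [q'p q'P]] : exists q' : R, q' < p /\ forall t, (q' < t) = (q < beta * t).
  by exists (q / beta); split => [|t]; rewrite ltr_pdivrMr// mulrC.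
have [p' [psp' p'p qp']] : exists p' : R, [/\ ps <= p', p' < p & q < beta * p'].
  exists (Num.max ps ((q' + p) / 2)); split.
  - by rewrite le_max lexx.
  - by rewrite gt_max psp/=; lra.
  - by rewrite -q'P lt_max; apply/orP; right; lra.
have p'0 : 0 < p' by exact: lt_le_trans psp'.
have [C C0 hC] := truncation_good_point mopen mupos mudbl beta0 dens p'0 qp'.
have [C1 C10 hC1] := ball_mass_compare mopen mupos mudbl 256.
have [C2 [C20 C2p]] : exists C2 : R, 0 < C2 /\ C2 `^ p' = C1.
  exact: exists_powR_root.
have [K1 [K10 K1p]] : exists K1 : R, 0 < K1 /\ K1 `^ p' = 2.
  exact: exists_powR_root.
have CC2 : 0 < C * C2 by rewrite mulr_gt0.
have [Cs Cs0 hCs] := hps p' ltac:(by rewrite psp') (K1 + C * C2).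
have tau1 : 1 < p / p' by rewrite ltr_pdivlMr// mul1r.
have [C4 C40 hC4] := maximal_strong_type mopen mupos mudbl tau1.
have pb0 : 0 < 2 `^ (beta * p) :> R by rewrite powR_gt0.
have two0 : 0 < 2 `^ p :> R by rewrite powR_gt0.
have [T1 [T10 T1p]] : exists T1 : R, 0 < T1 /\
    T1 `^ p = 2 * (2 `^ p * (1 + 2 * 2 `^ p) * Cs) * 2 `^ (beta * p).
  have t0 : 0 < 2 * (2 `^ p * (1 + 2 * 2 `^ p) * Cs) * 2 `^ (beta * p).
    by rewrite !mulr_gt0// addr_gt0// mulr_gt0.
  exact: exists_powR_root.
have [T2 [T20 T2p]] : exists T2 : R, 0 < T2 /\
    T2 `^ p = 2 * (2 `^ p * (Cs + (C * C2) `^ p)) * 2 `^ (beta * p).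
  have t0 : 0 < 2 * (2 `^ p * (Cs + (C * C2) `^ p)) * 2 `^ (beta * p).
    by rewrite !mulr_gt0// addr_gt0// powR_gt0.
  exact: exists_powR_root.
have A0 : 0 < (T1 + T2) `^ p by rewrite powR_gt0// addr_gt0.
exists (C4 * (T1 + T2) `^ p); move=> w r Ew r0 rE B0 EQ Bs0 u g hu u0 hg.
have /hajlasz_gradientP[N H] := hg; have [mg g0 N0 _] := H.
have gpp x : ((g x `^ p') `^ (p / p') = g x `^ p)%E.
  by rewrite -poweRrM mulrCA divff ?mulr1// gt_eqF.
set Phi := fun x => ((sharp_maximal mu beta p Bs0 u x + boundary_maximal mu beta p Bs0 EQ u x) `^ p)%E.
have := @hC4 w r (4 * r) ((T1 + T2) `^ p) (fun x => g x `^ p')%E Phi (cst 0)%E N.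
under [X in (_ <= (C4 * _)%:E * X + _)%E]eq_integral do rewrite gpp.
rewrite integral0 adde0; apply => //.
- by rewrite mulr_gt0.
- exact: hajlasz_measurable_pow H _.
- by move=> x; exact: poweR_ge0.
- by move=> x; exact: poweR_ge0.
move=> l x l0 Wx Nx nlev; rewrite adde0.
have [a [a0 ap]] : exists a : R, 0 < a /\ a `^ p' = l.
  exact: exists_powR_root.
have -> : (T1 + T2) `^ p * l `^ (p / p') = ((T1 + T2) * a) `^ p.
  by rewrite powRM ?addr_ge0 ?(ltW T10) ?(ltW T20) ?(ltW a0)// -ap -powRrM mulrCA divff ?mulr1// gt_eqF.
have balls b : Bs0 b -> ball b.1 b.2 x -> exists D r', [/\ diam (ball b.1 b.2) = D%:E, 0 < D,
    0 < r' <= 2 * D /\ r' <= 4 * r, ball b.1 b.2 = ball b.1 r' &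
    (\int[mu]_(z in ball b.1 r') (g z `^ p') <= (a `^ p' * m b.1 r')%:E)%E].
  move=> [b0 bsub] bx; have [D [r' [DE D0 /andP[r'0 r'D] Dr' BE]]] := ball_diam hX geo b.1 b0.
  have D2 : D <= 2 * r.
    rewrite -lee_fin -DE; apply: diam_le; first by rewrite mulr_ge0// ltW.
    by move=> y z /bsub + /bsub; exact: ball_dist_le.
  have r'r : r' <= 4 * r.
    by apply: (le_trans r'D); rewrite mul4E ler_pM2l.
  exists D, r'; split => //; first by rewrite r'0.
  rewrite leNgt; apply/negP => lt; apply: nlev; exists b.1, r'; rewrite -BE; split => //.
    by rewrite r'0.
  by rewrite (setIidl bsub) BE -ap.
rewrite /Phi -[X in (_ <= X)%E]poweR_EFin.
have sharp_le : (sharp_maximal mu beta p Bs0 u x <= (T1 * a)%:E)%E.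
  apply: ge_ereal_sup => _ [->|[b [/= Bb bx] <-]].
    by rewrite lee_fin mulr_ge0 ?(ltW T10) ?(ltW a0).
  have [D [r' [DE D0 [/andP[r'0 r'D] r'r] BE hI]]] := balls b Bb bx.
  rewrite DE BE; have mb0 := ball_mass_gt0 mupos b.1 r'0.
  have rb0 : 0 < r' `^ (beta * p) by rewrite powR_gt0.
  have app0 : 0 < a `^ p by rewrite powR_gt0.
  have [y0 [By0 Ny0 gy0]] : exists y, [/\ ball b.1 r' y, ~ N y & (g y <= (K1 * a)%:E)%E].
    apply: (hajlasz_good_point H (p := p')) => //.
    - exact: measurable_ball.
    - by rewrite mulr_ge0// ltW.
    apply: (le_lt_trans hI); rewrite ball_massE// -EFinM lte_fin powRM ?(ltW K10) ?(ltW a0)// K1p.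
    by rewrite ltr_pM2r// ltr_pMl ?powR_gt0// ltr1n.
  have gy0' : (g y0 <= ((K1 + C * C2) * a)%:E)%E.
    by apply: (le_trans gy0); rewrite lee_fin ler_pM2r// lerDl ltW.
  have [c1 [c10 c1E]] : exists c1 : R, 0 < c1 /\ c1 = Cs * r' `^ (beta * p) * a `^ p.
    by eexists; split; last reflexivity; rewrite !mulr_gt0.
  have pt z : ball b.1 r' z -> ~ N z ->
      ((`|u z - u y0| `^ p)%:E <= c1%:E * (1 + (a `^ (- p'))%:E * g z `^ p'))%E.
    by move=> Bz Nz; rewrite c1E; apply: (hCs b.1 r' a u g N).
  have hM : (\int[mu]_(z in ball b.1 r') (`|u z - u y0| `^ p)%:E <= (2 * c1 * m b.1 r')%:E)%E.
    apply: (integral_le_of_affine H p'0 r'0 a0 (ltW c10) hI _ pt).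
    by move=> z; rewrite lee_fin powR_ge0.
  have hmean := mean_deviation_le mopen mupos beta0 r'0 (ltW p1) (mulr_gt0 (ltr0Sn _ 1) c10) hu hM.
  set uB := fine _ in hmean *.
  have c20 : 0 < 2 `^ p * (2 * c1) by rewrite !mulr_gt0.
  have cc0 : 0 <= 2 `^ p * (c1 + 2 `^ p * (2 * c1)) by rewrite mulr_ge0 ?addr_ge0 ?(ltW two0) ?(ltW c10) ?(ltW c20).
  apply: normalized_average_le => //; [exact: ltW| |].
    rewrite averageE// mule_ge0//; first by rewrite lee_fin invr_ge0 ltW.
    by apply: integral_ge0 => z _; rewrite lee_fin powR_ge0.
  apply: (@le_trans _ _ (2 * (2 `^ p * (c1 + 2 `^ p * (2 * c1))))%:E).
    apply: average_le => //; apply: (integral_le_of_affine H p'0 r'0 a0 cc0 hI).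
      by move=> z; rewrite lee_fin powR_ge0.
    move=> z Bz Nz; apply: (affine_add_le two0 c10 c20 _ _ (pt z Bz Nz) hmean).
      by rewrite mule_ge0 ?lee_fin ?powR_ge0// poweR_ge0.
    apply: le_trans (powR_add_le _ _ (ltW p0)) => //.
    apply: ge0_ler_powR; rewrite ?nnegrE ?(ltW p0) ?addr_ge0//.
    by rewrite [X in _ <= _ + X]distrC (le_trans _ (ler_distD (u y0) _ _)).
  rewrite lee_fin T1p c1E; set e1 := r' `^ _; set e2 := a `^ p.
  have hD : e1 <= 2 `^ (beta * p) * D `^ (beta * p).
    rewrite -powRM ?(ltW D0)//; apply: ge0_ler_powR; rewrite ?nnegrE ?mulr_ge0 ?(ltW beta0) ?(ltW p0) ?(ltW r'0) ?(ltW D0)//.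
  rewrite (_ : 2 * _ = 2 * (2 `^ p * (1 + 2 * 2 `^ p) * Cs) * e2 * e1); last by ring.
  rewrite [leRHS](_ : _ = 2 * (2 `^ p * (1 + 2 * 2 `^ p) * Cs) * e2 * (2 `^ (beta * p) * D `^ (beta * p))); last by ring.
  by rewrite ler_wpM2l// !mulr_ge0 ?powR_ge0 ?addr_ge0 ?mulr_ge0 ?powR_ge0 ?(ltW Cs0).
have bdry_le : (boundary_maximal mu beta p Bs0 EQ u x <= (T2 * a)%:E)%E.
  apply: ge_ereal_sup => _ [->|[b [/= Bb bx] <-]].
    by rewrite lee_fin mulr_ge0 ?(ltW T20) ?(ltW a0).
  have [D [r' [DE D0 [/andP[r'0 r'D] r'r] BE hI]]] := balls b Bb bx.
  rewrite DE BE indicE; have mb0 := ball_mass_gt0 mupos b.1 r'0.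
  have A0' : (0 <= average mu (ball b.1 r') (fun y => (`|u y| `^ p)%:E))%E.
    rewrite averageE// mule_ge0//; first by rewrite lee_fin invr_ge0 ltW.
    by apply: integral_ge0 => z _; rewrite lee_fin powR_ge0.
  apply: normalized_average_le => //; [exact: ltW|by rewrite mule_ge0// lee_fin|].
  have rb0 : 0 < r' `^ (beta * p) by rewrite powR_gt0.
  have app0 : 0 < a `^ p by rewrite powR_gt0.
  have [bEQ|_] := boolP (b.1 \in EQ); last first.
    by rewrite mul0e lee_fin !mulr_ge0 ?powR_ge0.
  rewrite mul1e; move/set_mem in bEQ.
  have [t [tr /andP[t20 t2r] tr' rt]] := exists_scale r'0 r'r.
  have t0 : 0 < t by case/andP: tr.
  have hI2 : (\int[mu]_(z in ball b.1 (2 * t)) (g z `^ p') <=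
      ((C2 * a) `^ p' * m b.1 (2 * t))%:E)%E.
    apply: (@le_trans _ _ (\int[mu]_(z in ball b.1 r') (g z `^ p'))%E).
      apply: ge0_subset_integral_pointwise; last by move=> z _; exact: poweR_ge0.
      by apply: ball_sub; rewrite mdistxx add0r.
    apply: (le_trans hI); rewrite lee_fin powRM ?(ltW C20) ?(ltW a0)// C2p mulrAC [leRHS]mulrC.
    rewrite ler_wpM2l ?powR_ge0//; apply: hC1 => //.
    by rewrite mdistxx add0r.
  have [x1 [Bx1 Nx1 gx1 ux1]] := hC w b.1 r t (C2 * a) u g N Ew r0 rE bEQ tr (mulr_gt0 C20 a0) hu u0 H hI2.
  have gx1' : (g x1 <= ((K1 + C * C2) * a)%:E)%E.
    by apply: (le_trans gx1); rewrite lee_fin mulrA ler_pM2r// lerDr ltW.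
  have Bx1' : ball b.1 r' x1.
    by move: Bx1; apply: ball_sub; rewrite mdistxx add0r.
  have [c1 [c10 c1E]] : exists c1 : R, 0 < c1 /\ c1 = Cs * r' `^ (beta * p) * a `^ p.
    by eexists; split; last reflexivity; rewrite !mulr_gt0.
  have [c2 [c20 c2E]] : exists c2 : R, 0 < c2 /\ c2 = (C * C2) `^ p * r' `^ (beta * p) * a `^ p.
    by eexists; split; last reflexivity; rewrite !mulr_gt0// powR_gt0.
  have ux1p : `|u x1| `^ p <= c2.
    apply: (@le_trans _ _ ((C * C2 * r' `^ beta * a) `^ p)).
      apply: ge0_ler_powR; rewrite ?nnegrE ?(ltW p0) ?mulr_ge0 ?powR_ge0 ?(ltW C0) ?(ltW C20) ?(ltW a0)//.
      apply: (le_trans ux1); rewrite (_ : C * _ * _ = C * C2 * t `^ beta * a); last by ring.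
      rewrite ler_wpM2r ?(ltW a0)// ler_wpM2l ?(ltW CC2)//.
      by apply: ge0_ler_powR; rewrite ?nnegrE ?(ltW beta0) ?(ltW t0) ?(ltW r'0).
    by rewrite c2E !powRM ?mulr_ge0 ?powR_ge0 ?(ltW C0) ?(ltW C20) ?(ltW a0)// -powRrM.
  have cc0 : 0 <= 2 `^ p * (c1 + c2) by rewrite mulr_ge0 ?addr_ge0 ?(ltW two0) ?(ltW c10) ?(ltW c20).
  apply: (@le_trans _ _ (2 * (2 `^ p * (c1 + c2)))%:E).
    apply: average_le => //; apply: (integral_le_of_affine H p'0 r'0 a0 cc0 hI).
      by move=> z; rewrite lee_fin powR_ge0.
    move=> z Bz Nz; apply: (@affine_add_le _ (`|u z - u x1| `^ p) (`|u x1| `^ p)) => //.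
    - by rewrite mule_ge0 ?lee_fin ?powR_ge0// poweR_ge0.
    - apply: le_trans (powR_add_le _ _ (ltW p0)) => //.
      apply: ge0_ler_powR; rewrite ?nnegrE ?(ltW p0) ?addr_ge0//.
      by rewrite -[X in `|X| <= _](subrK (u x1)) ler_normD.
    - by rewrite c1E; apply: (hCs b.1 r' a u g N).
  rewrite lee_fin T2p c1E c2E; set e1 := r' `^ _; set e2 := a `^ p; set e3 := (C * C2) `^ p.
  have hD : e1 <= 2 `^ (beta * p) * D `^ (beta * p).
    rewrite -powRM ?(ltW D0)//; apply: ge0_ler_powR; rewrite ?nnegrE ?mulr_ge0 ?(ltW beta0) ?(ltW p0) ?(ltW r'0) ?(ltW D0)//.
  rewrite (_ : 2 * _ = 2 * (2 `^ p * (Cs + e3)) * e2 * e1); last by ring.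
  rewrite [leRHS](_ : _ = 2 * (2 `^ p * (Cs + e3)) * e2 * (2 `^ (beta * p) * D `^ (beta * p))); last by ring.
  by rewrite ler_wpM2l// !mulr_ge0 ?powR_ge0 ?addr_ge0 ?powR_ge0 ?(ltW Cs0).
have s0 : (0 <= sharp_maximal mu beta p Bs0 u x)%E by apply: ereal_sup_ubound; left.
have b0 : (0 <= boundary_maximal mu beta p Bs0 EQ u x)%E by apply: ereal_sup_ubound; left.
apply: gt0_ler_poweR; first exact: ltW.
- by rewrite in_itv/= adde_ge0// leey.
- by rewrite in_itv/= leey lee_fin mulr_ge0 ?addr_ge0 ?(ltW T10) ?(ltW T20) ?(ltW a0).
- by rewrite mulrDl EFinD; apply: leeD.
Qed.

End content_maximal.

(** * Test functions and thick scales *)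

Section logarithmic_test_function.
Context (R : realType) (d : measure_display) (X : metricMeasurableType R d).
Variable mu : {measure set X -> \bar R}.
Hypothesis mopen : forall A : set X, open A -> measurable A.
Hypothesis mupos : balls_pos_finite mu.
Hypothesis mudbl : doubling mu.
Local Notation dist := (@mdist R X).
Local Notation m := (ball_mass mu).

Variables (beta : R).
Hypothesis beta01 : 0 < beta <= 1.

Let beta0 : 0 < beta. Proof. by case/andP: beta01. Qed.

Lemma min1_le_powR (t : R) : 0 <= t -> Num.min 1 t <= t `^ beta.
Proof.
move=> t0; have /andP[_ b1] := beta01; have [t1|t1] := leP 1 t.
  have : 1 `^ beta <= t `^ beta by apply: ge0_ler_powR; rewrite ?nnegrE ?(ltW beta0).
  by rewrite powR1.
move: t0; rewrite le_eqVlt => /predU1P[<-|t0]; first by rewrite powR_ge0.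
by apply: ger1_powR => //; rewrite t0 ltW.
Qed.

Lemma min1_dist (a b : R) : 0 <= a -> 0 <= b ->
  `|Num.min 1 a - Num.min 1 b| <= Num.min 1 `|a - b|.
Proof.
move=> a0 b0; wlog ab : a b a0 b0 / a <= b.
  move=> h; have [ab|/ltW ba] := leP a b; first exact: h.
  by rewrite distrC (distrC a b); exact: h.
rewrite distrC (distrC a b) ger0_norm; last first.
  by rewrite subr_ge0 le_min !ge_min lexx ab orbT.
rewrite ger0_norm ?subr_ge0// le_min; apply/andP; split.
  by rewrite lerBlDr ler_wpDr ?le_min ?ler01// ge_min lexx.
have [b1|b1] := leP b 1; have [a1|a1] := leP a 1; lra.
Qed.

(* A single cutoff at scale [s] has energy [s^(-beta p) mu(F_s)]; averaging [N] of them
   gains the factor [N^(1 - p)]. *)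
Definition log_test (F : set X) (sg : R) (N : nat) (x : X) : R :=
  N%:R^-1 * \sum_(i < N) Num.min 1 (dist_set F x / (sg * 2^-1 ^+ i)).

Definition log_gradient (F : set X) (sg : R) (N : nat) (x : X) : R :=
  N%:R^-1 * \sum_(i < N | dist_set F x < sg * 2^-1 ^+ i) (sg * 2^-1 ^+ i) `^ (- beta).

Variables (F : set X) (sg : R) (N : nat).
Hypotheses (F0 : F !=set0) (sg0 : 0 < sg) (N0 : (0 < N)%N).

Let s i : R := sg * 2^-1 ^+ i.

Let s_gt0 i : 0 < s i.
Proof. by rewrite mulr_gt0// exprn_gt0// invr_gt0. Qed.

Let invN0 : 0 < N%:R^-1 :> R.
Proof. by rewrite invr_gt0 ltr0n. Qed.

Lemma log_gradient_ge0 x : 0 <= log_gradient F sg N x.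
Proof. by rewrite mulr_ge0 ?(ltW invN0)// sumr_ge0// => i _; exact: powR_ge0. Qed.

Lemma min1_scaled_dist_le i x y : `|Num.min 1 (dist_set F x / s i) - Num.min 1 (dist_set F y / s i)|
  <= dist x y `^ beta * s i `^ (- beta).
Proof.
have d0 z : 0 <= dist_set F z / s i by rewrite divr_ge0 ?dist_set_ge0// ltW.
apply: (le_trans (min1_dist (d0 x) (d0 y))).
apply: (@le_trans _ _ (Num.min 1 (dist x y / s i))).
  rewrite le_min !ge_min lexx/=; apply/orP; right.
  by rewrite -mulrBl normrM normfV (gtr0_norm (s_gt0 i)) ler_pM2r ?invr_gt0// dist_set_lipschitz.
apply: (le_trans (min1_le_powR _)); first by rewrite divr_ge0 ?mdist_ge0// ltW.
by rewrite powRM ?invr_ge0 ?mdist_ge0 ?(ltW (s_gt0 i))// powRV ?powRN// ltW.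
Qed.

Lemma log_test_hajlasz x y : `|log_test F sg N x - log_test F sg N y| <=
  dist x y `^ beta * (log_gradient F sg N x + log_gradient F sg N y).
Proof.
rewrite /log_test /log_gradient -mulrBr -mulrDr normrM (gtr0_norm invN0) mulrCA ler_pM2l//.
rewrite -sumrB (le_trans (ler_norm_sum _ _ _))// [X in _ * (X + _)]big_mkcond.
rewrite [X in _ * (_ + X)]big_mkcond/= -big_split mulr_sumr; apply: ler_sum => i _.
have [xi|xi] := ltP (dist_set F x) (sg * 2^-1 ^+ i).
  apply: (le_trans (min1_scaled_dist_le i x y)); rewrite ler_wpM2l ?powR_ge0// lerDl.
  by case: ifP => // _; exact: powR_ge0.
have [yi|yi] := ltP (dist_set F y) (sg * 2^-1 ^+ i).
  by rewrite /= add0r; exact: min1_scaled_dist_le.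
rewrite /= !min_l ?subrr ?normr0 ?addr0 ?mulr0// ler_pdivlMr ?mul1r//; exact: s_gt0.
Qed.

Lemma log_test_holder : holder beta (log_test F sg N).
Proof.
exists (N%:R^-1 * \sum_(i < N) s i `^ (- beta)).
  by rewrite mulr_ge0 ?(ltW invN0)// sumr_ge0// => i _; exact: powR_ge0.
move=> x y; rewrite /log_test -mulrBr normrM (gtr0_norm invN0) -mulrA ler_pM2l//.
rewrite -sumrB (le_trans (ler_norm_sum _ _ _))// mulr_suml; apply: ler_sum => i _.
by rewrite [leRHS]mulrC; exact: min1_scaled_dist_le.
Qed.

Lemma log_test0 x : F x -> log_test F sg N x = 0.
Proof.
move=> Fx; rewrite /log_test big1 ?mulr0// => i _.
by rewrite dist_set0// mul0r min_r.
Qed.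

Lemma log_test1 x : sg <= dist_set F x -> log_test F sg N x = 1.
Proof.
move=> h; rewrite /log_test (eq_bigr (fun=> 1)).
  by rewrite sumr_const card_ord -mulr_natr mul1r mulVf// pnatr_eq0 -lt0n.
move=> i _; rewrite min_l// ler_pdivlMr; last exact: s_gt0.
rewrite mul1r (le_trans _ h)// ler_piMr ?(ltW sg0)// exprn_ile1//; lra.
Qed.

Lemma log_test_ge0 x : 0 <= log_test F sg N x.
Proof.
rewrite mulr_ge0 ?(ltW invN0)// sumr_ge0// => i _.
by rewrite le_min ler01/= divr_ge0 ?dist_set_ge0// ltW// s_gt0.
Qed.

Lemma log_test_le1 x : log_test F sg N x <= 1.
Proof.
rewrite /log_test mulrC ler_pdivrMr ?ltr0n// mul1r (@le_trans _ _ (\sum_(i < N) 1))//.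
  by apply: ler_sum => i _; rewrite ge_min lexx.
by rewrite sumr_const card_ord.
Qed.

Lemma log_gradient_first x : dist_set F x < sg -> N%:R^-1 * sg `^ (- beta) <= log_gradient F sg N x.
Proof.
move=> xs; rewrite ler_pM2l//; case: N N0 => // n _.
rewrite big_mkcond big_ord_recl/= expr0 mulr1 xs lerDl sumr_ge0// => i _.
by case: ifP => // _; exact: powR_ge0.
Qed.

Lemma log_gradient_measurable : measurable_fun setT (log_gradient F sg N).
Proof.
apply: measurable_funM => //.
rewrite (_ : (fun x => _) = (fun x => \sum_(i < N) (sg * 2^-1 ^+ i) `^ (- beta) * \1_(neighborhood F (sg * 2^-1 ^+ i)) x)).
  apply: measurable_sum => i; apply: measurable_funM => //.
  by apply: measurable_indic; apply: mopen; exact: neighborhood_open.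
apply/funext => x; rewrite big_mkcond; apply: eq_bigr => i _; rewrite indicE.
case: ifPn => h; first by rewrite mem_set ?mulr1//; apply/neighborhoodE.
by rewrite memNset ?mulr0// => /(neighborhoodE _ _ F0); exact/negP.
Qed.

Lemma log_gradient_pow_le (p : R) x : 0 < p -> log_gradient F sg N x `^ p <=
  (N%:R^-1 * (2 `^ beta / (2 `^ beta - 1))) `^ p *
  \sum_(i < N) s i `^ (- (beta * p)) * \1_(neighborhood F (s i)) x.
Proof.
move=> p0; set S := \sum_(i < N) _.
have term0 (i : 'I_N) : 0 <= s i `^ (- (beta * p)) * \1_(neighborhood F (s i)) x.
  by rewrite mulr_ge0 ?powR_ge0.
have S0 : 0 <= S by apply: sumr_ge0.
have th1 : 1 < 2 `^ beta :> R.
  have : 2 `^ 0 < 2 `^ beta :> R by apply: ltr_powR; rewrite ?ltr1n.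
  by rewrite powRr0.
have K0 : 0 <= 2 `^ beta / (2 `^ beta - 1) :> R by rewrite divr_ge0 ?powR_ge0// subr_ge0 ltW.
have key : \sum_(i < N | dist_set F x < s i) s i `^ (- beta) <=
    2 `^ beta / (2 `^ beta - 1) * S `^ p^-1.
  apply: (@geometric_sum_le _ (fun i => s i `^ (- beta)) (fun i => dist_set F x < s i)) => //.
  - by move=> k; exact: powR_ge0.
  - move=> k; rewrite /s exprSr mulrA powRM ?(ltW (s_gt0 k)) ?invr_ge0//.
    by rewrite mulrC [X in X * _ = _]powRN powRV// invrK.
  - exact: powR_ge0.
  - move=> k kN xk; apply: (@powR_le_cancel _ _ _ p) => //; rewrite ?powR_ge0//.
    rewrite powR_root_cancel ?gt_eqF// -powRrM mulNr.
    rewrite /S (bigD1 (Ordinal kN))//= indicE mem_set ?mulr1; last exact/neighborhoodE.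
    by rewrite lerDl sumr_ge0.
apply: (@le_trans _ _ ((N%:R^-1 * (2 `^ beta / (2 `^ beta - 1)) * S `^ p^-1) `^ p)).
  apply: ge0_ler_powR; rewrite ?nnegrE ?(ltW p0) ?log_gradient_ge0//.
    by rewrite mulr_ge0 ?powR_ge0// mulr_ge0// ltW.
  by rewrite -mulrA ler_pM2l.
rewrite [leLHS]powRM ?powR_ge0//; last by rewrite mulr_ge0// ltW.
by rewrite powR_root_cancel ?gt_eqF.
Qed.

End logarithmic_test_function.

Section thick_scales.
Context (R : realType) (d : measure_display) (X : metricMeasurableType R d).
Variable mu : {measure set X -> \bar R}.
Hypothesis mopen : forall A : set X, open A -> measurable A.
Hypothesis mupos : balls_pos_finite mu.
Hypothesis mudbl : doubling mu.
Hypothesis hX : exists x y : X, x <> y.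
Hypothesis geo : geodesic_space X.
Local Notation dist := (@mdist R X).
Local Notation m := (ball_mass mu).

Variables (p beta : R) (E : set X).
Hypotheses (p1 : 1 < p) (beta01 : 0 < beta <= 1) (cE : closed E).

Let beta0 : 0 < beta. Proof. by case/andP: beta01. Qed.
Let p0 : 0 < p. Proof. exact: lt_trans p1. Qed.

Definition thick_scales : Prop := forall A : R, 0 < A -> exists n0 : nat,
  forall w r, E w -> 0 < r -> (r%:E < diam E)%E -> exists i F,
    [/\ (2 <= i <= n0)%N, F `<=` E, F `<=` ball w (r / 2) &
    ((A * (2^-1 ^+ i) `^ (beta * p) * m w r)%:E <= mu (neighborhood F (r * 2^-1 ^+ i)))%E].

Lemma log_test_scale (C A : R) : 0 < C -> 0 < A -> exists2 N : nat, (0 < N)%N &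
  forall w r F i0 (W : set X), 0 < r -> F !=set0 -> measurable W ->
  ((m w r)%:E <= (C * r `^ (beta * p))%:E *
    \int[mu]_(x in W) (log_gradient beta F (r * 2^-1 ^+ i0) N x `^ p)%:E)%E ->
  exists i, (i0 <= i < i0 + N)%N /\
    ((A * (2^-1 ^+ i) `^ (beta * p) * m w r)%:E <= mu (neighborhood F (r * 2^-1 ^+ i)))%E.
Proof.
move=> C0 A0.
have [K [K0 KE]] : exists K : R, 0 < K /\ K = 2 `^ beta / (2 `^ beta - 1).
  exists (2 `^ beta / (2 `^ beta - 1)); split => //; rewrite divr_gt0 ?powR_gt0// subr_gt0.
  have : 2 `^ 0 < 2 `^ beta :> R by apply: ltr_powR; rewrite ?ltr1n.
  by rewrite powRr0.
have p10 : 0 < p - 1 by rewrite subr_gt0.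
have T0 : 0 < C * K `^ p * A by rewrite !mulr_gt0 ?powR_gt0.
have [t [t0 tE]] := exists_powR_root T0 p10.
pose N := (Num.truncn t).+1; have tN : t < N%:R by exact: truncnS_gt.
have N0 : 0 < N%:R :> R by rewrite ltr0n.
have TN : C * K `^ p * A < N%:R `^ (p - 1).
  by rewrite -tE; apply: gt0_ltr_powR; rewrite ?nnegrE ?(ltW t0) ?(ltW N0).
exists N => // w r F i0 W r0 F0 mW hW; apply: contrapT => hn.
have m0 := ball_mass_gt0 mupos w r0.
pose sg : R := r * 2^-1 ^+ i0.
have sg0 : 0 < sg by rewrite mulr_gt0 ?exprn_gt0 ?invr_gt0.
pose s j : R := sg * 2^-1 ^+ j.
have s0 j : 0 < s j by rewrite mulr_gt0 ?exprn_gt0 ?invr_gt0.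
have sE j : s j = r * 2^-1 ^+ (i0 + j) by rewrite /s /sg exprD mulrA.
have small j : (j < N)%N -> (mu (neighborhood F (s j)) <= (A * (2^-1 ^+ (i0 + j)) `^ (beta * p) * m w r)%:E)%E.
  move=> jN; rewrite leNgt; apply/negP => lt; apply: hn; exists (i0 + j)%N.
  by rewrite leq_addr ltn_add2l jN -sE ltW.
have mn j : measurable (neighborhood F (s j)) by apply: mopen; exact: neighborhood_open.
have c0 : 0 <= (N%:R^-1 * K) `^ p by exact: powR_ge0.
have : (\int[mu]_(x in W) (log_gradient beta F sg N x `^ p)%:E <=
   ((N%:R^-1 * K) `^ p * (N%:R * (r `^ (- (beta * p)) * A * m w r)))%:E)%E.
  apply: (@le_trans _ _ (\int[mu]_(x in W) (((N%:R^-1 * K) `^ p)%:E *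
      \sum_(j <- index_enum 'I_N) ((s j `^ (- (beta * p)))%:E * (\1_(neighborhood F (s j)) x)%:E)))%E).
    apply: ge0_le_integral_pointwise => x _; first by rewrite lee_fin powR_ge0.
    under eq_bigr do rewrite -EFinM.
    by rewrite sumEFin -EFinM lee_fin KE; apply: log_gradient_pow_le.
  have mterm (j : 'I_N) : measurable_fun W (fun x => (s j `^ (- (beta * p)))%:E * (\1_(neighborhood F (s j)) x)%:E)%E.
    by apply: measurable_funeM; apply/measurable_EFinP; exact: measurable_indic.
  have term0 (j : 'I_N) x : (0 <= (s j `^ (- (beta * p)))%:E * (\1_(neighborhood F (s j)) x)%:E)%E.
    by rewrite mule_ge0// lee_fin// powR_ge0.
  rewrite ge0_integralZl//; last 2 first.
  - exact: emeasurable_sum.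
  - by move=> x _; apply: sume_ge0.
  rewrite ge0_integral_sum// (EFinM ((N%:R^-1 * K) `^ p)); apply: lee_wpmul2l => //.
  apply: (@le_trans _ _ (\sum_(j < N) (r `^ (- (beta * p)) * A * m w r)%:E)%E).
    apply: lee_sum => j _; rewrite ge0_integralZl//; last 2 first.
    - by apply/measurable_EFinP; exact: measurable_indic.
    - by rewrite lee_fin powR_ge0.
    rewrite integral_indic//.
    apply: (@le_trans _ _ ((s j `^ (- (beta * p)))%:E * (A * (2^-1 ^+ (i0 + j)) `^ (beta * p) * m w r)%:E)%E).
      apply: lee_wpmul2l; first by rewrite lee_fin powR_ge0.
      apply: le_trans (small j (ltn_ord j)); apply: le_measure; last exact: subIsetl.
        by apply: mem_set; apply: measurableI.
      exact: mem_set.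
    rewrite -EFinM lee_fin sE powRM ?(ltW r0) ?exprn_ge0 ?invr_ge0//.
    rewrite [(2^-1 ^+ _) `^ (- _)]powRN le_eqVlt; apply/orP; left; apply/eqP.
    by field; rewrite gt_eqF// powR_gt0// exprn_gt0// invr_gt0.
  by rewrite sumEFin lee_fin sumr_const card_ord mulr_natl.
move=> hI; have := le_trans hW (lee_wpmul2l _ hI).
rewrite -EFinM !lee_fin => /(_ (mulr_ge0 (ltW C0) (powR_ge0 _ _))).
apply/negP; rewrite -ltNge.
rewrite [ltLHS](_ : _ = (C * K `^ p * A) * (N%:R^-1 `^ p * N%:R) * m w r); last first.
  rewrite powRM ?invr_ge0 ?(ltW N0) ?(ltW K0)// powRN.
  by field; rewrite gt_eqF// powR_gt0.
rewrite gtr_pMl// powRV ?(ltW N0)// -(mulr_powRB1 (ltW N0) p0).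
rewrite (_ : _^-1 * _ = (N%:R `^ (p - 1))^-1); last first.
  by field; rewrite !gt_eqF// powR_gt0.
by rewrite ltr_pdivrMr ?powR_gt0// mul1r.
Qed.

Lemma dist_set_ge (A : set X) x (r : R) : A !=set0 -> (forall a, A a -> r <= dist x a) ->
  r <= dist_set A x.
Proof.
move=> A0 h; rewrite leNgt; apply/negP => /(dist_set_lt A0)[a Aa].
by apply/negP; rewrite -leNgt; exact: h.
Qed.

(* What (4), (5) and (6) have in common. The bound [r / 256] separates the truncated set from
   a ball of comparable measure on which [u = 1]. *)
Definition vanishing_test_bound : Prop := exists2 C : R, 0 < C &
  forall w r, E w -> 0 < r -> (r%:E < diam E)%E ->
  let EQ := truncation E w (r / 128) in
  forall u g, holder beta u -> (forall x, EQ x -> u x = 0) ->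
    (forall x, r * 2^-1 ^+ 8 <= dist_set EQ x -> u x = 1) ->
    hajlasz_gradient mu beta u g ->
    ((m w r)%:E <= (C * r `^ (beta * p))%:E * \int[mu]_(x in ball w r) (g x `^ p))%E.

Lemma log_gradient_hajlasz F sg N : F !=set0 -> 0 < sg -> (0 < N)%N ->
  hajlasz_gradient mu beta (log_test F sg N) (EFin \o log_gradient beta F sg N).
Proof.
move=> F0 sg0 N0; split.
- by apply/measurable_EFinP; exact: log_gradient_measurable.
- by move=> x; rewrite lee_fin; exact: log_gradient_ge0.
exists set0; first exact: negligible_set0.
by move=> x y _ _; rewrite -EFinD -EFinM lee_fin; exact: log_test_hajlasz.
Qed.

Lemma vanishing_test_bound_thick : vanishing_test_bound -> thick_scales.
Proof.
move=> [C C0 hC] A A0; have [N N0 hN] := log_test_scale C0 A0.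
exists (8 + N)%N => w r Ew r0 rE.
have r1280 : 0 < r / 128 by rewrite divr_gt0.
set EQ := truncation E w (r / 128).
have EQ0 : EQ !=set0 by exists w; exact: truncation_center.
have sg0 : 0 < r * 2^-1 ^+ 8 by rewrite mulr_gt0 ?exprn_gt0 ?invr_gt0.
have u0 x : EQ x -> log_test EQ (r * 2^-1 ^+ 8) N x = 0 by move=> EQx; exact: log_test0.
have u1 x : r * 2^-1 ^+ 8 <= dist_set EQ x -> log_test EQ (r * 2^-1 ^+ 8) N x = 1.
  by move=> h; exact: log_test1.
have hT := hC w r Ew r0 rE _ _ (log_test_holder beta01 EQ0 sg0 N0) u0 u1
  (log_gradient_hajlasz EQ0 sg0 N0).
have [i [/andP[i8 iN] hi]] := hN w r EQ 8%N (ball w r) r0 EQ0 (measurable_ball mopen _ _) hT.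
exists i, EQ; split => //.
- by rewrite (leq_trans _ i8)// ltnW.
- exact: truncation_sub.
- move=> x /(truncation_dist r1280) wx; rewrite in_ballE (le_lt_trans wx)//.
  by rewrite ltr_pM2l// ltf_pV2 ?posrE// ltr_nat.
Qed.

Lemma truncation_far_ball w r : E w -> 0 < r -> (r%:E < diam E)%E -> exists y,
  dist w y = r / 64 /\ forall z, ball y (r / 256) z ->
    r * 2^-1 ^+ 8 <= dist_set (truncation E w (r / 128)) z /\ dist w z < 3 * (r / 128).
Proof.
move=> Ew r0 rE; have [e Ee we] := exists_far_point (ltW r0) rE Ew.
have r1280 : 0 < r / 128 by rewrite divr_gt0.
have [y [wy _]] : exists y, dist w y = r / 64 /\ dist y e = dist w e - r / 64.
  by apply: geodesic_between => //; apply/andP; split; lra.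
have e8 : r * 2^-1 ^+ 8 = r / 256 :> R by rewrite exprVn -natrX.
exists y; split => // z; rewrite in_ballE => yz; split.
  rewrite e8; apply: dist_set_ge; first by exists w; exact: truncation_center.
  move=> a /(truncation_dist r1280) wa.
  have := metric_triangle w a y; have := metric_triangle a z y.
  by rewrite (metric_sym a z) (metric_sym z y) wy; lra.
by have := metric_triangle w y z; rewrite wy; lra.
Qed.

Lemma far_ball_mass : exists2 C : R, 0 < C & forall w y r, 0 < r -> dist w y = r / 64 ->
  m w r <= C * m y (r / 256).
Proof.
have [C C0 hC] := ball_mass_compare mopen mupos mudbl 512; exists C => // w y r r0 wy.
by apply: hC => //; rewrite ?wy; lra.
Qed.

Lemma far_ball_integral (u : X -> R) (y : X) (s : R) (B : set X) : 0 < s -> ball y s `<=` B ->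
  (forall z, ball y s z -> u z = 1) ->
  ((m y s)%:E <= \int[mu]_(x in B) (`|u x| `^ p)%:E)%E.
Proof.
move=> s0 yB u1; have pp x : (0 <= (`|u x| `^ p)%:E)%E by rewrite lee_fin powR_ge0.
apply: (@le_trans _ _ (\int[mu]_(x in ball y s) (`|u x| `^ p)%:E)%E); last first.
  exact: ge0_subset_integral_pointwise.
have mB : measurable (ball y s) by exact: measurable_ball.
rewrite -(ball_massE mupos y s0) -[leLHS]mul1e -(integral_cst mu mB 1%E).
by apply: ge0_le_integral_pointwise => // x Bx; rewrite u1// normr1 powR1.
Qed.

Lemma local_boundary_poincare_test : local_boundary_poincare mu beta p E -> vanishing_test_bound.
Proof.
move=> [K hK]; have [C C0 hC] := far_ball_mass.
pose K1 := Num.max K 1; have K10 : 0 < K1 by rewrite lt_max ltr01 orbT.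
exists (C * K1); first by rewrite mulr_gt0.
move=> w r Ew r0 rE EQ u g hu u0 u1 hg.
have [y [wy hy]] := truncation_far_ball Ew r0 rE.
have r1280 : 0 < r / 128 by rewrite divr_gt0.
pose rB := 3 * (r / 128); have rB0 : 0 < rB by rewrite mulr_gt0.
have EQw : EQ w by exact: truncation_center.
have Bsub : ball w rB `<=` ball w (4 * (r / 128)) by apply: le_ball; rewrite ler_pM2r// ler_nat.
have := hK w r Ew r0 rE w rB rB0 EQw Bsub u g hu u0 hg.
have [D [r' [DE D0 _ _ _]]] := ball_diam hX geo w rB0.
rewrite DE poweR_EFin !averageE// [leRHS]muleCA lee_pmul2l ?fin_numE//; last first.
  by rewrite lte_fin invr_gt0 ball_mass_gt0.
move=> h.
have Dr : D <= r.
  by rewrite -lee_fin -DE (le_trans (diam_ball_le _ rB0))// lee_fin /rB; lra.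
have gp x : (0 <= g x `^ p)%E by exact: poweR_ge0.
have I0 A : (0 <= \int[mu]_(x in A) (g x `^ p))%E by apply: integral_ge0.
have s0 : 0 < r / 256 by rewrite divr_gt0.
have h1 : ((m y (r / 256))%:E <= \int[mu]_(x in ball w rB) (`|u x| `^ p)%:E)%E.
  apply: far_ball_integral => //.
    by move=> z /hy[_]; rewrite in_ballE.
  by move=> z /hy[+ _]; exact: u1.
apply: (@le_trans _ _ (C%:E * (m y (r / 256))%:E)%E).
  by rewrite -EFinM lee_fin; exact: hC.
rewrite -mulrA (EFinM C) -muleA; apply: lee_wpmul2l; first by rewrite lee_fin ltW.
apply: (le_trans h1); apply: (le_trans h).
apply: (@le_trans _ _ ((K1 * r `^ (beta * p))%:E * \int[mu]_(x in ball w rB) (g x `^ p))%E).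
  apply: lee_wpmul2r => //; rewrite -EFinM lee_fin.
  apply: (@le_trans _ _ (K1 * D `^ (beta * p))).
    by rewrite ler_wpM2r ?powR_ge0// le_max lexx.
  rewrite ler_pM2l//; apply: ge0_ler_powR; rewrite ?nnegrE ?(ltW D0) ?(ltW r0)//.
  by rewrite mulr_ge0// ltW.
apply: lee_wpmul2l; first by rewrite lee_fin mulr_ge0 ?powR_ge0// ltW.
apply: ge0_subset_integral_pointwise => //; apply: le_ball; rewrite /rB; lra.
Qed.

Lemma maximal_boundary_poincare_test : maximal_boundary_poincare mu beta p E -> vanishing_test_bound.
Proof.
move=> [K hK]; have [C C0 hC] := far_ball_mass.
pose K1 := Num.max K 1; have K10 : 0 < K1 by rewrite lt_max ltr01 orbT.
exists (C * K1); first by rewrite mulr_gt0.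
move=> w r Ew r0 rE EQ u g hu u0 u1 hg.
have [y [wy hy]] := truncation_far_ball Ew r0 rE.
have r1280 : 0 < r / 128 by rewrite divr_gt0.
have r20 : 0 < r / 2 by rewrite divr_gt0.
have EQw : EQ w by exact: truncation_center.
have := hK w r Ew r0 rE u g hu u0 hg.
set Bs0 := [set b : X * R | _].
have I0 A : (0 <= \int[mu]_(x in A) (g x `^ p))%E by apply: integral_ge0 => x _; exact: poweR_ge0.
have [D [r' [DE D0 _ _ _]]] := ball_diam hX geo w r20.
have Dr : D <= r.
  by rewrite -lee_fin -DE (le_trans (diam_ball_le _ r20))// lee_fin mulrC divfK.
have s0 : 0 < r / 256 by rewrite divr_gt0.
have Bsub : ball w (r / 2) `<=` ball w r by apply: le_ball; lra.
have m20 := ball_mass_gt0 mupos w r20.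
have rp0 : 0 < r `^ (beta * p) by rewrite powR_gt0.
pose v := (m w (r / 2))^-1 * m y (r / 256) / r `^ (beta * p).
have v0 : 0 <= v by rewrite /v !mulr_ge0 ?invr_ge0 ?powR_ge0 ?(ltW m20) ?(ltW (ball_mass_gt0 mupos _ s0)).
have h1 : ((m y (r / 256))%:E <= \int[mu]_(x in ball w (r / 2)) (`|u x| `^ p)%:E)%E.
  apply: far_ball_integral => //.
    by move=> z /hy[_ wz]; rewrite in_ballE; lra.
  by move=> z /hy[+ _]; exact: u1.
have mB : measurable (ball w (r / 2)) by exact: measurable_ball.
have pt x : ball w (r / 2) x ->
    (v%:E <= (sharp_maximal mu beta p Bs0 u x + boundary_maximal mu beta p Bs0 EQ u x) `^ p)%E.
  move=> Bx.
  have sm0 : (0 <= sharp_maximal mu beta p Bs0 u x)%E by apply: ereal_sup_ubound; left.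
  have : ((v `^ p^-1)%:E <= boundary_maximal mu beta p Bs0 EQ u x)%E.
    apply: (@le_trans _ _ ((((\1_EQ w)%:E * average mu (ball w (r / 2)) (fun y => (`|u y| `^ p)%:E)
        / diam (ball w (r / 2)) `^ (beta * p)) `^ p^-1)%E)); last first.
      by apply: ereal_sup_ubound; right; exists (w, r / 2).
    rewrite -poweR_EFin indicE mem_set// mul1e DE (poweR_EFin D) averageE//.
    have vle : (v%:E <= (m w (r / 2))^-1%:E * \int[mu]_(z in ball w (r / 2)) (`|u z| `^ p)%:E / (D `^ (beta * p))%:E)%E.
      have Dp0 : 0 < D `^ (beta * p) by rewrite powR_gt0.
      rewrite inver gt_eqF//.
      apply: (@le_trans _ _ ((m w (r / 2))^-1%:E * (m y (r / 256))%:E * ((D `^ (beta * p))^-1)%:E)%E).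
        rewrite -!EFinM lee_fin /v ler_wpM2l//.
          by rewrite mulr_ge0 ?invr_ge0 ?(ltW m20) ?(ltW (ball_mass_gt0 mupos _ s0)).
        rewrite lef_pV2 ?posrE//; apply: ge0_ler_powR; rewrite ?nnegrE ?(ltW D0) ?(ltW r0)//.
        by rewrite mulr_ge0// ltW.
      apply: lee_wpmul2r; first by rewrite lee_fin invr_ge0 ltW.
      by apply: lee_wpmul2l => //; rewrite lee_fin invr_ge0 ltW.
    apply: gt0_ler_poweR => //; first by rewrite invr_ge0 ltW.
      by rewrite in_itv/= leey lee_fin v0.
    by rewrite in_itv/= leey andbT (le_trans _ vle).
  move=> hb.
  have -> : v%:E = ((v `^ p^-1)%:E `^ p)%E by rewrite poweR_EFin powR_root_cancel// gt_eqF.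
  apply: gt0_ler_poweR; first exact: ltW.
  - by rewrite in_itv/= leey lee_fin powR_ge0.
  - by rewrite in_itv/= leey andbT adde_ge0// (le_trans _ hb)// lee_fin powR_ge0.
  - by rewrite (le_trans hb)// leeDr.
move=> h.
have h2 : ((v * m w (r / 2))%:E <= K%:E * \int[mu]_(x in ball w r) (g x `^ p))%E.
  apply: le_trans h.
  apply: (@le_trans _ _ (\int[mu]_(x in ball w (r / 2)) (sharp_maximal mu beta p Bs0 u x + boundary_maximal mu beta p Bs0 EQ u x) `^ p)%E); last first.
    by apply: ge0_subset_integral_pointwise => // x _; exact: poweR_ge0.
  rewrite EFinM -ball_massE// -(integral_cst mu mB v%:E).
  by apply: ge0_le_integral_pointwise => // x _; rewrite lee_fin.
apply: (@le_trans _ _ ((C * r `^ (beta * p))%:E * (v * m w (r / 2))%:E)%E).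
  rewrite -EFinM lee_fin (le_trans (hC w y r r0 wy))// -mulrA ler_pM2l// /v.
  by rewrite le_eqVlt; apply/orP; left; apply/eqP; field; rewrite !gt_eqF.
rewrite [(C * K1 * _)%R]mulrAC (EFinM _ K1) -muleA.
apply: lee_wpmul2l; first by rewrite lee_fin mulr_ge0 ?(ltW C0) ?powR_ge0.
by apply: (le_trans h2); apply: lee_wpmul2r => //; rewrite lee_fin le_max lexx.
Qed.

Lemma local_hardy_test : local_hardy mu beta p E -> vanishing_test_bound.
Proof.
move=> [K hK]; have [C C0 hC] := far_ball_mass.
pose K1 := Num.max K 1; have K10 : 0 < K1 by rewrite lt_max ltr01 orbT.
exists (C * K1); first by rewrite mulr_gt0.
move=> w r Ew r0 rE EQ u g hu u0 u1 hg.
have [y [wy hy]] := truncation_far_ball Ew r0 rE.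
have r1280 : 0 < r / 128 by rewrite divr_gt0.
have EQw : EQ w by exact: truncation_center.
have EQ0 : EQ !=set0 by exists w.
have := hK w r Ew r0 rE u g hu u0 hg.
have I0 A : (0 <= \int[mu]_(x in A) (g x `^ p))%E by apply: integral_ge0 => x _; exact: poweR_ge0.
have s0 : 0 < r / 256 by rewrite divr_gt0.
have e8 : 0 < r * 2^-1 ^+ 8 by rewrite mulr_gt0 ?exprn_gt0 ?invr_gt0.
have rp0 : 0 < r `^ (beta * p) by rewrite powR_gt0.
have mB : measurable (ball y (r / 256)) by exact: measurable_ball.
move=> h.
have h2 : (((r `^ (beta * p))^-1 * m y (r / 256))%:E <= K%:E * \int[mu]_(x in ball w r) (g x `^ p))%E.
  apply: le_trans h.
  apply: (@le_trans _ _ (\int[mu]_(x in ball y (r / 256)) ((`|u x| `^ p)%:E / edist_inf EQ x `^ (beta * p)))%E); last first.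
    apply: ge0_subset_integral_pointwise.
      move=> z /hy[dz wz]; split; first by rewrite in_ballE; lra.
      by move=> EQz; move: dz; rewrite dist_set0// leNgt e8.
    by move=> x _; rewrite mule_ge0// ?lee_fin ?powR_ge0// inve_ge0 poweR_ge0.
  rewrite EFinM -ball_massE// -(integral_cst mu mB (r `^ (beta * p))^-1%:E).
  apply: ge0_le_integral_pointwise => x; first by move=> _; rewrite lee_fin invr_ge0 ltW.
  move=> /hy[dx wx]; rewrite u1// normr1 powR1 mul1e edist_infE// poweR_EFin.
  have d0 : 0 < dist_set EQ x by exact: lt_le_trans dx.
  rewrite inver gt_eqF ?powR_gt0// lee_fin lef_pV2 ?posrE ?powR_gt0//.
  apply: ge0_ler_powR; rewrite ?nnegrE ?(ltW d0) ?(ltW r0)//; first by rewrite mulr_ge0// ltW.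
  by apply: (le_trans (dist_set_le _ EQw)); rewrite metric_sym; lra.
apply: (@le_trans _ _ ((C * r `^ (beta * p))%:E * ((r `^ (beta * p))^-1 * m y (r / 256))%:E)%E).
  rewrite -EFinM lee_fin (le_trans (hC w y r r0 wy))// -mulrA ler_pM2l//.
  by rewrite mulrA divff ?mul1r// gt_eqF.
rewrite [(C * K1 * _)%R]mulrAC (EFinM _ K1) -muleA.
apply: lee_wpmul2l; first by rewrite lee_fin mulr_ge0 ?(ltW C0) ?powR_ge0.
by apply: (le_trans h2); apply: lee_wpmul2r => //; rewrite lee_fin le_max lexx.
Qed.

End thick_scales.

Section capacity_test.
Context (R : realType) (d : measure_display) (X : metricMeasurableType R d).
Variable mu : {measure set X -> \bar R}.
Hypothesis mopen : forall A : set X, open A -> measurable A.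
Hypothesis mupos : balls_pos_finite mu.
Hypothesis mudbl : doubling mu.
Local Notation dist := (@mdist R X).
Local Notation m := (ball_mass mu).

Variables (p beta : R) (E : set X).
Hypotheses (p1 : 1 < p) (beta01 : 0 < beta <= 1).

Let beta0 : 0 < beta. Proof. by case/andP: beta01. Qed.
Let p0 : 0 < p. Proof. exact: lt_trans p1. Qed.

Definition cutoff (w : X) (rho : R) (x : X) : R :=
  1 - Num.min 1 (Num.max 0 (dist w x / rho - 1)).

Lemma cutoff01 w rho x : 0 <= cutoff w rho x <= 1.
Proof.
rewrite /cutoff subr_ge0 ge_min lexx/= lerBlDr lerDl le_min ler01/=.
by rewrite le_max lexx.
Qed.

Lemma cutoff1 w rho x : 0 < rho -> dist w x <= rho -> cutoff w rho x = 1.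
Proof.
move=> rho0 h; rewrite /cutoff max_l; first by rewrite min_r// subr0.
by rewrite subr_le0 ler_pdivrMr// mul1r.
Qed.

Lemma cutoff0 w rho x : 0 < rho -> 2 * rho <= dist w x -> cutoff w rho x = 0.
Proof.
move=> rho0 h; rewrite /cutoff min_l ?subrr// le_max; apply/orP; right.
by rewrite lerBrDr ler_pdivlMr.
Qed.

Lemma cutoff_holder w rho x y : 0 < rho ->
  `|cutoff w rho x - cutoff w rho y| <= dist x y `^ beta * rho `^ (- beta).
Proof.
move=> rho0; have max0 (t : R) : 0 <= Num.max 0 t by rewrite le_max lexx.
rewrite /cutoff opprB addrC addrA subrK distrC.
apply: (le_trans (min1_dist (max0 _) (max0 _))).
apply: (@le_trans _ _ (Num.min 1 (dist x y / rho))).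
  rewrite le_min !ge_min lexx/=; apply/orP; right.
  have h1 : `|dist w x / rho - dist w y / rho| <= dist x y / rho.
    rewrite -mulrBl normrM normfV (gtr0_norm rho0) ler_pM2r ?invr_gt0//.
    have := metric_triangle w x y; have := metric_triangle w y x; rewrite (metric_sym y x) ler_norml.
    by move=> *; apply/andP; split; lra.
  apply: le_trans h1; set a := dist w x / rho; set b := dist w y / rho.
  by have [a1|a1] := leP 0 (a - 1); have [b1|b1] := leP 0 (b - 1);
    rewrite !ler_norml; have := ler_norm (a - b); have := ler_norm (b - a);
    rewrite (distrC b a) => *; apply/andP; split; lra.
apply: (le_trans (min1_le_powR beta01 _)); first by rewrite divr_ge0 ?mdist_ge0// ltW.
by rewrite powRM ?invr_ge0 ?mdist_ge0 ?(ltW rho0)// powRV ?powRN// ltW.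
Qed.

Lemma capacity_density_thick : capacity_density mu beta p E -> thick_scales mu p beta E.
Proof.
move=> [c c0 hc] A A0.
have [C1 C10 hC1] := ball_mass_compare mopen mupos mudbl 8.
have C0 : 0 < C1 * (c^-1 * 2 `^ p) by rewrite !mulr_gt0 ?invr_gt0 ?powR_gt0.
have [N N0 hN] := log_test_scale mopen mupos p1 beta01 C0 A0.
have N0' : 0 < N%:R :> R by rewrite ltr0n.
have [t [t0 tN]] := exists_powR_root N0' beta0.
have [n hn] := expn2_ge (8 * t).
exists (n.+2 + N)%N => w r Ew r0 rE.
pose rho := r / 8; have rho0 : 0 < rho by rewrite divr_gt0.
have rhoE : (rho%:E < (8^-1)%:E * diam E)%E.
  move: rE; case: (diam E) => [D| |]//.
    by rewrite -EFinM !lte_fin /rho mulrC ltr_pM2l// invr_gt0.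
  by move=> _; rewrite gt0_muley ?lte_fin ?invr_gt0// ltry.
pose F := E `&` ball w (r / 2).
have Fw : F w by split => //; apply: ballxx; rewrite divr_gt0.
have F0 : F !=set0 by exists w.
pose sg := r * 2^-1 ^+ n.+2.
have sg0 : 0 < sg by rewrite mulr_gt0 ?exprn_gt0 ?invr_gt0.
have sgrho : rho `^ (- beta) <= N%:R^-1 * sg `^ (- beta).
  have h8 : t * sg <= rho.
    have e0 : 0 < (2 : R) ^+ n by rewrite exprn_gt0.
    have -> : t * sg = rho * (8 * t / 2 ^+ n * 4^-1).
      by rewrite /sg /rho exprVn 2!exprS; field; rewrite gt_eqF.
    rewrite ler_piMr ?(ltW rho0)// mulrC -[leRHS](@mulVf _ (4 : R)) ?pnatr_eq0// ler_wpM2l ?invr_ge0//.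
    by rewrite (@le_trans _ _ 1) ?ler1n// ler_pdivrMr// mul1r.
  rewrite !powRN -tN -invfM -powRM ?(ltW t0) ?(ltW sg0)// lef_pV2 ?posrE ?powR_gt0 ?(mulr_gt0 t0 sg0)//.
  apply: ge0_ler_powR; rewrite ?nnegrE//; [exact: ltW|by rewrite mulr_ge0// ltW|exact: ltW].
pose u := log_test F sg N; pose G := log_gradient beta F sg N.
pose ph := cutoff w rho; pose v x := 1 - u x.
have u01 x : 0 <= u x <= 1 by rewrite log_test_ge0// log_test_le1.
have v01 x : 0 <= v x <= 1 by have := u01 x; rewrite /v => /andP[? ?]; apply/andP; split; lra.
have G0 x : 0 <= G x by exact: log_gradient_ge0.
have key x : rho `^ (- beta) * v x <= G x.
  have [xs|xs] := ltP (dist_set F x) sg; last by rewrite /v /u log_test1// subrr mulr0.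
  apply: (@le_trans _ _ (rho `^ (- beta))); first by rewrite ler_piMr ?powR_ge0//; case/andP: (v01 x).
  by apply: (le_trans sgrho); exact: log_gradient_first.
have uG x y : `|v x - v y| <= dist x y `^ beta * (G x + G y).
  rewrite /v (_ : _ - _ = u y - u x); last by ring.
  by rewrite distrC; exact: log_test_hajlasz.
have prodle x y : `|ph x * v x - ph y * v y| <= ph x * `|v x - v y| + v y * `|ph x - ph y|.
  have /andP[ph0 _] := cutoff01 w rho x; have /andP[v0 _] := v01 y.
  rewrite (_ : _ - _ = ph x * (v x - v y) + v y * (ph x - ph y)); last by ring.
  by rewrite (le_trans (ler_normD _ _))// !normrM (ger0_norm ph0) (ger0_norm v0).
pose B : set X := ball w (2 * rho).
have phB x : ~ B x -> ph x = 0.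
  move=> nB; apply: cutoff0 => //; rewrite leNgt; apply/negP => h; apply: nB.
  by rewrite /B in_ballE.
pose H x := 2 * G x * \1_B x.
have HB x : B x -> H x = 2 * G x by move=> Bx; rewrite /H indicE mem_set// mulr1.
have H0 x : 0 <= H x by rewrite /H indicE; apply: mulr_ge0; [apply: mulr_ge0|case: (_ \in _)].
have inout x y : B x -> ~ B y -> `|ph x * v x - ph y * v y| <= dist x y `^ beta * (H x + H y).
  move=> Bx nBy; rewrite (phB y nBy) mul0r subr0 ger0_norm; last first.
    by rewrite mulr_ge0//; [case/andP: (cutoff01 w rho x)|case/andP: (v01 x)].
  have h1 : ph x <= dist x y `^ beta * rho `^ (- beta).
    have := cutoff_holder w x y rho0; rewrite -/ph -/(ph y) (phB y nBy) subr0 ger0_norm//.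
    by case/andP: (cutoff01 w rho x).
  have /andP[v0 _] := v01 x.
  apply: (le_trans (ler_wpM2r v0 h1)); rewrite -mulrA ler_wpM2l ?powR_ge0//.
  apply: (le_trans (key x)); rewrite (HB x Bx); have := G0 x; have := H0 y; lra.
have mG : measurable_fun setT G by exact: log_gradient_measurable.
have mB : measurable B by exact: measurable_ball.
have hH : hajlasz_gradient mu beta (fun x => ph x * v x) (EFin \o H).
  split.
  - apply/measurable_EFinP; apply: measurable_funM; last exact: measurable_indic.
    exact: measurable_funM.
  - by move=> x; rewrite lee_fin.
  exists set0; first exact: negligible_set0.
  move=> x y _ _; rewrite -EFinD -EFinM lee_fin.
  have [Bx|nBx] := pselect (B x); have [By|nBy] := pselect (B y).
  - apply: (le_trans (prodle x y)); rewrite (HB x Bx) (HB y By).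
    have /andP[ph0 ph1] := cutoff01 w rho x; have /andP[v0 _] := v01 y.
    apply: (@le_trans _ _ (dist x y `^ beta * (G x + G y) + dist x y `^ beta * G y)).
      apply: lerD; first by rewrite (le_trans _ (uG x y))// ler_piMl.
      apply: (le_trans (ler_wpM2l v0 (cutoff_holder w x y rho0))).
      by rewrite mulrCA ler_wpM2l ?powR_ge0// mulrC.
    rewrite -mulrDr ler_wpM2l ?powR_ge0//; have := G0 x; lra.
  - exact: inout.
  - rewrite distrC (metric_sym x) [H x + _]addrC; exact: inout.
  - by rewrite (phB x nBx) (phB y nBy) !mul0r subrr normr0 mulr_ge0 ?powR_ge0// addr_ge0.
have hh : holder beta (fun x => ph x * v x).
  have [k k0 hk] := log_test_holder beta01 F0 sg0 N0.
  exists (rho `^ (- beta) + k); first by rewrite addr_ge0 ?powR_ge0.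
  move=> x y; apply: (le_trans (prodle x y)); rewrite [leRHS]mulrDl [leRHS]addrC; apply: lerD; last first.
    have /andP[v0 v1] := v01 y.
    by rewrite mulrC (le_trans (ler_wpM2r v0 (cutoff_holder w x y rho0)))// [leRHS]mulrC ler_piMr ?mulr_ge0 ?powR_ge0.
  have /andP[ph0 ph1] := cutoff01 w rho x.
  rewrite (le_trans _ (hk x y))// (_ : v x - v y = u y - u x); last by rewrite /v; ring.
  by rewrite distrC ler_piMl.
have h1 x : (E `&` closure (ball w rho)) x -> 1 <= ph x * v x.
  move=> [Ex /closure_ball_le wx].
  have Fx : F x by split => //; rewrite in_ballE (le_lt_trans wx)// /rho; lra.
  by rewrite /ph cutoff1// mul1r /v /u log_test0// subr0.
have h0 x : ~ ball w (2 * rho) x -> ph x * v x = 0 by move=> /phB ->; rewrite mul0r.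
have hcap : (capacity mu beta p (E `&` closure (ball w rho)) (ball w (2 * rho)) <=
    (2 `^ p)%:E * \int[mu]_(x in B) (G x `^ p)%:E)%E.
  apply: ereal_inf_lbound; exists (fun x => ph x * v x), (EFin \o H); split => //.
  rewrite -ge0_integralZl//; last 2 first.
  - apply/measurable_EFinP; apply: (measurable_funS measurableT) => //.
    exact: (measurableT_comp (measurable_powR p) mG).
  - by move=> x _; rewrite lee_fin powR_ge0.
  rewrite [LHS]integral_mkcond; apply: eq_integral => x _.
  rewrite /patch /H/=; rewrite indicE; case: ifPn => _.
    by rewrite mulr1 powRM// EFinM.
  by rewrite mulr0 powR0// gt_eqF.
have hcd := le_trans (hc w rho Ew rho0 rhoE) hcap.
have mr0 := ball_mass_gt0 mupos w rho0.
have rhop : 0 < rho `^ (beta * p) by rewrite powR_gt0.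
have hW : ((m w r)%:E <= (C1 * (c^-1 * 2 `^ p) * r `^ (beta * p))%:E * \int[mu]_(x in B) (G x `^ p)%:E)%E.
  have I0 : (0 <= \int[mu]_(x in B) (G x `^ p)%:E)%E by apply: integral_ge0 => x _; rewrite lee_fin powR_ge0.
  apply: (@le_trans _ _ (C1%:E * (m w rho)%:E)%E).
    by rewrite -EFinM lee_fin; apply: hC1 => //; rewrite mdistxx add0r /rho mulrC divfK.
  rewrite -mulrA (EFinM C1) -muleA; apply: lee_wpmul2l; first by rewrite lee_fin ltW.
  apply: (@le_trans _ _ ((c^-1 * rho `^ (beta * p))%:E * ((2 `^ p)%:E * \int[mu]_(x in B) (G x `^ p)%:E))%E).
    apply: (@le_trans _ _ ((c^-1 * rho `^ (beta * p))%:E * ((c * rho `^ (- (beta * p)))%:E * mu (ball w rho)))%E).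
      rewrite ball_massE// -!EFinM lee_fin powRN le_eqVlt; apply/orP; left; apply/eqP.
      by field; rewrite !gt_eqF.
    by apply: lee_wpmul2l => //; rewrite lee_fin mulr_ge0 ?invr_ge0 ?(ltW c0) ?(ltW rhop).
  rewrite muleA -EFinM; apply: lee_wpmul2r => //; rewrite lee_fin mulrAC ler_wpM2l//.
    by rewrite mulr_ge0 ?invr_ge0 ?powR_ge0// ltW.
  apply: ge0_ler_powR; rewrite ?nnegrE ?(ltW rho0) ?(ltW r0)//; first by rewrite mulr_ge0// ltW.
  by rewrite /rho ler_pdivrMr// ler_peMr ?(ltW r0)// ler1n.
have [i [/andP[i0 iN] hi]] := hN w r F n.+2 B r0 F0 mB hW.
exists i, F; split => //.
- by rewrite (leq_trans _ i0)//= ltnW.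
- exact: subIsetl.
- exact: subIsetr.
Qed.

End capacity_test.

(** * Codimension and content *)

Section codimension.
Context (R : realType) (d : measure_display) (X : metricMeasurableType R d).
Variable mu : {measure set X -> \bar R}.
Hypothesis mopen : forall A : set X, open A -> measurable A.
Hypothesis mupos : balls_pos_finite mu.
Hypothesis mudbl : doubling mu.
Local Notation dist := (@mdist R X).
Local Notation m := (ball_mass mu).

Lemma neighborhood_packing (x0 : X) (F W : set X) (s t : R) : 0 < t ->
  measurable W -> (mu W < +oo)%E -> (forall z, F z -> ball z t `<=` W) ->
  exists (K : set nat) (e : nat -> X),
    [/\ forall k, K k -> F (e k), trivIset K (fun k => ball (e k) t : set X) &
      (mu (neighborhood F s) <= \esum_(k in K) mu (ball (e k) (2 * t + s)))%E].
Proof.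
move=> t0 mW Wfin FW; pose V := [set b : X * R | F b.1 /\ b.2 = t].
have [||K [e [KV tK cov]]] := @vitali_cover R d X mu mopen mupos x0 V t W mW Wfin.
- by move=> b [_ ->]; rewrite t0 lexx.
- by move=> b [Fb ->]; exact: FW.
exists K, (fun k => (e k).1); split.
- by move=> k /KV[].
- move=> i j Ki Kj; have := tK i j Ki Kj.
  by have [_ ->] := KV i Ki; have [_ ->] := KV j Kj.
apply: measure_le_esum => [|k _|x /neighborhoodP[a Fa xa]].
- exact/mopen/neighborhood_open.
- exact: measurable_ball.
have [k [Kk _ h]] := cov (a, t) (conj Fa erefl); exists k => //.
have [_ ekt] := KV k Kk; rewrite /= ekt in h.
by rewrite in_ballE; have := metric_triangle (e k).1 a x; rewrite (metric_sym _ a) (metric_sym a x); lra.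
Qed.

Variables (p beta : R) (E : set X).
Hypothesis bp0 : 0 < beta * p.

Lemma half_pow_gap (n i : nat) (Q e : R) : (i <= n)%N -> 0 <= e -> e <= n.+1%:R^-1 -> Q + e = beta * p ->
  (2^-1 ^+ i) `^ Q <= 2 * (2^-1 ^+ i) `^ (beta * p).
Proof.
move=> ni e0 en Qe; have h0 k : 0 < (2^-1 : R) ^+ k by rewrite exprn_gt0// invr_gt0.
rewrite -Qe powRD; last by rewrite (gt_eqF (h0 i)) implybT.
rewrite mulrCA ler_peMr ?powR_ge0// -[leLHS](mulfV (_ : 2 != 0))// ler_pM2l//.
have le1 : 0 < (2^-1 : R) <= 1 by apply/andP; split; lra.
apply: (@le_trans _ _ ((2^-1 ^+ n.+1) `^ e)).
  rewrite -powR_mulrn ?invr_ge0// -powRrM -[leLHS]powRr1 ?invr_ge0//; apply: ger_powR => //.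
  by rewrite mulrC -ler_pdivlMr ?ltr0n// mul1r.
apply: ge0_ler_powR; rewrite ?nnegrE ?(ltW (h0 _))//.
by case/andP: le1 => ? ?; rewrite ler_wiXn2l// ?ltW// leqW.
Qed.

(* The thick scale [s = 2^-i r'] of [thick_scales] replaces the ball of radius [r'] by
   disjoint balls of radius [s], at the cost of a factor [(s / r') ^ Q] only: iterating
   until the radius is comparable to [r] gives the lower bound. *)
Lemma thick_scales_neighborhood : thick_scales mu p beta E ->
  exists Q c : R, [/\ 0 <= Q, Q < beta * p, 0 < c & forall w r r', E w -> 0 < r < r' ->
    (r'%:E < diam E)%E ->
    ((c * (r / r') `^ Q * m w r')%:E <= mu (neighborhood E r `&` ball w r'))%E].
Proof.
move=> thick.
have [C C0 hC] := ball_mass_compare mopen mupos mudbl 3.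
have [n0 hn0] := thick (2 * C) (mulr_gt0 (ltr0Sn R 1) C0).
have [D D0 hD] := ball_mass_compare mopen mupos mudbl (2 ^+ n0).
have n01 : 0 < n0.+1%:R^-1 :> R by rewrite invr_gt0.
have [Q [Q0 [e [e0 en Qe]]]] : exists Q : R, 0 <= Q /\ exists e : R,
    [/\ 0 < e, e <= n0.+1%:R^-1 & Q + e = beta * p].
  have [h|h] := leP (n0.+1%:R^-1) (beta * p).
    by exists (beta * p - n0.+1%:R^-1); split; [rewrite subr_ge0|exists n0.+1%:R^-1; rewrite subrK].
  by exists 0; split => //; exists (beta * p); rewrite add0r (ltW h).
exists Q, D^-1; split => //; [by rewrite -Qe ltrDl|by rewrite invr_gt0|].
have mE r : measurable (neighborhood E r) by exact/mopen/neighborhood_open.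
have mB w r : measurable (ball w r : set X) by exact: measurable_ball.
have base w r r' : E w -> 0 < r < r' -> r' <= 2 ^+ n0 * r ->
    ((D^-1 * (r / r') `^ Q * m w r')%:E <= mu (neighborhood E r `&` ball w r'))%E.
  move=> Ew /andP[r0 rr'] le; have r'0 := lt_trans r0 rr'.
  apply: (@le_trans _ _ (mu (ball w r))); last first.
    apply: le_measure; [exact/mem_set/mB|exact/mem_set/measurableI|].
    move=> x wx; split; last exact: (le_ball (ltW rr')).
    by apply/neighborhoodP; exists w => //; rewrite metric_sym -in_ballE.
  rewrite ball_massE// lee_fin -mulrA ler_pdivrMl//; apply: (@le_trans _ _ (m w r')).
    rewrite ler_piMl ?(ltW (ball_mass_gt0 _ _ _))//.
    have rr1 : 0 < r / r' <= 1 by rewrite divr_gt0//= ler_pdivrMr// mul1r ltW.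
    by have := ger_powR rr1 Q0; rewrite powRr0.
  by apply: hD => //; rewrite mdistxx add0r.
move=> w r r' Ew rr' r'E; have [n hn] := expn2_ge (r' / r).
have r0 : 0 < r by case/andP: rr'.
rewrite ler_pdivrMr// in hn.
elim: n w r' Ew rr' r'E hn => [|n IH] w r' Ew /andP[_ rr'] r'E hn.
  by move: hn; rewrite expr0 mul1r leNgt rr'.
have r'0 := lt_trans r0 rr'.
have [le|gt] := leP r' (2 ^+ n0 * r); first by apply: base; rewrite ?r0.
have [i [F [/andP[i2 in0] FE FB hF]]] := hn0 w r' Ew r'0 r'E.
have [s [s0 sE]] : exists s : R, 0 < s /\ s = r' * 2^-1 ^+ i.
  by exists (r' * 2^-1 ^+ i); rewrite mulr_gt0// exprn_gt0// invr_gt0.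
rewrite -sE in hF.
have i0 : 0 < (2 : R) ^+ i by rewrite exprn_gt0.
have rs : r < s.
  rewrite sE exprVn ltr_pdivlMr// mulrC (le_lt_trans _ gt)// ler_pM2r//.
  by rewrite ler_weXn2l// ler1n.
have s2 : s <= r' / 2.
  rewrite sE exprVn ler_pM2l// lef_pV2 ?posrE//.
  by rewrite -[leLHS]expr1 ler_weXn2l ?ler1n// ltnW.
have sE' : (s%:E < diam E)%E.
  by apply: le_lt_trans r'E; rewrite lee_fin (le_trans s2)// ler_pdivrMr// ler_peMr ?ltW ?ltr1n.
have sn : s <= 2 ^+ n * r.
  by rewrite (le_trans s2)// ler_pdivrMr// mulrAC -exprSr.
have sub z : F z -> ball z s `<=` ball w r'.
  move=> /FB; rewrite in_ballE => zw; apply: ball_sub; move: zw s2; lra.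
have [|K [e' [KF tK cov]]] := @neighborhood_packing w F (ball w r') s s s0 (mB w r') _ sub.
  by rewrite ball_massE// ltry.
apply: (@le_trans _ _ (\esum_(k in K) mu (neighborhood E r `&` ball (e' k) s))); last first.
  apply: esum_measure_le => [|k _||k Kk].
  - exact: measurableI.
  - exact: measurableI.
  - move=> k l Kk Kl [x [[_ kx] [_ lx]]]; apply: tK => //; by exists x.
  by apply: setIS; apply: sub; exact: KF.
apply: (@le_trans _ _ (\esum_(k in K) ((D^-1 * (r / s) `^ Q)%:E * mu (ball (e' k) s)))%E); last first.
  apply: le_esum => k Kk; rewrite ball_massE// -EFinM; apply: IH => //.
    exact/FE/KF.
  by rewrite r0.
rewrite ge0_esumZl//; last by rewrite mulr_ge0 ?powR_ge0// invr_ge0 ltW.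
have Cs : (mu (neighborhood F s) <= C%:E * \esum_(k in K) mu (ball (e' k) s))%E.
  apply: (le_trans cov); rewrite -ge0_esumZl ?(ltW C0)//; apply: le_esum => k _.
  rewrite !ball_massE//; last by rewrite addr_gt0 ?mulr_gt0.
  rewrite -EFinM lee_fin; apply: hC => //; first by rewrite addr_gt0 ?mulr_gt0.
  by rewrite mdistxx; lra.
have low : (((2^-1 ^+ i) `^ Q * m w r')%:E <= \esum_(k in K) mu (ball (e' k) s))%E.
  have C0' : (0 < C%:E)%E by rewrite lte_fin.
  rewrite -(@lee_pmul2l _ C%:E)//; apply: le_trans Cs; apply: le_trans hF.
  rewrite -EFinM lee_fin mulrA ler_wpM2r ?(ltW (ball_mass_gt0 _ _ _))//.
  rewrite -[leRHS]mulrA [leRHS]mulrCA ler_pM2l//.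
  exact: (half_pow_gap in0 (ltW e0) en Qe).
apply: le_trans (_ : _ <= (D^-1 * (r / s) `^ Q)%:E * ((2^-1 ^+ i) `^ Q * m w r')%:E)%E _.
  rewrite -EFinM lee_fin mulrA -[_ * (2^-1 ^+ i) `^ Q]mulrA -powRM ?divr_ge0 ?(ltW r0) ?(ltW s0)//.
    by rewrite [r / s * _](_ : _ = r / r')//; rewrite sE; field; rewrite expf_neq0 ?invr_neq0 ?pnatr_eq0// gt_eqF.
by apply: lee_wpmul2l => //; rewrite lee_fin mulr_ge0 ?powR_ge0// invr_ge0 ltW.
Qed.

Lemma thick_scales_upper_codim : (forall x, E <> [set x]) ->
  thick_scales mu p beta E -> (upper_codim mu E < (beta * p)%:E)%E.
Proof.
move=> hE1 /thick_scales_neighborhood[Q [c [Q0 Qbp c0 h]]].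
apply: (@le_lt_trans _ _ Q%:E); last by rewrite lte_fin.
apply: ereal_inf_lbound; exists Q => //; split => //; exists c => // x r r' Ex rr' [dE|r'E].
  have [y Ey xy] : exists2 y, E y & x <> y.
    apply: contrapT => hn; apply: (hE1 x); apply/seteqP; split => [y Ey|y ->//].
    by apply: contrapT => xy; apply: hn; exists y => // e; apply: xy.
  have := diam_ge Ex Ey; rewrite dE lee_fin leNgt mdist_gt0.
  by move=> /negP; case; apply/eqP.
have r'0 : 0 < r' by case/andP: rr' => /lt_trans; apply.
have m0 := ball_mass_gt0 mupos x r'0.
rewrite ball_massE// inver gt_eqF// lee_pdivlMr//.
by rewrite -EFinM; exact: h.
Qed.

End codimension.

Section series.
Variable R : realType.
Implicit Types (a : nat -> \bar R) (I K : set nat).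

Lemma esum_le_subset I K a : I `<=` K -> (\esum_(k in I) a k <= \esum_(k in K) a k)%E.
Proof.
move=> IK; apply: ge_ereal_sup => _ [S [finS SI] <-]; apply: esum_ge; exists S => //.
by split => //; exact: subset_trans SI IK.
Qed.

Lemma esum_disjoint_le K I (J : nat -> set nat) a : (forall k, 0 <= a k)%E ->
  trivIset K J -> (forall j, K j -> J j `<=` I) ->
  (\esum_(j in K) \esum_(k in J j) a k <= \esum_(k in I) a k)%E.
Proof.
move=> a0 tJ JI; pose J' j := [set k | K j /\ J j k].
rewrite (_ : \esum_(j in K) _ = \esum_(j in K) \esum_(k in J' j) a k); last first.
  apply: eq_esum => j Kj; congr (\esum_(_ in _) _).
  by apply/seteqP; split => [k ?|k []].
rewrite -esum_bigcupT//; last first.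
  by move=> i j _ _ [k [[Ki Jik] [Kj Jjk]]]; apply: tJ => //; exists k.
by apply: esum_le_subset => k [j Kj [_ /(JI j Kj)]].
Qed.

Lemma expr_half_lt (r e dl : R) : 0 < r -> 0 < e -> 0 < dl <= 2^-1 -> exists n, r * dl ^+ n < e.
Proof.
move=> r0 e0 /andP[dl0 dl1]; have [n hn] := expn2_ge (r / e + 1); exists n.
have n0 : 0 < (2 : R) ^+ n by rewrite exprn_gt0.
apply: (@le_lt_trans _ _ (r / 2 ^+ n)).
  by rewrite ler_pM2l// -exprVn lerXn2r ?nnegrE ?(ltW dl0)// invr_ge0.
rewrite ltr_pdivrMr// mulrC -ltr_pdivrMr//; apply: lt_le_trans hn; by rewrite ltrDl.
Qed.

End series.

Section geometric_limit.
Context (R : realType) (d : measure_display) (X : completeMetricMeasurableType R d).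
Local Notation dist := (@mdist R X).

Lemma geometric_steps_limit (w : nat -> X) (r dl : R) : 0 < r -> 0 < dl <= 2^-1 ->
  (forall n, dist (w n) (w n.+1) < r * dl ^+ n) ->
  exists l, forall n, dist (w n) l <= 2 * (r * dl ^+ n).
Proof.
move=> r0 /[dup] dl12 /andP[dl0 dl1] step.
have far k n : dist (w n) (w (n + k)%N) <= 2 * (r * dl ^+ n).
  have s0 j : 0 < r * dl ^+ j by rewrite mulr_gt0 ?exprn_gt0.
  elim: k n => [|k IH] n; first by rewrite addn0 mdistxx mulr_ge0 ?(ltW (s0 _)).
  have := metric_triangle (w n) (w n.+1) (w (n + k.+1)%N).
  have := IH n.+1; rewrite addSnnS.
  have h : 2 * (r * dl ^+ n.+1) <= r * dl ^+ n.
    rewrite exprS !mulrA [2 * r]mulrC -[r * 2 * dl]mulrA -!mulrA ler_pM2l// mulrA.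
    by rewrite ler_piMl ?exprn_ge0 ?(ltW dl0)// mulrC -ler_pdivlMr// mul1r.
  have := step n; lra.
have cw : cauchy (w @ \oo).
  apply: cauchy_exP => e e0.
  have [n hn] := @expr_half_lt R (2 * r) e dl ltac:(by rewrite mulr_gt0) e0 dl12.
  exists (w n); exists n => // k /= nk; rewrite in_ballE.
  by apply: le_lt_trans hn; rewrite -mulrA -(subnKC nk); exact: far.
have cvw : cvg (w @ \oo) by exact: cauchy_cvg.
exists (lim (w @ \oo)) => n.
apply/ler_addgt0Pr => e e0.
have [N _ hN] : \forall k \near \oo, ball (lim (w @ \oo)) e (w k).
  by apply: cvw; apply: nbhsx_ballx.
have := hN (n + N)%N (leq_addl _ _); rewrite in_ballE metric_sym => h.
have := metric_triangle (w n) (w (n + N)%N) (lim (w @ \oo)); have := far N n; lra.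
Qed.

End geometric_limit.

Section content_lower_bound.
Context (R : realType) (d : measure_display) (X : completeMetricMeasurableType R d).
Variable mu : {measure set X -> \bar R}.
Hypothesis mopen : forall A : set X, open A -> measurable A.
Hypothesis mupos : balls_pos_finite mu.
Hypothesis mudbl : doubling mu.
Local Notation dist := (@mdist R X).
Local Notation m := (ball_mass mu).
Variables (E : set X) (Q q c : R).
Hypotheses (cE : closed E) (Q0 : 0 <= Q) (Qq : Q < q) (c0 : 0 < c).
Hypothesis lower : forall w r r', E w -> 0 < r < r' -> (r'%:E < diam E)%E ->
  ((c * (r / r') `^ Q * m w r')%:E <= mu (neighborhood E r `&` ball w r'))%E.

Let q0 : 0 < q. Proof. exact: le_lt_trans Qq. Qed.

Lemma codim_children : exists dl : R, 0 < dl <= 10^-1 /\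
  forall w r, E w -> 0 < r -> (r%:E < diam E)%E -> exists (K : set nat) (e : nat -> X),
  [/\ forall k, K k -> E (e k) /\ dist w (e k) < 3 / 5 * r,
     trivIset K (fun k => ball (e k) (4 * (dl * r)) : set X) &
     ((r `^ (- q) * m w r)%:E <= \esum_(k in K) ((dl * r) `^ (- q) * m (e k) (dl * r))%:E)%E].
Proof.
have [C C0 hC] := ball_mass_compare mopen mupos mudbl 9.
have [D D0 hD] := ball_mass_compare mopen mupos mudbl 2.
have cCD : 0 < c / (C * D) by rewrite divr_gt0 ?mulr_gt0.
have qQ0 : 0 < q - Q by rewrite subr_gt0.
have [t [t0 tE]] := exists_powR_root cCD qQ0.
have [dl [dl0 dl1 dlt]] : exists dl : R, [/\ 0 < dl, dl <= 10^-1 & dl <= t].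
  by exists (Num.min t 10^-1); rewrite lt_min t0 invr_gt0 ltr0n !ge_min !lexx orbT.
exists dl; rewrite dl0; split=> // w r Ew r0 rE.
have [s [s0 sE]] : exists s, 0 < s /\ s = dl * r by exists (dl * r); rewrite mulr_gt0.
rewrite -sE; have sr : s <= 10^-1 * r by rewrite sE ler_pM2r.
pose F := E `&` ball w (r / 2 + s).
have sub z : F z -> ball z (4 * s) `<=` ball w r.
  by move=> [_]; rewrite in_ballE => zw; apply: ball_sub; move: zw sr; lra.
have s40 : 0 < 4 * s by rewrite mulr_gt0.
have Wfin : (mu (ball w r) < +oo)%E by rewrite ball_massE// ltry.
have [K [e [KF tK cov]]] :=
  neighborhood_packing mopen mupos w s s40 (measurable_ball mopen w r) Wfin sub.
exists K, e; split => //.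
  move=> k /KF[Ek]; rewrite in_ballE => wk; split => //; move: wk sr; lra.
have s2 : s < r / 2 by move: sr; lra.
have rE2 : ((r / 2)%:E < diam E)%E.
  by apply: le_lt_trans rE; rewrite lee_fin ler_pdivrMr// ler_peMr ?(ltW r0)// ler1n.
have Fs : ((c * (s / (r / 2)) `^ Q * m w (r / 2))%:E <= mu (neighborhood F s))%E.
  apply: le_trans (lower Ew _ rE2) _; first by rewrite s0.
  apply: le_measure; [|exact/mem_set/mopen/neighborhood_open|].
    apply/mem_set/measurableI; [exact/mopen/neighborhood_open|exact: measurable_ball].
  move=> x [/neighborhoodP[a Ea xa]]; rewrite in_ballE => wx; apply/neighborhoodP; exists a => //.
  by split => //; rewrite in_ballE; have := metric_triangle w x a; lra.
have Ks : (mu (neighborhood F s) <= \esum_(k in K) (C * m (e k) s)%:E)%E.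
  apply: (le_trans cov); apply: le_esum => k _.
  have s9 : 2 * (4 * s) + s = 9 * s by ring.
  rewrite s9 ball_massE ?mulr_gt0// lee_fin; apply: hC => //; first by rewrite mulr_gt0.
  by rewrite mdistxx add0r.
have sq : 0 < s `^ (- q) by rewrite powR_gt0.
have fac : 0 <= s `^ (- q) / C by rewrite divr_ge0 ?(ltW sq) ?(ltW C0).
rewrite (_ : \esum_(k in K) _ = (s `^ (- q) / C)%:E * \esum_(k in K) (C * m (e k) s)%:E)%E; last first.
  rewrite -ge0_esumZl//; last first.
    by move=> k _; rewrite lee_fin mulr_ge0 ?(ltW C0) ?(ltW (ball_mass_gt0 _ _ _)).
  by apply: eq_esum => k _; rewrite -EFinM; congr EFin; field; rewrite gt_eqF.
have le0 : (0 <= (s `^ (- q) / C)%:E)%E by rewrite lee_fin.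
apply: le_trans (lee_wpmul2l le0 (le_trans Fs Ks)).
rewrite -EFinM lee_fin.
have mD : m w r <= D * m w (r / 2).
  by apply: hD; rewrite ?divr_gt0// mdistxx add0r mulrC divfK.
have sQ : dl `^ Q <= (s / (r / 2)) `^ Q.
  apply: ge0_ler_powR; rewrite ?nnegrE ?divr_ge0 ?(ltW dl0) ?(ltW s0) ?(ltW r0)//.
  rewrite sE invf_div mulrA -mulrA mulrC.
  by rewrite (_ : _ / r * (dl * r) = 2 * dl) ?ler_peMl ?(ltW dl0) ?ler1n//; field; rewrite gt_eqF.
have dlq : dl `^ q <= c / (C * D) * dl `^ Q.
  have -> : q = (q - Q) + Q by rewrite subrK.
  rewrite powRD; last by rewrite (gt_eqF dl0) implybT.
  rewrite ler_wpM2r ?powR_ge0// -tE; apply: ge0_ler_powR; rewrite ?nnegrE ?(ltW qQ0) ?(ltW dl0) ?(ltW t0)//.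
have dlq0 : 0 < dl `^ q by rewrite powR_gt0.
have mr0 := ball_mass_gt0 mupos w r0.
apply: (@le_trans _ _ (s `^ (- q) / C * (c * dl `^ Q * (D^-1 * m w r)))); last first.
  rewrite ler_wpM2l//; apply: ler_pM; rewrite ?mulr_ge0 ?powR_ge0 ?invr_ge0 ?(ltW D0) ?(ltW c0) ?(ltW mr0)//.
    by rewrite ler_wpM2l// ltW.
  by rewrite ler_pdivrMl.
rewrite sE powRM ?(ltW dl0) ?(ltW r0)// (powRN dl).
rewrite [leRHS](_ : _ = r `^ (- q) * m w r * ((dl `^ q)^-1 * (c / (C * D) * dl `^ Q))).
  by rewrite ler_peMr ?mulr_ge0 ?powR_ge0 ?(ltW mr0)// mulrC ler_pdivlMr// mul1r.
by field; rewrite !gt_eqF.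
Qed.

Definition meeting (K : set nat) (x : nat -> X) (r : nat -> R) (w : X) (t : R) : set nat :=
  [set k | K k /\ ball (x k) (r k) `&` ball w t !=set0].

Definition small_cover (eta : R) (K : set nat) (x : nat -> X) (r : nat -> R) (w : X) (t : R) : Prop :=
  [/\ E w, 0 < t, (t%:E < diam E)%E,
    forall k, meeting K x r w t k -> r k <= t &
    (\esum_(k in meeting K x r w t) (mu (ball (x k) (r k)) * (r k `^ (- q))%:E) <
      (eta * (t `^ (- q) * m w t))%:E)%E].

(* A cover ball which is small compared with the children meets at most one of them, and a
   large one alone already carries the sum, so the sums over the children cannot all
   be large. *)
Lemma cover_descent : exists eta dl : R, [/\ 0 < eta, 0 < dl <= 10^-1 &
  forall K (x : nat -> X) (r : nat -> R) w t, (forall k, K k -> 0 < r k) -> small_cover eta K x r w t ->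
  exists w', small_cover eta K x r w' (dl * t) /\ dist w w' < 3 / 5 * t].
Proof.
have [dl [/andP[dl0 dl1] children]] := codim_children.
have [D D0 hD] := ball_mass_compare mopen mupos mudbl (3 / dl).
exists D^-1, dl; rewrite invr_gt0 dl0; split => // K x r w t rpos [Ew t0 tE rt st].
pose a k := (mu (ball (x k) (r k)) * (r k `^ (- q))%:E)%E.
have [s [s0 sE]] : exists s, 0 < s /\ s = dl * t by exists (dl * t); rewrite mulr_gt0.
have sm : s <= 10^-1 * t by rewrite sE ler_pM2r.
have a0 k : (0 <= a k)%E by rewrite mule_ge0// lee_fin powR_ge0.
have rs k : meeting K x r w t k -> r k < s.
  move=> Nk; have [Kk [y [xy wy]]] := Nk; rewrite ltNge; apply/negP => sk.
  have rk0 := rpos k Kk; have rkt := rt k Nk.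
  move: st; rewrite ltNge => /negP; apply.
  apply: (@le_trans _ _ (a k)); last first.
    rewrite -[leLHS](@esum_set1 R nat k a)//; apply: esum_le_subset.
    by move=> _ ->.
  rewrite /a ball_massE// -EFinM lee_fin mulrC -ler_pdivlMr ?invr_gt0// invrK mulrC.
  have tq : t `^ (- q) <= r k `^ (- q).
    rewrite !powRN lef_pV2 ?posrE ?powR_gt0//.
    by apply: ge0_ler_powR; rewrite ?nnegrE ?(ltW q0) ?(ltW rk0) ?(ltW t0).
  have mk : m w t <= D * m (x k) (r k).
    apply: hD => //; move: xy wy; rewrite !in_ballE => xy wy.
    apply: (@le_trans _ _ (3 * t)).
      have := metric_triangle w y (x k); rewrite (metric_sym y); lra.
    by rewrite mulrAC ler_pdivlMr// -mulrA ler_pM2l// mulrC -sE.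
  rewrite mulrAC [m (x k) (r k) * D]mulrC; apply: ler_pM => //; rewrite ?powR_ge0 ?(ltW (ball_mass_gt0 _ _ _))//.
have [K' [e [Ke tK sumK]]] := children w t Ew t0 tE; rewrite -sE in tK sumK *.
have sub k : K' k -> meeting K x r (e k) s `<=` meeting K x r w t.
  move=> /Ke[_ we] i [Ki [y [xy ey]]]; split => //; exists y; split => //.
  by apply: ball_sub ey; move: we sm; lra.
have tM : trivIset K' (fun k => meeting K x r (e k) s).
  move=> i j Ki Kj [k [ik jk]]; apply: tK => //.
  have rk := rs _ (sub _ Ki _ ik).
  case: ik => [_ [y [xy iy]]]; case: jk => [_ [z [xz jz]]].
  exists (e j); split; last by apply: ballxx; rewrite mulr_gt0.
  have := ball_dist_le xy xz; move: iy jz; rewrite !in_ballE.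
  have := metric_triangle (e i) y (e j); have := metric_triangle y z (e j); rewrite (metric_sym z); lra.
have [k Kk lt] : exists2 k, K' k &
    (\esum_(i in meeting K x r (e k) s) a i < (D^-1 * (s `^ (- q) * m (e k) s))%:E)%E.
  apply: contrapT => hn; move: st; rewrite ltNge => /negP; apply.
  apply: le_trans (esum_disjoint_le a0 tM sub).
  rewrite EFinM; apply: le_trans (_ : _ <= D^-1%:E * \esum_(k in K') (s `^ (- q) * m (e k) s)%:E)%E _.
    by apply: lee_wpmul2l => //; rewrite lee_fin invr_ge0 ltW.
  rewrite -ge0_esumZl ?invr_ge0 ?(ltW D0)//; last first.
    by move=> k _; rewrite lee_fin mulr_ge0 ?powR_ge0 ?(ltW (ball_mass_gt0 _ _ _)).
  by apply: le_esum => k Kk; rewrite leNgt; apply/negP => h; apply: hn; exists k.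
exists (e k); have [Ee wek] := Ke k Kk; split => //; split => //.
- by apply: le_lt_trans tE; rewrite lee_fin (le_trans sm)// ler_piMl ?(ltW t0)// invf_le1 ?ler1n ?ltr0n.
- by move=> i /(sub _ Kk)/rs/ltW.
Qed.

(* Descending through the children of a cover with small sum gives points of [E]
   converging to a point which the cover misses. *)
Lemma codim_content_density : content_density mu q E.
Proof.
have [eta [dl [eta0 /andP[dl0 dl1] descent]]] := cover_descent.
have dl12 : 0 < dl <= 2^-1 by rewrite dl0 (le_trans dl1)// lef_pV2 ?posrE ?ltr0n// ler_nat.
exists eta => // w t Ew t0 tE; apply: le_ereal_inf_tmp => _ [K [x [r [rK cov ->]]]].
have rpos k : K k -> 0 < r k by move=> /rK/andP[].
rewrite leNgt; apply/negP => lt.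
pose small := small_cover eta K x r.
have sm0 : small w t.
  split => //; first by move=> k [/rK/andP[]].
  apply: (@le_lt_trans _ _ (\esum_(k in K) (mu (ball (x k) (r k)) * (r k `^ (- q))%:E))%E).
    by apply: esum_le_subset => k [].
  by rewrite mulrA EFinM -ball_massE.
pose T := {b : X * R | small b.1 b.2}.
have next (b : T) : {b' : T | (sval b').2 = dl * (sval b).2 /\
    dist (sval b).1 (sval b').1 < 3 / 5 * (sval b).2}.
  apply: cid; have [w' [sw' dw']] := descent _ _ _ _ _ rpos (svalP b).
  by exists (exist _ (w', dl * (sval b).2) sw').
have [f [f0 fS]] := dependent_choice next (exist _ (w, t) sm0).
have f2 n : (sval (f n)).2 = t * dl ^+ n.
  elim: n => [|n IH]; first by rewrite f0 expr0 mulr1.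
  by have [-> _] := fS n; rewrite IH exprS mulrCA.
have tn n : 0 < t * dl ^+ n by rewrite mulr_gt0 ?exprn_gt0.
have fdist n : dist (sval (f n)).1 (sval (f n.+1)).1 < t * dl ^+ n.
  have [_ h] := fS n; apply: (lt_le_trans h); rewrite f2 ler_piMl ?(ltW (tn n))//.
  by rewrite ler_pdivrMr// mul1r ler_nat.
have [l fl] := geometric_steps_limit t0 dl12 fdist.
have El : E l.
  apply: cE => B /nbhs_ballP[e /= e0 eB].
  have [n hn] := @expr_half_lt R (2 * t) e dl ltac:(by rewrite mulr_gt0) e0 dl12.
  exists (sval (f n)).1; split; first by have [] := svalP (f n).
  by apply: eB; rewrite in_ballE metric_sym (le_lt_trans (fl n))// mulrA.
have wl : ball w t l.
  have := fl 1%N; have [_] := fS 0%N; rewrite f2 f0/= expr1 expr0 mulr1 in_ballE => h1 h2.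
  have := metric_triangle w (sval (f 1%N)).1 l; have : t * dl <= t / 10 by rewrite ler_pM2l.
  move: h1 h2; lra.
have [k Kk kl] := cov l (conj El (subset_closure wl)).
rewrite in_ballE in kl.
have [n hn] := @expr_half_lt R (2 * t) (r k - dist (x k) l) dl
  ltac:(by rewrite mulr_gt0) ltac:(by rewrite subr_gt0) dl12.
have [_ _ _ rk _] := svalP (f n).
have : r k <= t * dl ^+ n.
  rewrite -f2; apply: rk; split => //; exists (sval (f n)).1; split; last first.
    by apply: ballxx; rewrite f2.
  rewrite in_ballE; have := fl n; have := metric_triangle (x k) l (sval (f n)).1.
  rewrite (metric_sym l); move: hn; rewrite -mulrA; lra.
have := tn n; have := mdist_ge0 (x k) l; move: hn; rewrite -mulrA; lra.
Qed.

End content_lower_bound.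

Lemma upper_codim_content_density (R : realType) (d : measure_display)
    (X : completeMetricMeasurableType R d) (mu : {measure set X -> \bar R})
    (E : set X) (b : R) :
  (forall A : set X, open A -> measurable A) -> balls_pos_finite mu -> doubling mu ->
  closed E -> 0 < b -> (upper_codim mu E < b%:E)%E ->
  exists2 q, 0 < q < b & content_density mu q E.
Proof.
move=> mopen mupos mudbl cE b0 /ereal_inf_lt[_ [Q [Q0 [c c0 h]] <-]]; rewrite lte_fin => Qb.
exists ((Q + b) / 2); first by apply/andP; split; lra.
apply: (@codim_content_density R d X mu mopen mupos mudbl E Q _ c cE Q0 _ c0); first lra.
move=> w r r' Ew rr' r'E; have r'0 : 0 < r' by case/andP: rr' => /lt_trans; apply.
have := h w r r' Ew rr' (or_intror r'E); have m0 := ball_mass_gt0 mupos w r'0.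
by rewrite ball_massE// inver gt_eqF// lee_pdivlMr// -EFinM.
Qed.

Theorem theorem9p5 (R : realType) (d : measure_display)
    (X : completeMetricMeasurableType R d) (mu : {measure set X -> \bar R})
    (hX : exists x y : X, x <> y)
    (hmu : complete_borel_regular mu)
    (hballs : balls_pos_finite mu)
    (hdoubling : doubling mu)
    (hgeo : geodesic_space X)
    (p beta : R) (hp : 1 < p) (hbeta : 0 < beta <= 1)
    (E : set X) (hE : closed E) (hE1 : forall x : X, E <> [set x]) :
  [<-> (upper_codim mu E < (beta * p)%:E)%E;
       exists2 q : R, 0 < q < beta * p & content_density mu q E;
       capacity_density mu beta p E;
       local_boundary_poincare mu beta p E;
       maximal_boundary_poincare mu beta p E;
       local_hardy mu beta p E].
Proof.
have [mopen _ _] := hmu; have /andP[beta0 _] := hbeta.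
have p0 : 0 < p by exact: lt_trans hp.
have bp0 : 0 < beta * p by rewrite mulr_gt0.
have content : (upper_codim mu E < (beta * p)%:E)%E ->
    exists2 q : R, 0 < q < beta * p & content_density mu q E.
  exact: upper_codim_content_density.
have thick : thick_scales mu p beta E -> (upper_codim mu E < (beta * p)%:E)%E.
  exact: thick_scales_upper_codim.
have test : vanishing_test_bound mu p beta E ->
    exists2 q : R, 0 < q < beta * p & content_density mu q E.
  by move/(vanishing_test_bound_thick mopen hballs hp hbeta hE)/thick/content.
tfae => //.
- by move=> [q /andP[q0 qp] dens]; exact: (content_capacity_density mopen hballs hdoubling hgeo beta0 dens).
- move=> /(capacity_density_thick mopen hballs hdoubling hp hbeta)/thick/content[q /andP[q0 qp] dens].
  exact: (content_local_boundary_poincare mopen hballs hdoubling hX hgeo beta0 dens).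
- move=> /(local_boundary_poincare_test mopen hballs hdoubling hX hgeo hp hbeta)/test[q /andP[q0 qp] dens].
  exact: (content_maximal_boundary_poincare mopen hballs hdoubling hX hgeo beta0 hp qp dens).
- move=> /(maximal_boundary_poincare_test mopen hballs hdoubling hX hgeo hp hbeta)/test[q /andP[q0 qp] dens].
  have qbp : q / beta < p by rewrite ltr_pdivrMr// mulrC.
  have qb0 : 0 < q / beta by rewrite divr_gt0.
  apply: (content_local_hardy mopen hballs hdoubling beta0 dens (p' := (q / beta + p) / 2)).
    by apply/andP; split; lra.
  by rewrite mulrC -ltr_pdivrMr//; lra.
- move=> /(local_hardy_test mopen hballs hdoubling hgeo hp hbeta).
  by move=> /(vanishing_test_bound_thick mopen hballs hp hbeta hE)/thick.
Qed.
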